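(* Let $A$ be the random hypergraph tensor built from a symmetric continuous $g:[0,1]^3\to[0,1]$, let $\mathbb P_A$ denote the law of $A$, and, conditionally on $A$, let $X\sim P^A_{\beta_0,h_0}$ for fixed $\beta_0,h_0\in\mathbb R$. The following conditional conclusions hold on an event (depending on $A$ only) with $\mathbb P_A$-probability tending to one as $N\to\infty$; that is, in each part there are events $\mathcal E_N$ measurable with respect to $A$ with $\mathbb P_A(\mathcal E_N)\to1$ such that the conclusion holds for every deterministic sequence of realizations of $A$ lying in $\mathcal E_N$. (a) If $G$ is not constant and $\Lambda'(h_0)\ne0$, then $T_N(X)=\Omega_{P^A_{\beta_0,h_0}}(1)$. Consequently, the maximum pseudo-likelihood estimator (MPLE) exists with $P^A_{\beta_0,h_0}$-probability tending to one and is jointly $\sqrt N$-consistent for $(\beta_0,h_0)$. (b) Assume that $G\equiv\bar G$, that $\inf_{[0,1]^3}g>0$, and that $\mu$ is stochastically non-negative. If $\beta_0>0$, $h_0\ge0$, and either $h_0>0$ or $\kappa_-\ge0$, then $T_N(X)=o_{P^A_{\beta_0,h_0}}(1)$.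
   Context: Setting. $\kappa_-<\kappa_+$ are real numbers, $\mu$ is a fixed probability measure on $[\kappa_-,\kappa_+]$ with $\kappa_-,\kappa_+\in\mathrm{supp}(\mu)$, and $\Lambda(\lambda)=\log\int e^{\lambda z}\,d\mu(z)$. Random tensor: $g:[0,1]^3\to[0,1]$ is symmetric and continuous. For each unordered triple $\{i,j,k\}\subset[N]$ of distinct indices let $\xi_{\{i,j,k\}}\sim\mathrm{Ber}(g(i/N,j/N,k/N))$, independently over triples. Set $A_{ijk}=N^{-2}\xi_{\{i,j,k\}}$ if $i,j,k$ are distinct and $A_{ijk}=0$ otherwise. Put $G(x)=\int_{[0,1]^2}g(x,y,z)\,dy\,dz$ and $\bar G=\int_{[0,1]^3}g(x,y,z)\,dx\,dy\,dz$. Conditionally on $A$, $P^A_{\beta,h}$ is the probability measure on $[\kappa_-,\kappa_+]^N$ with $$\frac{dP^A_{\beta,h}}{d\mu^{\otimes N}}(x)=\frac1{Z_N(\beta,h)}\exp\Big(\frac\beta3\sum_{i,j,k}A_{ijk}x_ix_jx_k+h\sum_ix_i\Big).$$ Put $m_i(x)=\sum_{j,k}A_{ijk}x_jx_k$, $\bar m(x)=\frac1N\sum_im_i(x)$, $T_N(x)=\frac1N\sum_i(m_i(x)-\bar m(x))^2$. Rate function: $I(t)=\sup_{\lambda\in\mathbb R}(\lambda t-\Lambda(\lambda))\in[0,\infty]$ for $t\in\mathbb R$. The measure $\mu$ is stochastically non-negative if $I(t)\le I(-t)$ for all $t\ge0$. MPLE: given $x$ (and $A$), $(\hat\beta,\hat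 h)$ is the unique solution $(\beta,h)\in\mathbb R^2$ (if there is a unique solution, in which case it is said to exist) of $$\sum_i m_i(x)\big(x_i-\Lambda'(\beta m_i(x)+h)\big)=0,\qquad \sum_i\big(x_i-\Lambda'(\beta m_i(x)+h)\big)=0.$$ Jointly $\sqrt N$-consistent means $\max(|\hat\beta-\beta_0|,|\hat h-h_0|)=O_p(N^{-1/2})$ under $P^A_{\beta_0,h_0}$. $T_N(X)=o_P(1)$ means $T_N(X)\to0$ in $P$-probability; $T_N(X)=\Omega_P(1)$ means $P(T_N(X)\le\varepsilon_N)\to0$ for every deterministic sequence $\varepsilon_N\to0$. *)

(* Defs.v *)
From HB Require Import structures.
From mathcomp Require Import all_boot all_order all_algebra.
From mathcomp Require Import all_classical all_reals all_analysis.

Set Implicit Arguments.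
Unset Strict Implicit.
Unset Printing Implicit Defensive.
Import Order.TTheory GRing.Theory Num.Theory.
Import numFieldNormedType.Exports.

Local Open Scope classical_set_scope.
Local Open Scope ring_scope.

Section product_law.
Context d (T : measurableType d) (R : realType).

Definition tuple_cons n (z : T * n.-tuple T) : n.+1.-tuple T :=
  [tuple of z.1 :: z.2].

Lemma measurable_tuple_cons n : measurable_fun [set: _] (@tuple_cons n).
Proof. by apply: measurable_cons. Qed.

HB.instance Definition _ n := isMeasurableFun.Build _ _ _ _
  (@tuple_cons n) (@measurable_tuple_cons n).

Fixpoint prod_law (mu : probability T R) (n : nat) :
    probability (n.-tuple T) R :=
  match n with
  | 0 => \d_[tuple]
  | m.+1 => distribution (mu \x prod_law mu m)%E (@tuple_cons m)
  end.

Lemma prod_lawE (mu : probability T R) n (B : 'I_n -> set T) :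
  (forall i, measurable (B i)) ->
  prod_law mu n [set x | forall i, B i (tnth x i)] = (\prod_(i < n) mu (B i))%E.
Proof.
elim: n B => [|n IH] B mB.
  rewrite big_ord0 /= diracE mem_set//.
  by case.
rewrite big_ord_recl -IH; last by move=> i; exact: mB.
rewrite /= /distribution /pushforward /=.
rewrite -product_measure1E//; last first.
  rewrite (_ : mkset _ = \big[setI/setT]_(i < n)
      ((fun x : n.-tuple T => tnth x i) @^-1` B (lift ord0 i))).
    apply: bigsetI_measurable => i _; rewrite -[X in measurable X]setTI.
    by apply: measurable_tnth.
  rewrite -bigcap_seq; apply/seteqP; split => x /= h i.
    by move=> _; exact: h.
  by apply: h; rewrite /= mem_index_enum.
congr (_ _); apply/seteqP; split => -[x y] /= h.
  split; first exact: (h ord0).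
  by move=> i; have := h (lift ord0 i); rewrite /tuple_cons tnthS.
case: h => h0 h i; case: (unliftP ord0 i) => [j ->|->] //.
by rewrite /tuple_cons tnthS; exact: h.
Qed.

End product_law.

Section base_measure.
Context (R : realType).
Implicit Types mu : probability (measurableTypeR R) R.

Definition supp mu : set R :=
  [set x | forall U : set R, open U -> U x -> (0 < mu U)%E].

Definition Lambda mu (l : R) : R := ln (\int[mu]_z expR (l * z)).

Definition rate mu (t : R) : \bar R :=
  ereal_sup [set (l * t - Lambda mu l)%:E | l in [set: R]].

Definition stochastically_nonneg mu : Prop :=
  forall t : R, 0 <= t -> (rate mu t <= rate mu (- t))%E.

End base_measure.

Section kernel.
Context (R : realType).
Local Notation leb := (@lebesgue_measure R).
Implicit Types g : R * R * R -> R.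

(* Only the restriction of [g] to the unit cube is ever used. *)
Definition cube : set (R * R * R) := `[0, 1] `*` `[0, 1] `*` `[0, 1].

Definition symmetric3 g : Prop := forall x y z, cube (x, y, z) ->
  g (x, y, z) = g (y, x, z) /\ g (x, y, z) = g (x, z, y).

Definition degree_fun g (x : R) : R :=
  \int[(leb \x leb)%E]_(p in `[0, 1] `*` `[0, 1]) g (x, p.1, p.2).

Definition mean_density g : R :=
  \int[((leb \x leb) \x leb)%E]_(p in cube) g p.

End kernel.

(* Unordered triples of distinct indices; the index [i : 'I_N] stands for the
   element [i.+1] of {1, ..., N}. *)
Definition triple (N : nat) : Type := {e : {set 'I_N} | #|e| == 3%N}.
HB.instance Definition _ N := Finite.on (triple N).

Definition hypergraph (N : nat) : Type := {ffun triple N -> bool}.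
HB.instance Definition _ N := Finite.on (hypergraph N).

Section random_tensor.
Context (R : realType).

(* For symmetric [g] the order in which the three indices are listed is
   irrelevant. *)
Definition edge_prob (g : R * R * R -> R) N (e : triple N) : R :=
  let s := [seq (val i).+1%:R / N%:R | i <- enum (val e)] in
  g (s`_0, s`_1, s`_2).

(* Law of the family of independent Bernoulli variables indexed by triples.
   Since [xi] and [tensor xi] determine each other, sets of hypergraphs are
   exactly the events measurable with respect to the tensor. *)
Definition hypergraph_prob (g : R * R * R -> R) N (E : {set hypergraph N}) : R :=
  \sum_(xi in E) \prod_(e : triple N) bernoulli_pmf (edge_prob g e) (xi e).

(* [insub] fails exactly when [i], [j], [k] are not pairwise distinct. *)
Definition tensor N (xi : hypergraph N) (i j k : 'I_N) : R :=
  if (insub [set i; j; k]%SET : option (triple N)) is Some e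
  then N%:R ^- 2 * (xi e)%:R else 0.

End random_tensor.

Section model.
Context (R : realType) (N : nat).
Implicit Types (mu : probability (measurableTypeR R) R)
  (A : 'I_N -> 'I_N -> 'I_N -> R) (x : N.-tuple (measurableTypeR R)).

Definition hamiltonian A (b h : R) x : R :=
  b / 3%:R * (\sum_i \sum_j \sum_k A i j k * tnth x i * tnth x j * tnth x k)
  + h * \sum_i tnth x i.

Definition partition_fun mu A (b h : R) : R :=
  \int[prod_law mu N]_x expR (hamiltonian A b h x).

Definition gibbs mu A (b h : R) (B : set (N.-tuple (measurableTypeR R))) : \bar R :=
  \int[prod_law mu N]_(x in B)
    (expR (hamiltonian A b h x) / partition_fun mu A b h)%:E.

Definition local_field A x (i : 'I_N) : R :=
  \sum_j \sum_k A i j k * tnth x j * tnth x k.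

Definition mean_field A x : R := N%:R^-1 * \sum_i local_field A x i.

Definition Tstat A x : R :=
  N%:R^-1 * \sum_i (local_field A x i - mean_field A x) ^+ 2.

Definition score_zero mu A x (bh : R * R) : Prop :=
  \sum_i local_field A x i *
    (tnth x i - derive1 (Lambda mu) (bh.1 * local_field A x i + bh.2)) = 0 /\
  \sum_i (tnth x i - derive1 (Lambda mu) (bh.1 * local_field A x i + bh.2)) = 0.

Definition is_mple mu A x (bh : R * R) : Prop :=
  score_zero mu A x bh /\ forall bh', score_zero mu A x bh' -> bh' = bh.

End model.

Section modes.
Context (R : realType).
Variable P : forall N, set (N.-tuple (measurableTypeR R)) -> \bar R.
Implicit Types T : forall N, N.-tuple (measurableTypeR R) -> R.

Definition littleo_P T : Prop := forall eps : R, 0 < eps ->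
  P [set x : N.-tuple _ | eps < `|T N x|] @[N --> \oo] --> 0%E.

Definition Omega_P T : Prop := forall eps : nat -> R, eps @ \oo --> 0 ->
  P [set x : N.-tuple _ | T N x <= eps N] @[N --> \oo] --> 0%E.

(* Probabilities of the events about the estimator are bounded through the
   outer measure of the complement, so that measurability of these events need
   not be presupposed; on measurable events this is the ordinary probability. *)
Definition mple_exists_whp mu (A : forall N, 'I_N -> 'I_N -> 'I_N -> R) : Prop :=
  (@P N)^*%mu (~` [set x | exists bh, is_mple mu (@A N) x bh])
    @[N --> \oo] --> 0%E.

Definition mple_sqrt_consistent mu (A : forall N, 'I_N -> 'I_N -> 'I_N -> R)
    (b0 h0 : R) : Prop :=
  forall eps : R, 0 < eps -> exists2 K : R, 0 < K & \forall N \near \oo,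
    ((@P N)^*%mu (~` [set x | exists bh, is_mple mu (@A N) x bh /\
        (Num.max `|bh.1 - b0| `|bh.2 - h0| <= K / Num.sqrt N%:R)%R])
      <= eps%:E)%E.

End modes.

(* Main.v *)
(* With probability tending to one, the tensor [A] is so close to its mean that
   [sum_ijk (A - E A)_ijk x_i y_j z_k] is bounded by a constant times
   [max |x| * max |y| * max |z|], uniformly in [x], [y], [z] and [N]; this is
   the event used in both parts.

   (a) Let [m_i] be the local fields and [t = Lambda']. Under the Gibbs measure
   the sums [sum_j (x_j - t (b m_j + h)) phi_j] are of order [sqrt N] for
   weights [phi_j] which do not depend on [x_j] and hardly depend on each other
   spin. If [T_N] is small, all [m_j] are nearly equal to their mean and hence
   [m_i] is close to [c ^ 2 * d_i], where [c] is the common value of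
   [t (b m_j + h)] and [d_i] is the degree of [i]. The degrees are not nearly
   constant, so [c] and then all [m_i] nearly vanish, whence [c] is close to
   [t h <> 0], a contradiction. When [T_N] is bounded below, the log
   pseudo-likelihood is strongly concave near [(b, h)] and its gradient there is
   [O(sqrt N)], so it has a critical point at distance [O(1 / sqrt N)].

   (b) By uniform continuity of [g] the Hamiltonian depends on [x] only through
   the averages [y] of [x] over finitely many blocks of indices, up to [o(N)].
   Replacing [y_i] by its absolute value and [g] by its constant degree
   increases the energy; by the AM-GM inequality (here [inf g > 0] is used) the
   loss is of order [N] unless [y] is nearly constant, which forces [T_N] to be
   small. The maximal energy minus entropy is reached by product measures, which
   bound the partition function from below by Jensen's inequality, while for
   the upper bound the Gibbs weight is covered by finitely many product tilts
   for each block; stochastic non-negativity of [mu] controls the entropy at the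
   negative [y_i]. So configurations with large [T_N] have exponentially small
   probability. *)

Require Import Defs.
From mathcomp Require Import all_boot all_order all_algebra.
From mathcomp Require Import all_classical all_reals all_analysis.
From mathcomp Require Import measurable_realfun.
From mathcomp Require Import ring lra.

Set Implicit Arguments.
Unset Strict Implicit.
Unset Printing Implicit Defensive.
Import Order.TTheory GRing.Theory Num.Theory.
Import numFieldNormedType.Exports.

Local Open Scope classical_set_scope.
Local Open Scope ring_scope.

(** * Expectations under product measures *)

(** The tensor error can be bounded by a constant because, for fixed signs, it is a sum of about
    [N ^ 3] independent centred terms of size [N ^ - 2]. Its variance is of order [1 / N], so
    exceeding a constant is exponentially unlikely in [N], at a rate that grows with the constant
    and thus beats the entropy of the sign vectors. Conditioning is never formalized: a spin is
    integrated out by overwriting one coordinate. One spin moves a local field by only [O(1 / N)],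
    so decoupling a pair of spins costs [O(1 / N)], and the [N ^ 2] pairs contribute no more than
    the [N] diagonal terms. In (b) the obstacle is the rate function: it may be infinite, and its
    optimal tilt need not exist at the ends of the interval. It enters only through its affine
    minorants [l * z - Lambda l], which are exactly the exponents of product tilts, so no large
    deviation principle is needed. The numbers of blocks and of minorants are fixed before [N], so
    that their combinatorial cost is a constant against a gain exponential in [N]. *)

Section expectation.
Context d (T : measurableType d) (R : realType) (P : probability T R).
Variable B : set T.
Hypothesis mB : measurable B.
Implicit Types (F G : T -> R) (C : R).

(** Measurability is global but boundedness is only on [B]: polynomials in the spins are unbounded
    on the whole space and bounded on the box that carries the measure. The class is closed under
    the operations used below, so integrability never needs a separate argument. *)
Definition bmeas F : Prop :=
  measurable_fun [set: T] F /\ exists C, forall x, B x -> `|F x| <= C.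

(* Locked, as comparing two integrals by conversion is prohibitively slow. *)
Definition expect : (T -> R) -> R := locked (fun F => \int[P]_(x in B) F x).

Lemma expectE F : expect F = \int[P]_(x in B) F x.
Proof. by rewrite /expect -lock. Qed.

Lemma bmeas_cst C : bmeas (fun=> C).
Proof. by split; [exact: measurable_cst|exists `|C|]. Qed.

Lemma bmeasD F G : bmeas F -> bmeas G -> bmeas (fun x => F x + G x).
Proof.
move=> [mF [C FC]] [mG [D GD]]; split; first exact: measurable_funD.
by exists (C + D) => x Bx; rewrite (le_trans (ler_normD _ _))// lerD// ?FC ?GD.
Qed.

Lemma bmeasM F G : bmeas F -> bmeas G -> bmeas (fun x => F x * G x).
Proof.
move=> [mF [C FC]] [mG [D GD]]; split; first exact: measurable_funM.
by exists (C * D) => x Bx; rewrite normrM ler_pM// ?FC ?GD.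
Qed.

Lemma bmeasN F : bmeas F -> bmeas (fun x => - F x).
Proof.
move=> [mF [C FC]]; split; first exact: measurable_funN.
by exists C => x Bx; rewrite normrN FC.
Qed.

Lemma bmeasB F G : bmeas F -> bmeas G -> bmeas (fun x => F x - G x).
Proof. by move=> bF bG; exact: (bmeasD bF (bmeasN bG)). Qed.

Lemma bmeasX F n : bmeas F -> bmeas (fun x => F x ^+ n).
Proof.
move=> bF; elim: n => [|n IH]; first exact: bmeas_cst.
by under eq_fun do rewrite exprS; exact: bmeasM.
Qed.

Lemma bmeas_sum (I : Type) (r : seq I) (Q : pred I) (F : I -> T -> R) :
  (forall i, bmeas (F i)) -> bmeas (fun x => \sum_(i <- r | Q i) F i x).
Proof.
move=> bF; elim: r => [|i r IH].
  by under eq_fun do rewrite big_nil; exact: bmeas_cst.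
under eq_fun do rewrite big_cons.
by case: (Q i) => //; exact: bmeasD.
Qed.

Lemma bmeas_prod (I : Type) (r : seq I) (Q : pred I) (F : I -> T -> R) :
  (forall i, bmeas (F i)) -> bmeas (fun x => \prod_(i <- r | Q i) F i x).
Proof.
move=> bF; elim: r => [|i r IH].
  by under eq_fun do rewrite big_nil; exact: bmeas_cst.
under eq_fun do rewrite big_cons.
by case: (Q i) => //; exact: bmeasM.
Qed.

Lemma bmeas_indic (A : set T) : measurable A -> bmeas (\1_A : T -> R).
Proof.
move=> mA; split; first exact: measurable_indic.
by exists 1 => x _; rewrite indicE; case: (_ \in _); rewrite ?normr0 ?normr1.
Qed.

Lemma bmeas_expR F : bmeas F -> bmeas (fun x => expR (F x)).
Proof.
move=> [mF [C FC]]; split.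
  by apply: measurableT_comp => //; exact: measurable_expR.
exists (expR C) => x Bx; rewrite ger0_norm ?expR_ge0// ler_expR.
by rewrite (le_trans (ler_norm _))// FC.
Qed.

Lemma bmeas_comp (f : R -> R) F : continuous f -> bmeas F ->
  bmeas (fun x => f (F x)).
Proof.
move=> cf [mF [C FC]]; split.
  by apply: (measurableT_comp (f := f)) => //; exact: continuous_measurable_fun.
have [C0|C0] := leP (- `|C|) `|C|; last first.
  by exists 0 => x /FC; have := normr_ge0 C; move: C0; lra.
have cf' : {within `[- `|C|, `|C|], continuous (fun x => `|f x|)}.
  apply: continuous_subspaceT => x.
  exact: cvg_norm (cf x).
have [c _ fc] := EVT_max C0 cf'.
exists `|f c| => x Bx; apply: fc; rewrite in_itv/= -ler_norml.
by rewrite (le_trans (FC _ Bx))// ler_norm.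
Qed.

Lemma bmeas_integrable F : bmeas F -> P.-integrable B (EFin \o F).
Proof.
move=> [mF [C FC]]; apply: measurable_bounded_integrable => //.
- by rewrite (le_lt_trans (probability_le1 P mB))// ltry.
- exact: measurable_funTS.
- exists C; split; first exact: num_real.
  by move=> y Cy x /= Bx; rewrite (le_trans (FC _ Bx))// ltW.
Qed.

Lemma expectD F G : bmeas F -> bmeas G ->
  expect (fun x => F x + G x) = expect F + expect G.
Proof. by move=> bF bG; rewrite !expectE RintegralD//; exact: bmeas_integrable. Qed.

Lemma expectZ C F : bmeas F -> expect (fun x => C * F x) = C * expect F.
Proof. by move=> bF; rewrite !expectE RintegralZl//; exact: bmeas_integrable. Qed.

Lemma expectZr C F : bmeas F -> expect (fun x => F x * C) = expect F * C.
Proof. by move=> bF; rewrite !expectE RintegralZr//; exact: bmeas_integrable. Qed.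

Lemma expectB F G : bmeas F -> bmeas G ->
  expect (fun x => F x - G x) = expect F - expect G.
Proof. by move=> bF bG; rewrite !expectE RintegralB//; exact: bmeas_integrable. Qed.

Lemma eq_expect F G : (forall x, B x -> F x = G x) -> expect F = expect G.
Proof. by move=> FG; rewrite !expectE; apply: eq_Rintegral => x; rewrite inE; exact: FG. Qed.

Lemma le_expect F G : bmeas F -> bmeas G -> (forall x, B x -> F x <= G x) ->
  expect F <= expect G.
Proof. by move=> bF bG FG; rewrite !expectE; apply: le_Rintegral => //; exact: bmeas_integrable. Qed.

Lemma expect_ge0 F : (forall x, B x -> 0 <= F x) -> 0 <= expect F.
Proof. by rewrite expectE; exact: Rintegral_ge0. Qed.

Lemma expect_sum (I : Type) (r : seq I) (Q : pred I) (F : I -> T -> R) :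
  (forall i, bmeas (F i)) ->
  expect (fun x => \sum_(i <- r | Q i) F i x) =
  \sum_(i <- r | Q i) expect (F i).
Proof.
move=> bF; elim: r => [|i r IH].
  rewrite big_nil (@eq_expect _ (fun=> 0)); last by move=> x _; rewrite big_nil.
  by rewrite !expectE Rintegral_cst// mul0r.
rewrite big_cons; under eq_expect do rewrite big_cons.
by case: (Q i) => //; rewrite expectD ?IH//; exact: bmeas_sum.
Qed.

Lemma le_norm_expect F : bmeas F -> `|expect F| <= expect (fun x => `|F x|).
Proof. by move=> bF; rewrite !expectE; apply: le_normr_Rintegral => //; exact: bmeas_integrable. Qed.

Hypothesis PB : P B = 1%E.

Lemma expect_cst C : expect (fun=> C) = C.
Proof.
rewrite !expectE Rintegral_cst//; transitivity (C * fine 1%E).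
  by congr (C * fine _).
by rewrite /= mulr1.
Qed.

Lemma expect_gt0 F (c : R) : bmeas F -> 0 < c -> (forall x, B x -> c <= F x) ->
  0 < expect F.
Proof.
move=> bF c0 cF; apply: (lt_le_trans c0); rewrite -(expect_cst c).
by apply: le_expect => //; exact: bmeas_cst.
Qed.

Lemma negligible_setC : P (~` B) = 0%E.
Proof. by rewrite probability_setC// PB subee. Qed.

(** The complement of [B] is a null set. Non-negativity stands in for integrability over the whole
    space, where [F] may be unbounded; this is how the integrals in [Lambda] and [partition_fun]
    become integrals over the box. *)
Lemma expectT F : measurable_fun setT F -> (forall x, 0 <= F x) ->
  \int[P]_x F x = expect F.
Proof.
move=> mF F0; rewrite !expectE /Rintegral; congr fine.
rewrite (@ge0_negligible_integral _ _ _ P setT (~` B))//.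
- by rewrite setTD setCK.
- exact: measurableC.
- exact/measurable_EFinP.
- by move=> x _; rewrite lee_fin.
- exact: negligible_setC.
Qed.

End expectation.

(** * Integration over the box, one spin at a time *)

Section product_expectation.
Context (R : realType) (km kp : R) (mu : probability (measurableTypeR R) R).
Hypothesis km_lt_kp : km < kp.
Hypothesis mu_on : mu [set` `[km, kp]] = 1%E.
Local Notation T := (measurableTypeR R).
Local Notation I := ([set` `[km, kp]] : set T).

Definition box N : set (N.-tuple T) := [set x | forall i, I (tnth x i)].

Definition set_coord N (x : N.-tuple T) (j : 'I_N) (z : T) : N.-tuple T :=
  [tuple (if i == j then z else tnth x i) | i < N].

Lemma tnth_set_coord N (x : N.-tuple T) j z i :
  tnth (set_coord x j z) i = if i == j then z else tnth x i.
Proof. by rewrite tnth_mktuple. Qed.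

Lemma box_set_coord N (x : N.-tuple T) j z :
  box x -> I z -> box (set_coord x j z).
Proof. by move=> Bx Iz i; rewrite tnth_set_coord; case: eqP. Qed.

Lemma measurable_box N : measurable (@box N).
Proof.
rewrite (_ : @box N = \big[setI/setT]_(i < N)
    ((fun x : N.-tuple T => tnth x i) @^-1` I)).
  apply: bigsetI_measurable => i _; rewrite -[X in measurable X]setTI.
  by apply: measurable_tnth => //; exact: measurable_itv.
rewrite -bigcap_seq; apply/seteqP; split => x /= h i.
  by move=> _; exact: h.
by apply: h; rewrite /= mem_index_enum.
Qed.

Lemma measurable_I : measurable I.
Proof. exact: measurable_itv. Qed.

Lemma prod_law_box N : prod_law mu N (@box N) = 1%E.
Proof.
rewrite /box (@prod_lawE _ _ _ mu N (fun=> I)); last by move=> _; exact: measurable_I.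
by apply: big1 => i _; exact: mu_on.
Qed.

Definition expect1 (f : T -> R) : R := expect mu I f.
Definition expectN N (F : N.-tuple T -> R) : R := expect (prod_law mu N) (@box N) F.
Local Notation E1 := expect1.
Local Notation EN := expectN.
Local Notation bm1 := (bmeas I).
Local Notation bmN := (bmeas (@box _)).

Lemma tnth_tuple_cons0 n (z : T) (x : n.-tuple T) :
  tnth (tuple_cons (z, x)) ord0 = z.
Proof. by []. Qed.

Lemma tnth_tuple_consS n (z : T) (x : n.-tuple T) j :
  tnth (tuple_cons (z, x)) (lift ord0 j) = tnth x j.
Proof. by rewrite /tuple_cons tnthS. Qed.

Lemma box_cons n (z : T) (x : n.-tuple T) :
  box (tuple_cons (z, x)) <-> I z /\ box x.
Proof.
split=> [b|[Iz bx] i].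
  split; first exact: (b ord0).
  by move=> i; have := b (lift ord0 i); rewrite tnth_tuple_consS.
by case: (unliftP ord0 i) => [j ->|->//]; rewrite tnth_tuple_consS; exact: bx.
Qed.

Lemma bmeas_cons_r n (F : n.+1.-tuple T -> R) (z : T) : I z -> bmN F ->
  bmN (fun x => F (tuple_cons (z, x))).
Proof.
move=> Iz [mF [C FC]]; split; last first.
  by exists C => x Bx; apply: FC; apply/box_cons.
apply: (measurableT_comp mF); apply: measurable_cons => //.
exact: measurable_id.
Qed.

Lemma bmeas_cons_l n (F : n.+1.-tuple T -> R) (x : n.-tuple T) : box x -> bmN F ->
  bm1 (fun z => F (tuple_cons (z, x))).
Proof.
move=> Bx [mF [C FC]]; split; last first.
  by exists C => z Iz; apply: FC; apply/box_cons.
apply: (measurableT_comp mF); apply: measurable_cons => //.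
exact: measurable_id.
Qed.

(** Fubini for the first spin, in both orders: below, the first spin must be outermost to recurse on
    a later spin, and innermost to be integrated out itself. *)
Lemma EN_consE n (F : n.+1.-tuple T -> R) : bmN F ->
  EN F = E1 (fun z => EN (fun x => F (tuple_cons (z, x)))) /\
  EN F = EN (fun x => E1 (fun z => F (tuple_cons (z, x)))).
Proof.
move=> bF; have [mF [C FC]] := bF.
(* Extension by zero is bounded everywhere, so Fubini applies on the whole product space; [F] itself
   is bounded only on the box. *)
pose G := F \_ (@box n.+1).
have mG : measurable_fun setT G.
  apply/(measurable_restrictT _ (@measurable_box _)).
  exact: measurable_funTS.
pose h (p : T * n.-tuple T) := (G (tuple_cons p))%:E.
have mh : measurable_fun setT h.
  apply/measurable_EFinP/(measurableT_comp mG).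
  exact: measurable_tuple_cons.
have C0 : 0 <= `|C| by [].
have GC y : `|G y| <= `|C|.
  rewrite /G patchE; case: ifPn => [|_]; last by rewrite normr0.
  by rewrite inE => /FC /le_trans; apply; exact: ler_norm.
have ih : (mu \x prod_law mu n)%E.-integrable setT h.
  apply: (@measurable_bounded_integrable _ _ _ _ (G \o @tuple_cons _ _ n)) => //.
  - by rewrite (le_lt_trans (probability_le1 (mu \x prod_law mu n)%E _))// ltry.
  - by apply: (measurableT_comp mG); exact: measurable_tuple_cons.
  - exists `|C|; split; first exact: num_real.
    by move=> y Cy x /= _; rewrite (le_trans (GC _))// ltW.
have hE : EN F = fine (\int[(mu \x prod_law mu n)%E]_p h p).
  rewrite /expectN !expectE Rintegral_mkcond /Rintegral/=; congr fine.
  rewrite integral_pushforward//=.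
  - exact/measurable_EFinP.
have GE z x : G (tuple_cons (z, x)) =
    if (z \in I) then ((fun x => F (tuple_cons (z, x))) \_ (@box n)) x else 0.
  rewrite /G !patchE; case: ifPn => [|/negP].
    by rewrite inE => /box_cons[Iz Bx]; rewrite !mem_set.
  rewrite inE => nB; case: ifPn => //; rewrite inE => Iz.
  case: ifPn => //; rewrite inE => Bx.
  by exfalso; apply: nB; apply/box_cons.
split; rewrite hE.
  rewrite -integral12_prod_meas1// /expect1 !expectE Rintegral_mkcond /Rintegral.
  congr fine; apply: eq_integral => z _; rewrite /fubini_F patchE /h.
  case: ifPn => Iz; last first.
    by apply: integral0_eq => x _; rewrite GE (negbTE Iz).
  rewrite /expectN !expectE /Rintegral fineK.
    rewrite [RHS]integral_mkcond; apply: eq_integral => x _.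
    by rewrite GE Iz restrict_EFin.
  apply: integrable_fin_num; first exact: measurable_box.
  apply: bmeas_integrable; first exact: measurable_box.
  by apply: bmeas_cons_r => //; rewrite inE in Iz.
rewrite -integral21_prod_meas1// /expectN !expectE Rintegral_mkcond /Rintegral.
congr fine; apply: eq_integral => x _; rewrite /fubini_G patchE /h.
case: ifPn => Bx; last first.
  apply: integral0_eq => z _; rewrite GE patchE (negbTE Bx).
  by case: ifP.
rewrite /expect1 !expectE /Rintegral fineK.
  rewrite [RHS]integral_mkcond; apply: eq_integral => z _.
  by rewrite GE !patchE Bx; case: ifP.
apply: integrable_fin_num; first exact: measurable_I.
apply: bmeas_integrable; first exact: measurable_I.
by apply: bmeas_cons_l => //; rewrite inE in Bx.
Qed.

Lemma E1_0 (f : T -> R) : (forall z, I z -> f z = 0) -> E1 f = 0.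
Proof.
move=> f0; rewrite /expect1 (@eq_expect _ _ _ _ _ _ (fun=> 0))//.
by rewrite expect_cst//; exact: measurable_I.
Qed.

Lemma EN_0 N (F : N.-tuple T -> R) : (forall x, box x -> F x = 0) -> EN F = 0.
Proof.
move=> f0; rewrite /expectN (@eq_expect _ _ _ _ _ _ (fun=> 0))//.
by rewrite expect_cst//; [exact: measurable_box|exact: prod_law_box].
Qed.

(** This takes the place of the tower property of conditional expectation given all spins but the
    [j]-th. *)
Lemma EN_null N (F : N.-tuple T -> R) (j : 'I_N) : bmN F ->
  (forall x, box x -> E1 (fun z => F (set_coord x j z)) = 0) -> EN F = 0.
Proof.
elim: N F j => [F []//|n IH F j bF F0].
have [cons1 cons2] := EN_consE bF.
case: (unliftP ord0 j) F0 => [j' ->|->] F0.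
  rewrite cons1; apply: E1_0 => z Iz; apply: (IH _ j').
    exact: bmeas_cons_r.
  move=> x Bx; rewrite -[RHS](F0 (tuple_cons (z, x))); last exact/box_cons.
  apply: eq_expect => w Iw; congr F; apply: eq_from_tnth => i.
  rewrite tnth_set_coord; case: (unliftP ord0 i) => [i' ->|->].
    rewrite !tnth_tuple_consS tnth_set_coord.
    by rewrite (inj_eq lift_inj).
  by rewrite eqE/=.
rewrite cons2; apply: EN_0 => x Bx.
(* [km] is a dummy first coordinate: [set_coord] overwrites it at once. *)
have Ik : I km by rewrite /= in_itv/= lexx ltW.
rewrite -[RHS](F0 (tuple_cons (km, x))); last exact/box_cons.
apply: eq_expect => w Iw; congr F; apply: eq_from_tnth => i.
rewrite tnth_set_coord; case: (unliftP ord0 i) => [i' ->|->].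
  by rewrite !tnth_tuple_consS eqE/=.
by rewrite eqxx.
Qed.

Lemma norm_itv (z : T) : I z -> `|z| <= `|km| + `|kp|.
Proof.
rewrite /= in_itv/= => /andP[a b]; have := ler_norm kp; have := ler_norm (- km).
by rewrite normrN ler_norml; have := normr_ge0 km; have := normr_ge0 kp; lra.
Qed.

Lemma bmeas_tnth N (i : 'I_N) : bmN (fun x => tnth x i : R).
Proof.
split; first exact: measurable_tnth.
by exists (`|km| + `|kp|) => x /(_ i); exact: norm_itv.
Qed.

Lemma bmeas_comp_tnth N (i : 'I_N) (f : T -> R) : bm1 f ->
  bmN (fun x => f (tnth x i)).
Proof.
move=> [mf [C fC]]; split; last by exists C => x Bx; exact/fC/Bx.
by apply: (measurableT_comp mf); exact: measurable_tnth.
Qed.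

Lemma EN_prod N (f : 'I_N -> T -> R) : (forall i, bm1 (f i)) ->
  EN (fun x => \prod_(i < N) f i (tnth x i)) = \prod_(i < N) E1 (f i).
Proof.
elim: N f => [|n IH] f bf.
  under [LHS]eq_expect do rewrite big_ord0.
  by rewrite big_ord0 expect_cst//; [exact: measurable_box|exact: prod_law_box].
have bF : bmN (fun x : n.+1.-tuple T => \prod_(i < n.+1) f i (tnth x i)).
  by apply: bmeas_prod => i; exact: bmeas_comp_tnth.
have bG : bmN (fun x : n.-tuple T =>
    \prod_(i < n) f (lift ord0 i) (tnth x i)).
  by apply: bmeas_prod => i; exact: bmeas_comp_tnth.
rewrite (EN_consE bF).1 big_ord_recl -IH// /expect1.
rewrite -expectZr; do ?[exact: measurable_I | exact: bf].
apply: eq_expect => z Iz; rewrite /expectN -expectZ; do ?[exact: measurable_box | exact: bG].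
apply: eq_expect => x Bx; rewrite big_ord_recl tnth_tuple_cons0.
by congr (_ * _); apply: eq_bigr => i _; rewrite tnth_tuple_consS.
Qed.

End product_expectation.

(** * The cumulant generating function *)

Section real_calculus.
Variable R : realType.
Implicit Types (f df : R -> R).

(** Both sides come from [1 + v <= expR v]: at [v = u] directly, and at [v = - u] in the form
    [expR u * (1 - u) <= 1], since [(1 + u + 2 * u ^+ 2) * (1 - u) >= 1] for [u <= 1 / 2]. *)
Lemma expR_quadratic (u : R) : `|u| <= 2^-1 -> `|expR u - 1 - u| <= 2 * u ^+ 2.
Proof.
rewrite ler_norml => /andP[u1 u2].
have e1 : 1 + u <= expR u by exact: expR_ge1Dx.
have e2 : 1 + - u <= expR (- u) by exact: expR_ge1Dx.
have e3 : expR u * (1 - u) <= 1.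
  apply: (le_trans (ler_wpM2l (expR_ge0 u) e2)).
  by rewrite -expRD subrr expR0.
have e4 : expR u <= 1 + u + 2 * u ^+ 2.
  rewrite -(@ler_pM2r _ (1 - u)); last by lra.
  apply: (le_trans e3); have := mulr_ge0 (sqr_ge0 u) (_ : 0 <= 1 - 2 * u).
  by move/(_ ltac:(lra)); rewrite !expr2; nra.
by rewrite ler_norml; have := sqr_ge0 u; move=> ?; apply/andP; split; lra.
Qed.

(** Serves to differentiate under the integral sign: a quadratic remainder bound can be integrated
    pointwise, without dominated convergence. *)
Lemma is_derive_quadratic f (l d C e : R) : 0 < e ->
  (forall h, `|h| <= e -> `|f (l + h) - f l - h * d| <= C * h ^+ 2) ->
  is_derive l (1 : R) f d.
Proof.
move=> e0 H.
have cv : h^-1 *: (f (h *: 1 + l) - f l) @[h --> 0^'] --> d.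
  apply/cvgrPdist_le => eps eps0.
  near=> h.
  have h0 : h != 0 by near: h; exact: nbhs_dnbhs_neq.
  have he : `|h| <= e.
    near: h; apply: dnbhs0_le; exact: e0.
  have heps : `|h| <= eps / (`|C| + 1).
    by near: h; apply: dnbhs0_le; rewrite divr_gt0// ltr_wpDl.
  have -> : d - h^-1 *: (f (h *: 1 + l) - f l) =
      - (h^-1 * (f (l + h) - f l - h * d)).
    by rewrite /GRing.scale/= mulr1 (addrC h l); field.
  rewrite normrN normrM normfV ler_pdivrMl ?normr_gt0//.
  apply: (le_trans (H _ he)).
  rewrite -real_normK ?num_real// expr2 mulrA mulrC ler_wpM2l//.
  apply: (@le_trans _ _ ((`|C| + 1) * `|h|)).
    by rewrite ler_wpM2r// (le_trans (ler_norm C))// lerDl.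
  by rewrite mulrC -ler_pdivlMr// ltr_wpDl.
split; first by apply/cvg_ex; exists d.
exact/cvg_lim.
Unshelve. all: by end_near. Qed.

Lemma mean_value f df : (forall x : R, is_derive x (1 : R) f (df x)) ->
  forall a b, exists c, [/\ Num.min a b <= c, c <= Num.max a b &
    f b - f a = df c * (b - a)].
Proof.
move=> fd; have cf (a b : R) : {within `[a, b], continuous f}.
  apply: derivable_within_continuous => x _.
  by have [] := fd x.
suff H a b : a <= b -> exists c, [/\ a <= c, c <= b & f b - f a = df c * (b - a)].
  move=> a b; have [ab|ba] := leP a b; first exact: H.
  have [c [c1 c2 fc]] := H _ _ (ltW ba); exists c; split => //.
  by rewrite -[RHS]opprK -mulrN opprB -fc opprB.
move=> ab; have [c] := MVT_segment ab (fun x _ => fd x) (cf a b).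
by rewrite in_itv/= => /andP[c1 c2] fc; exists c.
Qed.

End real_calculus.

Section cumulant.
Context (R : realType) (km kp : R) (mu : probability (measurableTypeR R) R).
Hypothesis km_lt_kp : km < kp.
Hypothesis mu_on : mu [set` `[km, kp]] = 1%E.
Local Notation T := (measurableTypeR R).
Local Notation I := ([set` `[km, kp]] : set T).
Local Notation E1 := (expect1 km kp mu).
Local Notation bm1 := (bmeas I).
Local Notation M := (`|km| + `|kp|).

(** Moments of the law tilted by [l], not normalized. [tmean] and [tvar] are the mean and the
    variance of the normalized tilt, that is, the first and second derivatives of [Lambda]. *)
Definition moment k (l : R) : R := E1 (fun z => z ^+ k * expR (l * z)).
Definition tmean : R -> R := locked (fun l => moment 1 l / moment 0 l).
Definition tvar (l : R) : R := moment 2 l / moment 0 l - tmean l ^+ 2.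

Lemma tmeanE l : tmean l = moment 1 l / moment 0 l.
Proof. by rewrite /tmean -lock. Qed.

Lemma bmeas_id : bm1 (fun z => z).
Proof.
by split; [exact: measurable_id|exists M => z Iz; exact: norm_itv].
Qed.

Lemma bmeas_moment k l : bm1 (fun z => z ^+ k * expR (l * z)).
Proof.
apply: bmeasM; first by apply: bmeasX; exact: bmeas_id.
by apply: bmeas_expR; apply: bmeasM; [exact: bmeas_cst|exact: bmeas_id].
Qed.
Hint Resolve measurable_I bmeas_moment bmeas_id : core.

Lemma E1_cst c : E1 (fun=> c) = c.
Proof. by rewrite /expect1 expect_cst//; exact: measurable_I. Qed.

Lemma expR_lb l z : I z -> expR (- (`|l| * M)) <= expR (l * z).
Proof.
move=> Iz; rewrite ler_expR lerNl -mulrN (le_trans (ler_norm _))//.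
by rewrite normrM normrN ler_wpM2l// norm_itv.
Qed.

Lemma expR_ub l z : I z -> expR (l * z) <= expR (`|l| * M).
Proof.
move=> Iz; rewrite ler_expR (le_trans (ler_norm _))//.
by rewrite normrM ler_wpM2l// norm_itv.
Qed.

Lemma moment0E l : moment 0 l = E1 (fun z => expR (l * z)).
Proof. by apply: eq_expect => z _; rewrite expr0 mul1r. Qed.

Lemma moment0_lb l : expR (- (`|l| * M)) <= moment 0 l.
Proof.
rewrite moment0E -[leLHS]E1_cst; apply: le_expect => //.
- exact: bmeas_cst.
- by apply: bmeas_expR; apply: bmeasM; [exact: bmeas_cst|exact: bmeas_id].
- exact: expR_lb.
Qed.

Lemma moment0_gt0 l : 0 < moment 0 l.
Proof. exact: lt_le_trans (expR_gt0 _) (moment0_lb l). Qed.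

Lemma moment0_ub l : moment 0 l <= expR (`|l| * M).
Proof.
rewrite moment0E -[leRHS]E1_cst; apply: le_expect => //.
- by apply: bmeas_expR; apply: bmeasM; [exact: bmeas_cst|exact: bmeas_id].
- exact: bmeas_cst.
- exact: expR_ub.
Qed.

Lemma moment00 : moment 0 0 = 1.
Proof.
rewrite moment0E -[RHS]E1_cst; apply: eq_expect => z _.
by rewrite mul0r expR0.
Qed.

Lemma is_derive_moment k (l : R) : is_derive l (1 : R) (moment k) (moment k.+1 l).
Proof.
(* The integral of the remainder bound from [expR_quadratic] at [h * z]; the radius
   [(2 * (M + 1))^-1] forces [|h * z| <= 1 / 2], and the [+ 1] keeps it well defined whatever [M]
   is. *)
pose C := E1 (fun z => 2 * `|z| ^+ k.+2 * expR (l * z)).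
have M1 : 0 < M + 1 by rewrite ltr_wpDl// addr_ge0.
apply: (@is_derive_quadratic _ _ _ _ C (2 * (M + 1))^-1).
  by rewrite invr_gt0 mulr_gt0.
move=> h hM; rewrite /moment /expect1.
rewrite -expectZ//.
have b1 j : bm1 (fun z => `|z| ^+ j).
  by apply: bmeasX; apply: bmeas_comp (bmeas_id); exact: norm_continuous.
have b2 := bmeas_moment k (l + h); have b3 := bmeas_moment k l.
have b4 : bm1 (fun z => h * (z ^+ k.+1 * expR (l * z))).
  by apply: bmeasM; [exact: bmeas_cst|exact: bmeas_moment].
have b5 := bmeasB b2 b3; have b6 := bmeasB b5 b4.
rewrite -expectB//.
rewrite -expectB//.
apply: (le_trans (le_norm_expect _ _ _)) => //.
have b7 : bm1 (fun z => 2 * `|z| ^+ k.+2 * expR (l * z)).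
  apply: bmeasM; first by apply: bmeasM; [exact: bmeas_cst|exact: b1].
  by apply: bmeas_expR; apply: bmeasM; [exact: bmeas_cst|exact: bmeas_id].
rewrite /C /expect1 -expectZr//.
apply: le_expect => //.
- by apply: (bmeas_comp _ b6); exact: norm_continuous.
- by apply: bmeasM; [exact: b7|exact: bmeas_cst].
move=> z Iz.
have -> : z ^+ k * expR ((l + h) * z) - z ^+ k * expR (l * z) -
    h * (z ^+ k.+1 * expR (l * z)) =
    z ^+ k * expR (l * z) * (expR (h * z) - 1 - h * z).
  by rewrite mulrDl expRD exprS; ring.
rewrite 2!normrM normrX (ger0_norm (expR_ge0 _)).
have hz : `|h * z| <= 2^-1.
  rewrite normrM (@le_trans _ _ ((2 * (M + 1))^-1 * (M + 1)))//.
    rewrite ler_pM// (le_trans (norm_itv Iz))// lerDl//.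
  by rewrite invfM -mulrA mulVf ?mulr1// gt_eqF.
apply: (le_trans (ler_wpM2l _ (expR_quadratic hz))).
  by rewrite mulr_ge0// ?exprn_ge0// expR_ge0.
rewrite exprMn -(real_normK (num_real z)) !exprS.
by rewrite le_eqVlt; apply/orP; left; apply/eqP; ring.
Qed.

Lemma LambdaE l : Lambda mu l = ln (moment 0 l).
Proof.
rewrite /Lambda (expectT (@measurable_I _ _ _) mu_on) ?moment0E//.
apply: measurableT_comp; first exact: measurable_expR.
by apply: measurable_funM => //; exact: measurable_cst.
Qed.

Lemma is_derive_Lambda (l : R) : is_derive l (1 : R) (Lambda mu) (tmean l).
Proof.
have -> : Lambda mu = (@ln R) \o moment 0 by apply/funext => x; rewrite LambdaE.
rewrite tmeanE mulrC.
have d1 := is_derive_moment 0 l.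
have d2 := is_derive1_ln (moment0_gt0 l).
rewrite (mulrC (_^-1)) .
have := is_derive1_comp d2 d1; rewrite /GRing.scale/= mulrC.
exact.
Qed.

Lemma derive1_Lambda l : derive1 (Lambda mu) l = tmean l.
Proof. by rewrite derive1E; have [_ ->] := is_derive_Lambda l. Qed.

Lemma is_derive_tmean (l : R) : is_derive l (1 : R) tmean (tvar l).
Proof.
have d0 := is_derive_moment 0 l; have d1 := is_derive_moment 1 l.
have n0 : moment 0 l != 0 by rewrite gt_eqF// moment0_gt0.
have dV := is_deriveV n0.
have -> : tmean = (moment 1 * (fun x => (moment 0 x)^-1)).
  by apply/funext => x; rewrite tmeanE.
apply: (is_derive_eq (is_deriveM d1 (dV _ _ d0))).
rewrite /tvar tmeanE /GRing.scale/=; field.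
by [].
Qed.

Lemma tmean_continuous : continuous tmean.
Proof.
move=> x; apply: differentiable_continuous.
by apply/derivable1_diffP; have [] := is_derive_tmean x.
Qed.

Lemma Lambda_0 : Lambda mu 0 = 0.
Proof. by rewrite LambdaE moment00 ln1. Qed.

Lemma expR_Lambda l : expR (Lambda mu l) = moment 0 l.
Proof. by rewrite LambdaE lnK// posrE moment0_gt0. Qed.

Lemma tilt_null l : E1 (fun z => (z - tmean l) * expR (l * z)) = 0.
Proof.
have b0 : bm1 (fun z => expR (l * z)).
  by apply: bmeas_expR; apply: bmeasM; [exact: bmeas_cst|exact: bmeas_id].
have b1 := bmeasM (bmeas_cst I (tmean l)) b0.
have -> : E1 (fun z => (z - tmean l) * expR (l * z)) =
    moment 1 l - tmean l * moment 0 l.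
  rewrite moment0E /moment /expect1 -expectZ// -expectB//.
  by apply: eq_expect => z _; rewrite expr1 mulrBl.
by rewrite tmeanE divfK ?subrr// gt_eqF// moment0_gt0.
Qed.

Lemma tvar_centered l :
  tvar l * moment 0 l = E1 (fun z => (z - tmean l) ^+ 2 * expR (l * z)).
Proof.
have n0 : moment 0 l != 0 by rewrite gt_eqF// moment0_gt0.
have b2 := bmeas_moment 2 l; have b1 := bmeas_moment 1 l.
have b0 := bmeas_moment 0 l; set t := tmean l.
have -> : E1 (fun z => (z - t) ^+ 2 * expR (l * z)) =
    moment 2 l - 2 * t * moment 1 l + t ^+ 2 * moment 0 l.
  rewrite /moment /expect1 -!expectZ//; do ?exact: measurable_I.
  have bc1 := bmeasM (bmeas_cst I (2 * t)) b1.
  have bc0 := bmeasM (bmeas_cst I (t ^+ 2)) b0.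
  rewrite -expectB//; do ?exact: measurable_I.
  rewrite -expectD//; do ?exact: measurable_I.
    by apply: eq_expect => z _; ring.
  exact: bmeasB.
by rewrite /tvar -/t /t tmeanE; field.
Qed.

Lemma tmean_itv l : I (tmean l).
Proof.
have b1 := bmeas_moment 1 l; have b0 := bmeas_moment 0 l.
have m0 := moment0_gt0 l.
rewrite /= in_itv/= tmeanE; apply/andP; split.
  rewrite ler_pdivlMr// /moment /expect1 -expectZ//; do ?exact: measurable_I.
  apply: le_expect => //; do ?exact: measurable_I.
    exact: bmeasM (bmeas_cst I _) b0.
  move=> z; rewrite /= in_itv/= => /andP[z1 _].
  by rewrite expr0 mul1r expr1 ler_wpM2r// expR_ge0.
rewrite ler_pdivrMr// /moment /expect1 -expectZ//; do ?exact: measurable_I.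
apply: le_expect => //; do ?exact: measurable_I.
  exact: bmeasM (bmeas_cst I _) b0.
move=> z; rewrite /= in_itv/= => /andP[_ z1].
by rewrite expr0 mul1r expr1 ler_wpM2r// expR_ge0.
Qed.

Lemma tmean_norm l : `|tmean l| <= M.
Proof. exact: norm_itv (tmean_itv l). Qed.

Lemma tvar_ge0 l : 0 <= tvar l.
Proof.
rewrite -(pmulr_lge0 _ (moment0_gt0 l)) tvar_centered.
by apply: expect_ge0 => z _; rewrite mulr_ge0 ?sqr_ge0 ?expR_ge0.
Qed.

Lemma tvar_le l : tvar l <= M ^+ 2.
Proof.
have b2 := bmeas_moment 2 l; have b0 := bmeas_moment 0 l.
rewrite /tvar (@le_trans _ _ (moment 2 l / moment 0 l))//.
  by rewrite gerBl sqr_ge0.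
rewrite ler_pdivrMr ?moment0_gt0// /moment /expect1 -expectZ//; do ?exact: measurable_I.
apply: le_expect => //; do ?exact: measurable_I.
  exact: bmeasM (bmeas_cst I _) b0.
move=> z Iz; rewrite expr0 mul1r ler_wpM2r ?expR_ge0//.
by rewrite -(real_normK (num_real z)) ler_pXn2r ?nnegrE ?norm_itv// addr_ge0.
Qed.

Lemma tmean_lip a b : `|tmean a - tmean b| <= M ^+ 2 * `|a - b|.
Proof.
have [c [_ _ ->]] := mean_value is_derive_tmean b a.
by rewrite normrM ler_wpM2r// ger0_norm ?tvar_ge0 ?tvar_le.
Qed.

Lemma tmean_mono a b : 0 <= (tmean a - tmean b) * (a - b).
Proof.
have [c [_ _ ->]] := mean_value is_derive_tmean b a.
by rewrite -mulrA -expr2 mulr_ge0 ?tvar_ge0 ?sqr_ge0.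
Qed.

Lemma Lambda_tangent a b : tmean a * (b - a) <= Lambda mu b - Lambda mu a.
Proof.
have [c [ca cb ->]] := mean_value is_derive_Lambda a b.
rewrite -subr_ge0 -mulrBl; have := tmean_mono c a.
have [ab|ba] := leP a b.
  rewrite min_l// in ca; rewrite max_r// in cb.
  have [->|nac] := eqVneq c a; first by rewrite (subrr (tmean a)) !mul0r.
  rewrite pmulr_lge0; last by rewrite subr_gt0 lt_neqAle eq_sym nac.
  by move=> h; rewrite mulr_ge0// subr_ge0.
rewrite min_r ?(ltW ba)// in ca; rewrite max_l ?(ltW ba)// in cb.
have [->|nac] := eqVneq c a; first by rewrite (subrr (tmean a)) !mul0r.
rewrite nmulr_lge0; last by rewrite subr_lt0 lt_neqAle nac.
by move=> h; rewrite mulr_le0// subr_le0 ltW.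
Qed.

Lemma E1_indic_ball (x r : R) : supp mu x -> 0 < r -> 0 < E1 (\1_(ball x r)).
Proof.
move=> sx r0; have mb : measurable (ball x r : set T).
  by apply: open_measurable; exact: ball_open.
rewrite /expect1 -(expectT (@measurable_I _ _ _) mu_on)//.
rewrite /Rintegral integral_indic// setIT fine_gt0//.
rewrite sx /=; last exact: ballxx.
  by rewrite (le_lt_trans (probability_le1 _ _))// ltry.
exact: ball_open.
Qed.

Hypothesis km_supp : supp mu km.
Hypothesis kp_supp : supp mu kp.

(** The tilted mean cannot be near both ends: with [r] a quarter of the length, it is at distance at
    least [2 * r] from [km] or [kp]. The ball of radius [r] about that end has positive mass and
    lies at distance [r] from the mean, while the normalized tilt has density at least
    [expR (- (L * M)) ^+ 2]. *)
Lemma tvar_lb (L : R) : exists2 c, 0 < c & forall l, `|l| <= L -> c <= tvar l.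
Proof.
have [r rE] : exists r, r = (kp - km) / 4 := ex_intro _ _ erefl.
have r0 : 0 < r by rewrite rE divr_gt0// subr_gt0.
have p1 := E1_indic_ball km_supp r0; have p2 := E1_indic_ball kp_supp r0.
have [q1 q1E] : exists q, q = E1 (\1_(ball km r)) := ex_intro _ _ erefl.
have [q2 q2E] : exists q, q = E1 (\1_(ball kp r)) := ex_intro _ _ erefl.
rewrite -q1E in p1; rewrite -q2E in p2.
have M0 : 0 <= M by rewrite addr_ge0.
exists (expR (- (L * M)) ^+ 2 * (r ^+ 2 * Num.min q1 q2)).
  apply: mulr_gt0; first exact: exprn_gt0 (expR_gt0 _).
  by apply: mulr_gt0; [exact: exprn_gt0|rewrite lt_min p1].
move=> l lL; have l0 : 0 <= L := le_trans (normr_ge0 l) lL.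
have e0 := expR_gt0 (- (L * M)).
have lo z : I z -> expR (- (L * M)) <= expR (l * z).
  move=> Iz; apply: le_trans (expR_lb l Iz).
  by rewrite ler_expR lerN2 ler_wpM2r.
have hi : moment 0 l <= expR (L * M).
  by apply: le_trans (moment0_ub l) _; rewrite ler_expR ler_wpM2r.
have bsq : bm1 (fun z => (z - tmean l) ^+ 2 * expR (l * z)).
  apply: bmeasM; first by apply: bmeasX; apply: bmeasB => //; exact: bmeas_cst.
  by apply: bmeas_expR; apply: bmeasM; [exact: bmeas_cst|exact: bmeas_id].
have H x : supp mu x -> 2 * r <= `|x - tmean l| ->
    expR (- (L * M)) * r ^+ 2 * E1 (\1_(ball x r)) <= tvar l * moment 0 l.
  move=> sx xl; have mb : measurable (ball x r : set T).
    by apply: open_measurable; exact: ball_open.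
  rewrite tvar_centered /expect1 -expectZ//; last exact: bmeas_indic.
  apply: le_expect => //.
    by apply: bmeasM; [exact: bmeas_cst|exact: bmeas_indic].
  move=> z Iz; rewrite indicE; case: (boolP (_ \in _)) => [/set_mem xz|_] /=; last first.
    by rewrite mulr0 mulr_ge0 ?sqr_ge0 ?expR_ge0.
  rewrite mulr1 mulrC ler_pM ?sqr_ge0 ?expR_ge0//; last exact: lo.
  rewrite -(real_normK (num_real (z - _))) ler_pXn2r ?nnegrE ?(ltW r0)//.
  rewrite /ball/= in xz; have := ler_distD z x (tmean l).
  by move: xz xl; lra.
rewrite -(ler_pM2r (moment0_gt0 l)).
have key q : 0 < q -> Num.min q1 q2 <= q ->
    expR (- (L * M)) ^+ 2 * (r ^+ 2 * Num.min q1 q2) * moment 0 l <=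
    expR (- (L * M)) * r ^+ 2 * q.
  move=> q0 qm; set e := expR (- (L * M)) in e0 *; set m := Num.min _ _ in qm *.
  have m0 : 0 <= m by rewrite /m le_min !ltW.
  have em : e * moment 0 l <= 1.
    apply: (le_trans (ler_wpM2l (ltW e0) hi)).
    by rewrite /e -expRD addNr expR0.
  have -> : e ^+ 2 * (r ^+ 2 * m) * moment 0 l =
    e * (r ^+ 2 * m) * (e * moment 0 l) by ring.
  apply: (@le_trans _ _ (e * (r ^+ 2 * m) * 1)).
    by rewrite ler_wpM2l// mulr_ge0 ?(ltW e0)// mulr_ge0// sqr_ge0.
  rewrite mulr1 mulrA ler_wpM2l// mulr_ge0 ?(ltW e0)// sqr_ge0//.
have [h|h] := leP (2 * r) `|km - tmean l|.
  by apply: le_trans (H _ km_supp h); rewrite -q1E; apply: key => //; rewrite ge_min lexx.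
have h' : 2 * r <= `|kp - tmean l|.
  have := ler_distD (tmean l) km kp; rewrite (distrC km kp).
  have -> : `|kp - km| = kp - km by rewrite ger0_norm// subr_ge0 ltW.
  rewrite (distrC (tmean l) kp).
  by move: h; rewrite rE; lra.
by apply: le_trans (H _ kp_supp h'); rewrite -q2E; apply: key => //; rewrite ge_min lexx orbT.
Qed.

Lemma Lambda_strong_convex (L : R) : exists2 c, 0 < c & forall a b,
  `|a| <= L -> `|b| <= L ->
  c * (a - b) ^+ 2 <= (tmean a - tmean b) * (a - b) /\
  tmean a * (b - a) + c / 2 * (b - a) ^+ 2 <= Lambda mu b - Lambda mu a.
Proof.
have [c c0 cv] := tvar_lb L; exists c => // a b aL bL.
have mono x y : `|x| <= L -> `|y| <= L ->
    c * (x - y) ^+ 2 <= (tmean x - tmean y) * (x - y).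
  rewrite !ler_norml => /andP[x1 x2] /andP[y1 y2].
  have [z [z1 z2 ->]] := mean_value is_derive_tmean y x.
  rewrite -mulrA -expr2 ler_wpM2r ?sqr_ge0// cv// ler_norml.
  move: x1 x2 y1 y2 z1 z2; rewrite ge_min le_max=> ? ? ? ?.
  by move=> /orP[] ? /orP[] ?; lra.
split; first exact: mono.
have [Lm LmE] : exists Lm, Lm = Lambda mu := ex_intro _ _ erefl.
(* By strong monotonicity of [tmean], the derivative of [f] has the sign of [x - a], so that [f] is
   minimal at [a]. *)
rewrite -LmE; pose f x := Lm x - tmean a * x - c / 2 * (x - a) ^+ 2.
pose df x := tmean x - tmean a - c * (x - a).
have fd (x : R) : is_derive x (1 : R) f (df x).
  have dL := is_derive_Lambda x; rewrite -LmE in dL.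
  rewrite /f /df; apply: is_derive_eq.
  by rewrite /GRing.scale/=; field.
have [z [z1 z2]] := mean_value fd a b.
rewrite /f /df => H.
have zL : `|z| <= L.
  move: aL bL z1 z2; rewrite !ler_norml ge_min le_max.
  move=> /andP[? ?] /andP[? ?].
  by move=> /orP[] ? /orP[] ?; lra.
have P0 := mono _ _ zL aL.
suff : 0 <= (tmean z - tmean a - c * (z - a)) * (b - a).
  by rewrite -H subrr expr0n /= mulr0 mulrBr; lra.
have {}P0 : 0 <= (tmean z - tmean a - c * (z - a)) * (z - a).
  by rewrite mulrBl subr_ge0 -mulrA -expr2.
have [ab|ba] := leP a b.
  rewrite min_l// in z1.
  have [->|nac] := eqVneq z a; first by rewrite !subrr mulr0 subrr mul0r.
  move: P0; rewrite pmulr_lge0; last by rewrite subr_gt0 lt_neqAle eq_sym nac.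
  by move=> h; rewrite mulr_ge0// subr_ge0.
rewrite max_l ?(ltW ba)// in z2.
have [->|nac] := eqVneq z a; first by rewrite !subrr mulr0 subrr mul0r.
move: P0; rewrite nmulr_lge0; last by rewrite subr_lt0 lt_neqAle nac.
by move=> h; rewrite mulr_le0// subr_le0 ltW.
Qed.

(* [(s, p)] stands for [(1, kp)] or [(-1, km)]. *)
Lemma tmean_endpoint (s p d : R) : s ^+ 2 = 1 -> supp mu p -> 0 < d ->
  exists2 l, 0 <= s * l & s * p - d <= s * tmean l.
Proof.
move=> s1 sp d0; have d20 : 0 < d / 2 by rewrite divr_gt0.
have q0 := E1_indic_ball sp d20; set q := E1 _ in q0.
(* Integrating over the ball alone gives [Lambda (s * r) >= r * (s * p - d / 2) + ln q], and
   convexity gives [Lambda (s * r) <= r * (s * tmean (s * r))]. This [r] makes the spare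
   [r * (d / 2)] outweigh [ln q]. *)
pose r := `|ln q| / (d / 2) + 1.
have r0 : 0 < r by apply: ltr_wpDl => //; apply: divr_ge0 => //; exact: ltW.
have mb : measurable (ball p (d / 2) : set T).
  by apply: open_measurable; exact: ball_open.
have ssr : s * (s * r) = r by rewrite mulrA -expr2 s1 mul1r.
exists (s * r); first by rewrite ssr ltW.
have m0 : expR (r * (s * p - d / 2)) * q <= moment 0 (s * r).
  rewrite /q moment0E /expect1 -expectZ//; last exact: bmeas_indic.
  apply: le_expect => //.
  - by apply: bmeasM; [exact: bmeas_cst|exact: bmeas_indic].
  - by apply: bmeas_expR; apply: bmeasM; [exact: bmeas_cst|exact: bmeas_id].
  move=> z Iz; rewrite indicE; case: (boolP (_ \in _)) => [/set_mem pz|_] /=; last first.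
    by rewrite mulr0 expR_ge0.
  rewrite mulr1 ler_expR (mulrC s r) -mulrA ler_pM2l//.
  have := ler_norm (s * (p - z)); rewrite normrM mulrBr.
  have -> : `|s| = 1.
    by apply/eqP; rewrite -sqrp_eq1 ?normr_ge0// real_normK ?num_real// s1.
  by rewrite mul1r; rewrite /ball/= in pz; move: pz; lra.
have t1 := Lambda_tangent (s * r) 0.
rewrite Lambda_0 LambdaE in t1.
have t2 : r * (s * p - d / 2) + ln q <= ln (moment 0 (s * r)).
  rewrite -[leLHS]expRK expRD lnK ?posrE// ler_ln ?posrE ?moment0_gt0//.
  by rewrite mulr_gt0// expR_gt0.
have t3 : r * (s * p - d / 2) + ln q <= r * (s * tmean (s * r)).
  apply: (le_trans t2); move: t1; rewrite !sub0r mulrN lerN2 mulrCA => t1.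
  by rewrite (_ : r * (s * tmean (s * r)) = s * (tmean (s * r) * r))//; ring.
rewrite -(ler_pM2l r0); apply: le_trans t3.
rewrite -subr_ge0.
have -> : r * (s * p - d / 2) + ln q - r * (s * p - d) = ln q + r * (d / 2) by field.
have -> : r * (d / 2) = `|ln q| + d / 2.
  by rewrite /r mulrDl mul1r divfK// gt_eqF.
by have := ler_norm (- ln q); rewrite normrN; lra.
Qed.

End cumulant.

(** * Local fields and Gibbs measures *)

(** All that part (a) needs of a realization, besides a lower bound on the variance of its
    degrees. *)
Record is_tensor (R : realType) N (A : 'I_N -> 'I_N -> 'I_N -> R) : Prop := {
  tensor_sym12 : forall i j k, A i j k = A j i k;
  tensor_sym23 : forall i j k, A i j k = A i k j;
  tensor_diag : forall i j, A i j j = 0;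
  tensor_ge0 : forall i j k, 0 <= A i j k;
  tensor_le : forall i j k, A i j k <= N%:R ^- 2 }.

Section local_fields.
Context (R : realType) (km kp : R) (N : nat).
Local Notation T := (measurableTypeR R).
Local Notation I := ([set` `[km, kp]] : set T).
Local Notation M := (`|km| + `|kp|).
Local Notation bmN := (bmeas (@box R km kp N)).
Variable A : 'I_N -> 'I_N -> 'I_N -> R.
Hypothesis tA : is_tensor A.
Implicit Types (x : N.-tuple T) (i j k l : 'I_N).

(** Half the partial derivative of the [i]-th local field in the [j]-th spin. *)
Definition pair_field x i j : R := \sum_k A i j k * tnth x k.

Lemma local_fieldE x i : local_field A x i = \sum_j tnth x j * pair_field x i j.
Proof.
apply: eq_bigr => j _; rewrite /pair_field mulr_sumr.
by apply: eq_bigr => k _; ring.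
Qed.

Lemma tnth_set_coordD x j (z : R) i :
  tnth (set_coord x j z) i = tnth x i + (z - tnth x j) * (i == j)%:R.
Proof.
rewrite tnth_set_coord; case: eqP => [->|_]; rewrite ?mulr1 ?mulr0 ?addr0//.
by rewrite addrC subrK.
Qed.

Lemma sum_indic (F : 'I_N -> R) j : \sum_i F i * (i == j)%:R = F j.
Proof.
rewrite (bigD1 j)//= eqxx mulr1 big1 ?addr0// => i /negbTE ->.
by rewrite mulr0.
Qed.

Lemma pair_field_set x i j l z :
  pair_field (set_coord x l z) i j = pair_field x i j + (z - tnth x l) * A i j l.
Proof.
rewrite /pair_field -(sum_indic (fun k => A i j k) l) mulr_sumr -big_split/=.
by apply: eq_bigr => k _; rewrite tnth_set_coordD; ring.
Qed.

Lemma pair_field_sym x i j : pair_field x i j = pair_field x j i.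
Proof. by apply: eq_bigr => k _; rewrite (tensor_sym12 tA). Qed.

Lemma pair_field_diag x i : pair_field x i i = 0.
Proof.
rewrite /pair_field big1// => k _.
by rewrite (tensor_sym23 tA) (tensor_sym12 tA) (tensor_diag tA) mul0r.
Qed.

(** There is no term quadratic in the change, because it would carry [A i l l], which vanishes. *)
Lemma local_field_set x i l z : local_field A (set_coord x l z) i =
  local_field A x i + 2 * (z - tnth x l) * pair_field x i l.
Proof.
set d := z - tnth x l.
have -> : 2 * d * pair_field x i l = \sum_j (tnth x j * (d * A i j l)) +
    \sum_j d * (pair_field x i j * (j == l)%:R) + d * d * A i l l.
  rewrite -[X in _ + X + _]mulr_sumr sum_indic (tensor_diag tA) mulr0 addr0.
  have -> : \sum_j tnth x j * (d * A i j l) = d * pair_field x i l.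
    rewrite /pair_field mulr_sumr; apply: eq_bigr => j _.
    by rewrite (tensor_sym23 tA i j l); ring.
  by ring.
rewrite -(sum_indic (fun k => A i k l) l) mulr_sumr !local_fieldE.
rewrite addrA addrA -!big_split/=; apply: eq_bigr => j _.
by rewrite tnth_set_coordD pair_field_set -/d; ring.
Qed.

Lemma local_field_set_same x i z :
  local_field A (set_coord x i z) i = local_field A x i.
Proof. by rewrite local_field_set pair_field_diag mulr0 addr0. Qed.

Lemma cubicE x : \sum_i \sum_j \sum_k A i j k * tnth x i * tnth x j * tnth x k =
  \sum_i tnth x i * local_field A x i.
Proof.
apply: eq_bigr => i _; rewrite /local_field mulr_sumr.
apply: eq_bigr => j _; rewrite mulr_sumr.
by apply: eq_bigr => k _; ring.
Qed.

Lemma cubic_set x j z :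
  \sum_i tnth (set_coord x j z) i * local_field A (set_coord x j z) i =
  \sum_i tnth x i * local_field A x i + 3 * (z - tnth x j) * local_field A x j.
Proof.
set d := z - tnth x j.
have -> : 3 * d * local_field A x j =
    \sum_i tnth x i * (2 * d * pair_field x i j) +
    \sum_i d * (local_field A x i * (i == j)%:R) +
    \sum_i 2 * d * d * (pair_field x i j * (i == j)%:R).
  rewrite -!mulr_sumr !sum_indic pair_field_diag mulr0 addr0.
  have -> : \sum_i tnth x i * (2 * d * pair_field x i j) =
      2 * d * local_field A x j.
    rewrite local_fieldE mulr_sumr; apply: eq_bigr => i _.
    by rewrite (pair_field_sym x i j); ring.
  by ring.
rewrite !addrA -!big_split/=; apply: eq_bigr => i _.
by rewrite tnth_set_coordD local_field_set -/d; ring.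
Qed.

(** The Hamiltonian is affine in each spin, and its factor [1 / 3] cancels the three positions that
    spin [j] can take. Hence the law of spin [j] given the others is [mu] tilted by
    [b * local_field A x j + h]. *)
Lemma hamiltonian_set (b h : R) x j z :
  hamiltonian A b h (set_coord x j z) =
  hamiltonian A b h x + (z - tnth x j) * (b * local_field A x j + h).
Proof.
rewrite /hamiltonian !cubicE cubic_set.
have -> : \sum_i tnth (set_coord x j z) i = \sum_i tnth x i + (z - tnth x j).
  rewrite -[in RHS](sum_indic (fun=> z - tnth x j) j) -big_split/=.
  by apply: eq_bigr => i _; rewrite tnth_set_coordD.
by field.
Qed.

Lemma bmeas_pair_field i j : bmN (fun x => pair_field x i j).
Proof.
apply: bmeas_sum => k; apply: bmeasM; first exact: bmeas_cst.
exact: bmeas_tnth.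
Qed.

Lemma bmeas_local_field i : bmN (fun x => local_field A x i).
Proof.
do 2 (apply: bmeas_sum => ?); apply: bmeasM; last exact: bmeas_tnth.
by apply: bmeasM; [exact: bmeas_cst|exact: bmeas_tnth].
Qed.

Lemma bmeas_hamiltonian b h : bmN (hamiltonian A b h).
Proof.
apply: bmeasD; apply: bmeasM; (try exact: bmeas_cst).
  do 3 (apply: bmeas_sum => ?); apply: bmeasM; last exact: bmeas_tnth.
  apply: bmeasM; last exact: bmeas_tnth.
  by apply: bmeasM; [exact: bmeas_cst|exact: bmeas_tnth].
by apply: bmeas_sum => i; exact: bmeas_tnth.
Qed.

Lemma M_ge0 : 0 <= M. Proof. by rewrite addr_ge0. Qed.

Lemma tnth_norm x i : box km kp x -> `|tnth x i| <= M.
Proof. by move=> Bx; exact/norm_itv/Bx. Qed.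

Lemma norm_sum_tensor1 i j (c : 'I_N -> R) K : (0 < N)%N -> 0 <= K ->
  (forall k, `|c k| <= K) -> `|\sum_k A i j k * c k| <= K / N%:R.
Proof.
move=> N0 K0 cK; apply: (le_trans (ler_norm_sum _ _ _)).
apply: (@le_trans _ _ (\sum_(k < N) N%:R ^- 2 * K)).
  apply: ler_sum => k _; rewrite normrM ger0_norm ?(tensor_ge0 tA)//.
  by rewrite ler_pM ?(tensor_ge0 tA) ?(tensor_le tA).
rewrite sumr_const card_ord -mulr_natr le_eqVlt; apply/orP; left; apply/eqP.
by field; rewrite pnatr_eq0 -lt0n.
Qed.

Lemma norm_sum_tensor2 i (c : 'I_N -> 'I_N -> R) K : (0 < N)%N -> 0 <= K ->
  (forall j k, `|c j k| <= K) -> `|\sum_j \sum_k A i j k * c j k| <= K.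
Proof.
move=> N0 K0 cK; apply: (le_trans (ler_norm_sum _ _ _)).
apply: (@le_trans _ _ (\sum_(k < N) K / N%:R)).
  by apply: ler_sum => j _; exact: norm_sum_tensor1.
rewrite sumr_const card_ord -mulr_natr le_eqVlt; apply/orP; left; apply/eqP.
by field; rewrite pnatr_eq0 -lt0n.
Qed.

Lemma pair_field_norm x i j : (0 < N)%N -> box km kp x ->
  `|pair_field x i j| <= M / N%:R.
Proof.
move=> N0 Bx; apply: norm_sum_tensor1 => //.
by move=> k; exact: tnth_norm.
Qed.

Lemma local_field_norm x i : (0 < N)%N -> box km kp x ->
  `|local_field A x i| <= M ^+ 2.
Proof.
move=> N0 Bx; rewrite /local_field.
under eq_bigr => j _ do under eq_bigr => k _ do rewrite -mulrA.
apply: norm_sum_tensor2 => //.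
by move=> j k; rewrite normrM expr2 ler_pM// tnth_norm.
Qed.

Lemma local_field_lip x i j z : (0 < N)%N -> box km kp x -> I z ->
  `|local_field A x i - local_field A (set_coord x j z) i| <=
  4 * M ^+ 2 / N%:R.
Proof.
move=> N0 Bx Iz; rewrite local_field_set opprD addrA subrr add0r normrN.
rewrite !normrM (ger0_norm (_ : 0 <= 2 :> R))//.
have -> : 4 * M ^+ 2 / N%:R = 2 * (M + M) * (M / N%:R) by ring.
rewrite ler_pM ?pair_field_norm// ?mulr_ge0// ler_wpM2l//.
by rewrite (le_trans (ler_normB _ _))// lerD ?tnth_norm// norm_itv.
Qed.

End local_fields.

Section gibbs_mean.
Context (R : realType) (km kp : R) (mu : probability (measurableTypeR R) R).
Hypothesis km_lt_kp : km < kp.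
Hypothesis mu_on : mu [set` `[km, kp]] = 1%E.
Local Notation T := (measurableTypeR R).
Local Notation I := ([set` `[km, kp]] : set T).
Local Notation M := (`|km| + `|kp|).
Local Notation E1 := (expect1 km kp mu).
Local Notation EN := (@expectN R km kp mu _).
Context (N : nat) (A : 'I_N -> 'I_N -> 'I_N -> R) (b h : R).
Hypothesis tA : is_tensor A.
Local Notation bmN := (bmeas (@box R km kp N)).
Local Notation bx := (@box R km kp N).
Local Notation H := (hamiltonian A b h).
Implicit Types (F G : N.-tuple T -> R) (x : N.-tuple T) (i j : 'I_N).

Definition gmean F : R := EN (fun x => F x * expR (H x)) / EN (fun x => expR (H x)).

Definition cond_mean x i : R := tmean km kp mu (b * local_field A x i + h).

Lemma bmeas_weight : bmN (fun x => expR (H x)).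
Proof. by apply: bmeas_expR; exact: bmeas_hamiltonian. Qed.

Let mbox : measurable bx := @measurable_box R km kp N.
Hint Resolve mbox : core.

Lemma EN_weight_gt0 : 0 < EN (fun x => expR (H x)).
Proof.
have [_ [C HC]] := bmeas_hamiltonian km kp A b h.
apply: (@expect_gt0 _ _ _ _ _ mbox _ _ (expR (- C))).
- exact: prod_law_box.
- exact: bmeas_weight.
- exact: expR_gt0.
- by move=> x /HC; rewrite ler_norml ler_expR => /andP[].
Qed.

Lemma gmeanD F G : bmN F -> bmN G ->
  gmean (fun x => F x + G x) = gmean F + gmean G.
Proof.
move=> bF bG; rewrite /gmean -mulrDl /expectN -expectD//; last 2 first.
- by apply: bmeasM => //; exact: bmeas_weight.
- by apply: bmeasM => //; exact: bmeas_weight.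
by congr (_ / _); apply: eq_expect => x _; rewrite mulrDl.
Qed.

Lemma gmeanZ c F : bmN F -> gmean (fun x => c * F x) = c * gmean F.
Proof.
move=> bF; rewrite /gmean mulrA /expectN -expectZ//; last first.
  by apply: bmeasM => //; exact: bmeas_weight.
by congr (_ / _); apply: eq_expect => x _; rewrite mulrA.
Qed.

Lemma gmeanB F G : bmN F -> bmN G ->
  gmean (fun x => F x - G x) = gmean F - gmean G.
Proof.
move=> bF bG; rewrite -mulN1r -gmeanZ// -gmeanD//; last first.
  by apply: bmeasM => //; exact: bmeas_cst.
by congr (_ / _); apply: eq_expect => x _; rewrite mulN1r.
Qed.

Lemma gmean_cst c : gmean (fun=> c) = c.
Proof.
rewrite /gmean /expectN expectZ//; last exact: bmeas_weight.
by rewrite mulfK// gt_eqF// EN_weight_gt0.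
Qed.

Lemma eq_gmean F G : (forall x, bx x -> F x = G x) -> gmean F = gmean G.
Proof. by move=> FG; congr (_ / _); apply: eq_expect => x /FG ->. Qed.

Lemma le_gmean F G : bmN F -> bmN G -> (forall x, bx x -> F x <= G x) ->
  gmean F <= gmean G.
Proof.
move=> bF bG FG; rewrite ler_wpM2r ?invr_ge0 ?(ltW EN_weight_gt0)//.
apply: le_expect => //; try by apply: bmeasM => //; exact: bmeas_weight.
by move=> x /FG Fx; rewrite ler_wpM2r// expR_ge0.
Qed.

Lemma gmean_ge0 F : (forall x, bx x -> 0 <= F x) -> 0 <= gmean F.
Proof.
move=> F0; rewrite mulr_ge0 ?invr_ge0 ?(ltW EN_weight_gt0)//.
by apply: expect_ge0 => x /F0 Fx; rewrite mulr_ge0// expR_ge0.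
Qed.

Lemma gmean_sum (J : Type) (r : seq J) (Q : pred J) (F : J -> N.-tuple T -> R) :
  (forall i : J, bmN (F i)) ->
  gmean (fun x => \sum_(i <- r | Q i) F i x) = \sum_(i <- r | Q i) gmean (F i).
Proof.
move=> bF; rewrite /gmean -mulr_suml /expectN -expect_sum//; last first.
  by move=> i; apply: bmeasM => //; exact: bmeas_weight.
by congr (_ / _); apply: eq_expect => x _; rewrite mulr_suml.
Qed.

Lemma partition_funE : partition_fun mu A b h = EN (fun x => expR (H x)).
Proof.
rewrite /partition_fun (@expectT _ _ _ _ bx)//.
- exact: prod_law_box.
- by case: bmeas_weight.
Qed.

Lemma gibbsE (S : set (N.-tuple T)) : measurable S ->
  gibbs mu A b h S = (gmean (\1_S))%:E.
Proof.
move=> mS; pose W x := expR (H x) / partition_fun mu A b h.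
have bW : bmN W by apply: bmeasM; [exact: bmeas_weight|exact: bmeas_cst].
have bSW : bmN (fun x => \1_S x * W x).
  by apply: bmeasM => //; exact: bmeas_indic.
have W0 x : 0 <= W x.
  by rewrite mulr_ge0 ?expR_ge0// invr_ge0 partition_funE ltW// EN_weight_gt0.
have SW0 x : 0 <= \1_S x * W x by rewrite mulr_ge0// indicE.
rewrite /gibbs -/W integral_mkcond/=.
rewrite (eq_integral (fun x => (\1_S x * W x)%:E)); last first.
  move=> x _; rewrite patchE indicE; case: ifPn => xS; first by rewrite mul1r.
  by rewrite mul0r.
have -> : gmean \1_S = EN (fun x => \1_S x * W x).
  rewrite /gmean -partition_funE /expectN -expectZr//.
    by apply: eq_expect => x _; rewrite /W mulrA.
  by apply: bmeasM; [exact: bmeas_indic|exact: bmeas_weight].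
rewrite /expectN expectE /Rintegral fineK; last first.
  by apply: integrable_fin_num => //; exact: bmeas_integrable.
rewrite (@ge0_negligible_integral _ _ _ _ setT (~` bx))//.
- by rewrite setTD setCK.
- exact: measurableC.
- by apply/measurable_EFinP; case: bSW.
- by move=> x _; rewrite lee_fin.
- by apply: negligible_setC => //; exact: prod_law_box.
Qed.

Lemma bmeas_cond_mean i : bmN (fun x => cond_mean x i).
Proof.
apply: (bmeas_comp (@tmean_continuous _ _ _ mu mu_on)).
apply: bmeasD; last exact: bmeas_cst.
by apply: bmeasM; [exact: bmeas_cst|exact: bmeas_local_field].
Qed.

Lemma cond_mean_norm x i : `|cond_mean x i| <= M.
Proof. exact: tmean_norm. Qed.

Lemma cond_mean_set_same x i z : cond_mean (set_coord x i z) i = cond_mean x i.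
Proof. by rewrite /cond_mean local_field_set_same. Qed.

(* [cond_mean x j] is the conditional mean of the [j]-th spin given the others. *)
Lemma gmean_null (j : 'I_N) F : bmN F ->
  (forall x z, F (set_coord x j z) = F x) ->
  gmean (fun x => (tnth x j - cond_mean x j) * F x) = 0.
Proof.
move=> bF Fj; rewrite /gmean (@EN_null _ _ _ mu km_lt_kp mu_on _ _ j) ?mul0r//.
  apply: bmeasM; last exact: bmeas_weight.
  by apply: bmeasM => //; apply: bmeasB; [exact: bmeas_tnth|exact: bmeas_cond_mean].
move=> x Bx; set th := b * local_field A x j + h.
have <- : F x * expR (H x - tnth x j * th) *
    E1 (fun z => (z - tmean km kp mu th) * expR (th * z)) = 0.
  by rewrite tilt_null// mulr0.
rewrite /expect1 -expectZ//; last first.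
  apply: bmeasM; first by apply: bmeasB; [exact: bmeas_id|exact: bmeas_cst].
  by apply: bmeas_expR; apply: bmeasM; [exact: bmeas_cst|exact: bmeas_id].
apply: eq_expect => z Iz.
rewrite tnth_set_coord eqxx cond_mean_set_same Fj hamiltonian_set// -/th.
have e2 : expR ((z - tnth x j) * th) = expR (th * z) * expR (- (tnth x j * th)).
  by rewrite -expRD; congr expR; ring.
by rewrite [in LHS]expRD e2 [expR (H x - _)]expRD /cond_mean -/th; ring.
Qed.

Hypothesis N_gt0 : (0 < N)%N.

Lemma gmean_second_moment (phi : 'I_N -> N.-tuple T -> R) (B : R) : 0 <= B ->
  (forall j, bmN (phi j)) ->
  (forall j x, bx x -> `|phi j x| <= B) ->
  (forall j x z, phi j (set_coord x j z) = phi j x) ->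
  (forall j l x, bx x -> `|phi l x - phi l (set_coord x j km)| <= B / N%:R) ->
  gmean (fun x => (\sum_j (tnth x j - cond_mean x j) * phi j x) ^+ 2) <=
  (8 * M ^+ 5 * `|b| + 8 * M ^+ 2) * N%:R * B ^+ 2.
Proof.
move=> B0 bphi phiB phij philip.
have M0 : 0 <= M := M_ge0 km kp.
have Ik : I km by rewrite /= in_itv/= lexx ltW.
have btc j : bmN (fun x => tnth x j - cond_mean x j).
  by apply: bmeasB; [exact: bmeas_tnth|exact: bmeas_cond_mean].
have tc2 x j : bx x -> `|tnth x j - cond_mean x j| <= 2 * M.
  move=> Bx; rewrite (le_trans (ler_normB _ _))//.
  by have := tnth_norm j Bx; have := cond_mean_norm x j; lra.
pose a j x := (tnth x j - cond_mean x j) * phi j x.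
have ba j : bmN (a j) by exact: bmeasM.
have -> : gmean (fun x => (\sum_j a j x) ^+ 2) =
    \sum_j \sum_l gmean (fun x => a j x * a l x).
  rewrite -(@eq_gmean (fun x => \sum_j \sum_l a j x * a l x)); last first.
    move=> x _; rewrite expr2 mulr_suml; apply: eq_bigr => j _.
    by rewrite mulr_sumr.
  rewrite gmean_sum; last by move=> j; apply: bmeas_sum => l; exact: bmeasM.
  by apply: eq_bigr => j _; rewrite gmean_sum// => l; exact: bmeasM.
have diag j : gmean (fun x => a j x * a j x) <= 4 * M ^+ 2 * B ^+ 2.
  rewrite -(gmean_cst (4 * _ * _)); apply: le_gmean.
  - exact: bmeasM.
  - exact: bmeas_cst.
  move=> x Bx; rewrite (le_trans (ler_norm _))// normrM -expr2 /a normrM.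
  have -> : 4 * M ^+ 2 * B ^+ 2 = (2 * M * B) ^+ 2 by ring.
  rewrite ler_pXn2r ?nnegrE ?mulr_ge0// ler_pM//; first exact: tc2.
  exact: phiB.
have off j l : l != j -> gmean (fun x => a j x * a l x) <=
    (8 * M ^+ 5 * `|b| + 4 * M ^+ 2) / N%:R * B ^+ 2.
  move=> lj; pose psi x := (tnth x l - cond_mean x l) * phi l x * phi j x.
  have bset F : bmN F -> bmN (fun x => F (set_coord x j km)).
    move=> [mF [C FC]]; split; last first.
      by exists C => x Bx; apply/FC/box_set_coord.
    apply: (measurableT_comp mF); apply/measurable_fun_tnthP => i.
    rewrite (_ : _ \o _ = fun x : N.-tuple T => if i == j then km else tnth x i).
      by case: eqP => _; [exact: measurable_cst|exact: measurable_tnth].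
    by apply/funext => x /=; rewrite tnth_set_coord.
  have bpsi : bmN psi by apply: bmeasM => //; apply: bmeasM.
  have bpsi' := bset _ bpsi.
  have null := gmean_null bpsi' _.
  have {}null : gmean (fun x => (tnth x j - cond_mean x j) *
      psi (set_coord x j km)) = 0.
    apply: null => x z; congr psi; apply: eq_from_tnth => i.
    by rewrite !tnth_set_coord; case: eqP.
  rewrite -[leLHS]subr0 -null -gmeanB; last 2 first.
  - exact: bmeasM.
  - exact: bmeasM.
  rewrite -[leRHS]gmean_cst; apply: le_gmean.
  - by apply: bmeasB; exact: bmeasM.
  - exact: bmeas_cst.
  move=> x Bx; set x' := set_coord x j km.
  have Bx' : bx x' by exact: box_set_coord.
  have -> : a j x * a l x - (tnth x j - cond_mean x j) * psi x' =
      (tnth x j - cond_mean x j) * (phi j x *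
      ((cond_mean x' l - cond_mean x l) * phi l x +
       (tnth x l - cond_mean x' l) * (phi l x - phi l x'))).
    rewrite /a /psi phij {1}/x' tnth_set_coord (negbTE lj); ring.
  rewrite (le_trans (ler_norm _))// !normrM.
  apply: (@le_trans _ _ (2 * M * (B * ((M ^+ 2 * (`|b| * (4 * M ^+ 2 / N%:R))) * B
     + 2 * M * (B / N%:R))))); last first.
    rewrite le_eqVlt; apply/orP; left; apply/eqP; field.
    by rewrite pnatr_eq0 -lt0n.
  rewrite ler_pM ?mulr_ge0//; first exact: tc2.
  rewrite ler_pM//; first exact: phiB.
  rewrite (le_trans (ler_normD _ _))// !normrM lerD//.
    rewrite ler_pM//; last exact: phiB.
    apply: (le_trans (tmean_lip mu_on _ _)); rewrite ler_wpM2l ?sqr_ge0//.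
    rewrite opprD addrACA subrr addr0 -mulrBr normrM ler_wpM2l// distrC.
    exact: local_field_lip.
  rewrite ler_pM//; last exact: philip.
  by have := tc2 _ l Bx'; rewrite /x' tnth_set_coord (negbTE lj).
apply: (@le_trans _ _ (\sum_(j < N) \sum_(l < N) (
   (8 * M ^+ 5 * `|b| + 4 * M ^+ 2) / N%:R * B ^+ 2 +
   4 * M ^+ 2 * B ^+ 2 * (l == j)%:R))).
  apply: ler_sum => j _; apply: ler_sum => l _.
  have [->|lj] := eqVneq l j.
    rewrite mulr1 (le_trans (diag j))// lerDr.
    by rewrite mulr_ge0 ?sqr_ge0// divr_ge0// addr_ge0 ?mulr_ge0 ?exprn_ge0.
  by rewrite mulr0 addr0; exact: off.
under eq_bigr => j _.
  rewrite big_split/= sum_indic sumr_const card_ord -mulr_natr; over.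
rewrite sumr_const card_ord -mulr_natr le_eqVlt; apply/orP; left; apply/eqP.
by field; rewrite pnatr_eq0 -lt0n.
Qed.

End gibbs_mean.

(** * Pseudo-likelihood *)

Section pseudo_likelihood.
Context (R : realType) (L t : R -> R) (N : nat) (x m : 'I_N -> R).
Hypothesis is_derive_L : forall s : R, is_derive s (1 : R) L (t s).
Implicit Types (u : R * R).

Definition theta u i : R := u.1 * m i + u.2.
(** With [L = Lambda mu] and [m] the local fields, each term is the logarithm of the conditional
    density of [x i] given the other spins, relative to [mu]. *)
Definition pseudo_lik u : R := \sum_i (x i * theta u i - L (theta u i)).
Definition score1 u : R := \sum_i m i * (x i - t (theta u i)).
Definition score2 u : R := \sum_i (x i - t (theta u i)).

Lemma is_derive_lik_term (a c y : R) (s : R) :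
  is_derive s (1 : R) (fun s => y * (s * a + c) - L (s * a + c))
    (a * (y - t (s * a + c))).
Proof.
have d1 : is_derive s (1 : R) (fun s : R => s * a + c) a.
  by apply: is_derive_eq; rewrite /GRing.scale/=; ring.
have d2 := @is_derive1_comp R L (fun s : R => s * a + c) s _ _ (is_derive_L _) d1.
have d3 : is_derive s (1 : R) (fun s : R => y * (s * a + c)) (y * a).
  by apply: is_derive_eq; rewrite /GRing.scale/=; ring.
by apply: (is_derive_eq (is_deriveB d3 d2)); rewrite /GRing.scale/=; ring.
Qed.

Lemma is_derive_lik1 (c s : R) :
  is_derive s (1 : R) (fun s => pseudo_lik (s, c)) (score1 (s, c)).
Proof.
have -> : (fun s => pseudo_lik (s, c)) =
    \sum_i (fun s => x i * (s * m i + c) - L (s * m i + c)).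
  by apply/funext => r; rewrite fct_sumE.
by apply: is_derive_sum => i; exact: is_derive_lik_term.
Qed.

Lemma is_derive_lik2 (a s : R) :
  is_derive s (1 : R) (fun s => pseudo_lik (a, s)) (score2 (a, s)).
Proof.
have -> : (fun s => pseudo_lik (a, s)) =
    \sum_i (fun s => x i * (s * 1 + a * m i) - L (s * 1 + a * m i)).
  apply/funext => r; rewrite fct_sumE; apply: eq_bigr => i _.
  by rewrite /theta/= mulr1 (addrC r).
apply: (is_derive_eq (is_derive_sum (fun i => is_derive_lik_term 1 (a * m i) (x i) s))).
by apply: eq_bigr => i _; rewrite /theta/= mulr1 mul1r (addrC s).
Qed.

Lemma continuous_lik : continuous pseudo_lik.
Proof.
move=> u; have cL : continuous L.
  move=> s; apply: differentiable_continuous.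
  by apply/derivable1_diffP; have [] := is_derive_L s.
have cth i : theta ^~ i u' @[u' --> u] --> theta u i.
  apply: cvgD; last exact: cvg_snd.
  by apply: cvgM; [exact: cvg_fst|exact: cvg_cst].
rewrite /continuous_at /pseudo_lik; elim: (index_enum _) => [|i r IH].
  under eq_cvg do rewrite big_nil.
  by rewrite big_nil; exact: cvg_cst.
under eq_cvg do rewrite big_cons.
rewrite big_cons; apply: cvgD => //; apply: cvgB.
  by apply: cvgM; [exact: cvg_cst|exact: cth].
exact: (cvg_comp _ _ (cth i) (cL _)).
Qed.

Let mbar := N%:R^-1 * \sum_i m i.
Let var := N%:R^-1 * \sum_i (m i - mbar) ^+ 2.

Lemma quadratic_form u : (0 < N)%N ->
  \sum_i theta u i ^+ 2 = N%:R * (u.1 ^+ 2 * var + (u.1 * mbar + u.2) ^+ 2).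
Proof.
move=> N0; have N0' : N%:R != 0 :> R by rewrite pnatr_eq0 -lt0n.
have s1 : \sum_i m i = N%:R * mbar by rewrite /mbar mulVKf.
have s2 : \sum_i (m i - mbar) ^+ 2 = N%:R * var by rewrite /var mulVKf.
have s0 : \sum_(i < N) (m i - mbar) = 0.
  by rewrite sumrB s1 sumr_const card_ord -mulr_natr; ring.
transitivity (\sum_i (u.1 ^+ 2 * (m i - mbar) ^+ 2 +
    (2 * u.1 * (u.1 * mbar + u.2)) * (m i - mbar) + (u.1 * mbar + u.2) ^+ 2)).
  by apply: eq_bigr => i _; rewrite /theta; ring.
rewrite !big_split/= -!mulr_sumr s2 s0 sumr_const card_ord -mulr_natr; ring.
Qed.

Variables (K d : R).
Hypotheses (N0 : (0 < N)%N) (K0 : 0 <= K) (mK : forall i, `|m i| <= K)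
  (d01 : 0 < d <= 1) (dvar : d <= var).

(** The variance of [m] controls [u.1]; then [u.1 * mbar + u.2] together with [|mbar| <= K] controls
    [u.2]. Capping [d] at one makes the coefficient of the second square at most one. *)
Lemma quadratic_lb u :
  d / (4 * (K ^+ 2 + 1)) * N%:R * (u.1 ^+ 2 + u.2 ^+ 2) <= \sum_i theta u i ^+ 2.
Proof.
have NR : 0 < N%:R :> R by rewrite ltr0n.
have mbK : mbar ^+ 2 <= K ^+ 2.
  rewrite -(real_normK (num_real mbar)) ler_pXn2r ?nnegrE//.
  rewrite /mbar normrM ger0_norm ?invr_ge0// ler_pdivrMl//.
  rewrite (le_trans (ler_norm_sum _ _ _))//.
  apply: (@le_trans _ _ (\sum_(i < N) K)); first by apply: ler_sum.
  by rewrite sumr_const card_ord mulr_natl.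
rewrite quadratic_form// mulrAC (mulrC N%:R) ler_wpM2r ?(ltW NR)//.
set q := u.1 ^+ 2; have q0 : 0 <= q by exact: sqr_ge0.
set w := (u.1 * mbar + u.2) ^+ 2; have w0 : 0 <= w by exact: sqr_ge0.
have K1 : 0 < K ^+ 2 + 1 by rewrite ltr_wpDl// sqr_ge0.
set tau := d / (4 * (K ^+ 2 + 1)).
case/andP: d01 => d0 d1.
have tau0 : 0 < tau by rewrite divr_gt0// mulr_gt0.
have tauE : tau * (4 * (K ^+ 2 + 1)) = d.
  by rewrite divfK// gt_eqF// mulr_gt0.
have h1 : u.2 ^+ 2 <= 2 * w + 2 * (q * mbar ^+ 2).
  have := sqr_ge0 (2 * (u.1 * mbar) + u.2); rewrite /w /q; nra.
have h2 : q * mbar ^+ 2 <= q * K ^+ 2 by rewrite ler_wpM2l.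
have h3 : q * d <= q * var by rewrite ler_wpM2l.
have h4 : tau * u.2 ^+ 2 <= tau * (2 * w + 2 * (q * K ^+ 2)).
  by rewrite ler_wpM2l ?(ltW tau0)//; lra.
have h5 : 2 * tau <= 1.
  have := sqr_ge0 K; move: tauE d1 tau0; nra.
have h6 : 2 * tau * w <= w by rewrite -[leRHS]mul1r ler_wpM2r.
have h8 : q * d = tau * q * 4 + 4 * (tau * (q * K ^+ 2)) by rewrite -tauE; ring.
have h9 : 0 <= tau * (q * K ^+ 2).
  by rewrite mulr_ge0 ?(ltW tau0)// mulr_ge0// sqr_ge0.
have h10 : 0 <= tau * q by rewrite mulr_ge0 ?(ltW tau0).
rewrite mulrDr; move: h3 h4 h6 h8 h9 h10.
set a1 := q * var; set a2 := tau * q; set a3 := tau * (q * K ^+ 2).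
have -> : tau * (2 * w + 2 * (q * K ^+ 2)) = 2 * tau * w + 2 * a3.
  by rewrite /a3; ring.
lra.
Qed.

(** Pairing the difference of the scores with [u' - u] gives a sum of non-negative monotonicity
    terms. If it vanishes, [theta u] and [theta u'] agree at every [i], and [quadratic_lb] forces
    [u' = u]. *)
Lemma score_unique u u' :
  (forall a b, a != b -> 0 < (t a - t b) * (a - b)) ->
  score1 u = 0 -> score2 u = 0 -> score1 u' = 0 -> score2 u' = 0 -> u' = u.
Proof.
move=> tmono s1 s2 s1' s2'.
pose g i := (t (theta u' i) - t (theta u i)) * (theta u' i - theta u i).
have g0 i : 0 <= g i.
  rewrite /g; have [->|ne] := eqVneq (theta u' i) (theta u i).
    by rewrite !subrr mulr0.
  exact/ltW/tmono.
have sg : \sum_i g i = 0.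
  have -> : \sum_i g i = (u'.1 - u.1) * (score1 u - score1 u') +
      (u'.2 - u.2) * (score2 u - score2 u').
    rewrite /score1 /score2 -!sumrB !mulr_sumr -big_split/=.
    by apply: eq_bigr => i _; rewrite /g /theta; ring.
  by rewrite s1 s2 s1' s2' subrr !mulr0 addr0.
have th0 i : theta (u'.1 - u.1, u'.2 - u.2) i = 0.
  have /eqP := sg; rewrite psumr_eq0 => [/allP/(_ i)|]; last by [].
  rewrite mem_index_enum => /(_ isT)/= /eqP gi.
  have [e|/tmono] := eqVneq (theta u' i) (theta u i); last by rewrite -/(g i) gi ltxx.
  have : theta u' i - theta u i = 0 by rewrite e subrr.
  by rewrite /theta/= => <-; ring.
have := quadratic_lb (u'.1 - u.1, u'.2 - u.2).
rewrite big1 => [/=|i _]; last by rewrite th0 expr0n.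
rewrite pmulr_rle0; last first.
  case/andP: d01 => d0 d1; rewrite mulr_gt0 ?ltr0n// divr_gt0// mulr_gt0//.
  by rewrite ltr_wpDl// sqr_ge0.
move=> h; have e1 : (u'.1 - u.1) ^+ 2 = 0.
  by apply/eqP; rewrite eq_le; have := sqr_ge0 (u'.1 - u.1); have := sqr_ge0 (u'.2 - u.2); lra.
have e2 : (u'.2 - u.2) ^+ 2 = 0.
  by apply/eqP; rewrite eq_le; have := sqr_ge0 (u'.1 - u.1); have := sqr_ge0 (u'.2 - u.2); lra.
move/eqP: e1; rewrite sqrf_eq0 subr_eq0 => /eqP e1.
move/eqP: e2; rewrite sqrf_eq0 subr_eq0 => /eqP e2.
by case: u u' e1 e2 {s1 s2 s1' s2' g g0 sg th0 h} => [? ?] [? ?] /= -> ->.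
Qed.

(* The concave pseudo-likelihood is smaller on the boundary of the square of
   radius [r] than at its centre, so that it is maximal at an interior point. *)
Lemma score_exists (u0 : R * R) (c r L0 S : R) : 0 < c -> 0 < r ->
  (`|u0.1| + r) * K + `|u0.2| + r <= L0 ->
  (forall a b, `|a| <= L0 -> `|b| <= L0 ->
     t a * (b - a) + c / 2 * (b - a) ^+ 2 <= L b - L a) ->
  `|score1 u0| <= S -> `|score2 u0| <= S ->
  2 * S < c / 2 * (d / (4 * (K ^+ 2 + 1)) * N%:R) * r ->
  exists u, [/\ score1 u = 0, score2 u = 0 &
    `|u.1 - u0.1| <= r /\ `|u.2 - u0.2| <= r].
Proof.
move=> c0 r0 rL Lc S1 S2 Sr.
set c1 := d / _ * _ in Sr.
have S0 : 0 <= S by exact: le_trans S1.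
pose Q := (`[u0.1 - r, u0.1 + r] `*` `[u0.2 - r, u0.2 + r])%classic : set (R * R).
have cQ : compact Q by apply: compact_setX; exact: segment_compact.
have Q0 : Q !=set0.
  by exists u0; split => /=; rewrite in_itv/=; apply/andP; split; lra.
have [u uQ umax] := compact_EVT_max Q0 cQ (continuous_subspaceT continuous_lik).
have {uQ} [/= uQ1 uQ2] : Q u by exact: set_mem.
have thL v i : Q v -> `|theta v i| <= L0.
  move=> [/=]; rewrite !in_itv/= -!ler_distlC => v1 v2.
  apply: le_trans rL; rewrite -addrA; apply: (le_trans (ler_normD _ _)).
  have h1 : `|v.1| <= `|u0.1| + r.
    by have := ler_normB v.1 u0.1; have := ler_distD 0 v.1 u0.1; have := lerB_dist v.1 u0.1; rewrite distrC in v1; lra.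
  have h2 : `|v.2| <= `|u0.2| + r.
    by have := lerB_dist v.2 u0.2; rewrite distrC in v2; lra.
  by rewrite lerD// normrM ler_pM.
have Qu0 : Q u0 by split => /=; rewrite in_itv/=; apply/andP; split; lra.
(* A gradient of size [S] competes with a curvature of order [N]; the hypothesis relating [S] and
   [r] says that the curvature wins at distance [r]. *)
have decr v : Q v -> pseudo_lik v - pseudo_lik u0 <=
    S * (`|v.1 - u0.1| + `|v.2 - u0.2|) -
    c / 2 * c1 * ((v.1 - u0.1) ^+ 2 + (v.2 - u0.2) ^+ 2).
  move=> Qv; pose w := (v.1 - u0.1, v.2 - u0.2).
  have wth i : theta v i - theta u0 i = theta w i by rewrite /theta/=; ring.
  have le1 : pseudo_lik v - pseudo_lik u0 <=
      w.1 * score1 u0 + w.2 * score2 u0 - c / 2 * \sum_i theta w i ^+ 2.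
    rewrite /pseudo_lik /score1 /score2 -sumrB !mulr_sumr -sumrN -!big_split/=.
    apply: ler_sum => i _; have := Lc _ _ (thL _ i Qu0) (thL _ i Qv).
    rewrite wth; set a := L (theta v i); set b := L _; set e := t _.
    have -> : theta v i = theta u0 i + theta w i by rewrite -wth; ring.
    have -> : (v.1 - u0.1) * (m i * (x i - e)) + (v.2 - u0.2) * (x i - e) =
      theta w i * (x i - e) by rewrite /theta/=; ring.
    lra.
  apply: (le_trans le1); rewrite lerB//.
    rewrite mulrDr lerD// (le_trans (ler_norm _))// normrM mulrC ler_wpM2r//.
  rewrite -mulrA ler_wpM2l ?divr_ge0 ?(ltW c0)//.
  exact: (quadratic_lb w).
have bnd v : Q v -> (`|v.1 - u0.1| = r \/ `|v.2 - u0.2| = r) ->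
    pseudo_lik v < pseudo_lik u0.
  move=> Qv vr; rewrite -subr_lt0; apply: (le_lt_trans (decr _ Qv)).
  have [/=] := Qv; rewrite !in_itv/= -!ler_distlC !(distrC u0.1) !(distrC u0.2) => v1 v2.
  set e1 := `|_| in v1 vr *; set e2 := `|_| in v2 vr *.
  rewrite -(real_normK (num_real (v.1 - _))) -(real_normK (num_real (v.2 - _))).
  rewrite -/e1 -/e2 subr_lt0.
  set C := c / 2 * c1 in Sr *.
  have e10 : 0 <= e1 by exact: normr_ge0.
  have e20 : 0 <= e2 by exact: normr_ge0.
  have C0 : 0 < C.
    by rewrite -(pmulr_lgt0 _ r0) (le_lt_trans _ Sr)// mulr_ge0.
  apply: (@le_lt_trans _ _ (2 * S * r)).
    by rewrite -mulrA mulrCA ler_wpM2l//; lra.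
  apply: (@lt_le_trans _ _ (C * r * r)); first by rewrite ltr_pM2r.
  rewrite -mulrA ler_wpM2l ?(ltW C0)// -expr2.
  by case: vr => ->; rewrite ?lerDl ?lerDr sqr_ge0.
have umax' v : Q v -> pseudo_lik v <= pseudo_lik u by move=> Qv; apply/umax/mem_set.
have int1 : u.1 \in `]u0.1 - r, u0.1 + r[.
  rewrite in_itv/=; move: (uQ1); rewrite in_itv/= => /andP[l1 l2].
  apply/andP; split; rewrite lt_neqAle ?l1 ?l2 andbT; apply/eqP => e;
    have := umax' _ Qu0; rewrite leNgt bnd//; left.
    by rewrite -e addrAC subrr sub0r normrN gtr0_norm.
  by rewrite e addrAC subrr add0r gtr0_norm.
have int2 : u.2 \in `]u0.2 - r, u0.2 + r[.
  rewrite in_itv/=; move: (uQ2); rewrite in_itv/= => /andP[l1 l2].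
  apply/andP; split; rewrite lt_neqAle ?l1 ?l2 andbT; apply/eqP => e;
    have := umax' _ Qu0; rewrite leNgt bnd//; right.
    by rewrite -e addrAC subrr sub0r normrN gtr0_norm.
  by rewrite e addrAC subrr add0r gtr0_norm.
exists u; split; last first.
- by move: uQ1 uQ2; rewrite !in_itv/= -!ler_distlC (distrC u.1) (distrC u.2).
- have -> : u = (u.1, u.2) by case: (u).
  have [_ <-] := is_derive_lik2 u.1 u.2.
  have [|||_ ->] // := @derive1_at_max _ (fun s => pseudo_lik (u.1, s)) _ _ u.2 _ _ int2.
  + by lra.
  + by move=> s _; have [] := is_derive_lik2 u.1 s.
  + move=> s /= sQ; have -> : (u.1, u.2) = u by case: (u).
    apply: umax'; split => //=; exact: subset_itv_oo_cc sQ.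
- have -> : u = (u.1, u.2) by case: (u).
  have [_ <-] := is_derive_lik1 u.2 u.1.
  have [|||_ ->] // := @derive1_at_max _ (fun s => pseudo_lik (s, u.2)) _ _ u.1 _ _ int1.
  + by lra.
  + by move=> s _; have [] := is_derive_lik1 u.2 s.
  + move=> s /= sQ; have -> : (u.1, u.2) = u by case: (u).
    apply: umax'; split => //=; exact: subset_itv_oo_cc sQ.
Qed.

End pseudo_likelihood.

(** * Fluctuations of the local fields *)

Section average.
Context (R : realType) (N : nat).
Implicit Types (u v : 'I_N -> R).

Definition avg u : R := N%:R^-1 * \sum_i u i.

Lemma avgD u v : avg (fun i => u i + v i) = avg u + avg v.
Proof. by rewrite /avg big_split mulrDr. Qed.

Lemma avgZ c u : avg (fun i => c * u i) = c * avg u.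
Proof. by rewrite /avg -mulr_sumr; ring. Qed.

Lemma eq_avg u v : u =1 v -> avg u = avg v.
Proof. by move=> uv; congr (_ * _); apply: eq_bigr => i _. Qed.

Lemma le_avg u v : (forall i, u i <= v i) -> avg u <= avg v.
Proof. by move=> uv; rewrite ler_wpM2l ?invr_ge0//; apply: ler_sum. Qed.

Lemma avg_ge0 u : (forall i, 0 <= u i) -> 0 <= avg u.
Proof. by move=> u0; rewrite mulr_ge0 ?invr_ge0//; apply: sumr_ge0. Qed.

Lemma norm_avg u : `|avg u| <= avg (fun i => `|u i|).
Proof.
rewrite /avg normrM ger0_norm ?invr_ge0// ler_wpM2l ?invr_ge0//.
exact: ler_norm_sum.
Qed.

Hypothesis N0 : (0 < N)%N.

Lemma natr_neq0 : N%:R != 0 :> R. Proof. by rewrite pnatr_eq0 -lt0n. Qed.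

Lemma avg_cst c : avg (fun=> c) = c.
Proof. by rewrite /avg sumr_const card_ord -(mulr_natl c) mulKf// natr_neq0. Qed.

Lemma avg_sqr_shift u s :
  avg (fun i => (u i - s) ^+ 2) =
  avg (fun i => (u i - avg u) ^+ 2) + (avg u - s) ^+ 2.
Proof.
set a := avg u.
have a0 : avg (fun i => u i - a) = 0.
  by rewrite avgD -/a avg_cst subrr.
rewrite (eq_avg (v := fun i => (u i - a) ^+ 2 + (2 * (a - s) * (u i - a)
   + (a - s) ^+ 2))); last by move=> i; ring.
by rewrite avgD avgD avgZ a0 mulr0 add0r avg_cst.
Qed.

Lemma sqr_avg_le u : avg u ^+ 2 <= avg (fun i => u i ^+ 2).
Proof.
have := avg_sqr_shift u 0.
rewrite (eq_avg (v := fun i => u i ^+ 2)); last by move=> i; rewrite subr0.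
by rewrite subr0 => ->; rewrite lerDr; apply: avg_ge0 => i; exact: sqr_ge0.
Qed.

Lemma variance_le u s :
  avg (fun i => (u i - avg u) ^+ 2) <= avg (fun i => (u i - s) ^+ 2).
Proof. by rewrite (avg_sqr_shift u s) lerDl sqr_ge0. Qed.

End average.

Section tstat.
Context (R : realType) (km kp : R) (mu : probability (measurableTypeR R) R).
Hypothesis km_lt_kp : km < kp.
Hypothesis mu_on : mu [set` `[km, kp]] = 1%E.
Local Notation T := (measurableTypeR R).
Local Notation I := ([set` `[km, kp]] : set T).
Local Notation M := (`|km| + `|kp|).
Context (N : nat) (A : 'I_N -> 'I_N -> 'I_N -> R) (b h : R).
Hypothesis tA : is_tensor A.
Hypothesis N0 : (0 < N)%N.
Local Notation bmN := (bmeas (@box R km kp N)).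
Local Notation bx := (@box R km kp N).
Local Notation t := (tmean km kp mu).
Local Notation cm := (cond_mean km kp mu A b h).
Local Notation gm := (gmean km kp mu A b h).
Implicit Types (x : N.-tuple T) (i j k : 'I_N).

Definition degree i : R := \sum_j \sum_k A i j k.
Definition codegree i k : R := \sum_j A i j k.
Definition fluct_pair x i : R := \sum_j (tnth x j - cm x j) * pair_field A x i j.
Definition fluct_deg x i : R := \sum_k (tnth x k - cm x k) * codegree i k.
(** Collects the two random error terms of [local_field_decomp]; the weight [M ^+ 2] bounds the
    square of the coefficient [c] there. *)
Definition fluct x : R :=
  avg (fun i => fluct_pair x i ^+ 2 + M ^+ 2 * fluct_deg x i ^+ 2).

Lemma TstatE x : Tstat A x =
  avg (fun i => (local_field A x i - avg (local_field A x)) ^+ 2).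
Proof. by []. Qed.

(** In the double sum each of the two spins is replaced by its conditional mean and then by [c], one
    spin after the other. The first two errors are centred fluctuations, the last two measure how
    far the conditional means are from [c]. *)
Lemma local_field_decomp x c i :
  local_field A x i - c ^+ 2 * degree i =
  fluct_pair x i + c * fluct_deg x i +
  \sum_j (cm x j - c) * pair_field A x i j +
  c * \sum_k (cm x k - c) * codegree i k.
Proof.
have -> : c ^+ 2 * degree i = c * (\sum_k c * codegree i k).
  rewrite -mulr_sumr mulrA -expr2; congr (_ * _).
  by rewrite /degree exchange_big.
have -> : local_field A x i = fluct_pair x i +
    \sum_j (cm x j - c) * pair_field A x i j + c * \sum_j pair_field A x i j.
  rewrite mulr_sumr /fluct_pair -!big_split/= local_fieldE.
  by apply: eq_bigr => j _; ring.
have -> : \sum_j pair_field A x i j = fluct_deg x i +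
    \sum_k (cm x k - c) * codegree i k + \sum_k c * codegree i k.
  rewrite /pair_field exchange_big/= /fluct_deg -!big_split/=.
  by apply: eq_bigr => k _; rewrite -mulr_suml -/(codegree i k); ring.
ring.
Qed.

Lemma codegree_ge0 i k : 0 <= codegree i k.
Proof. by apply: sumr_ge0 => j _; exact: tensor_ge0 tA _ _ _. Qed.

Lemma codegree_le i k : codegree i k <= N%:R^-1.
Proof.
apply: (@le_trans _ _ (\sum_(j < N) N%:R ^- 2)).
  by apply: ler_sum => j _; exact: tensor_le tA _ _ _.
rewrite sumr_const card_ord -mulr_natr le_eqVlt; apply/orP; left; apply/eqP.
by field; exact: natr_neq0.
Qed.

Lemma degree_itv i : 0 <= degree i <= 1.
Proof.
apply/andP; split.
  by apply: sumr_ge0 => j _; apply: sumr_ge0 => k _; exact: tensor_ge0 tA _ _ _.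
rewrite /degree exchange_big/=.
apply: (@le_trans _ _ (\sum_(j < N) N%:R^-1)).
  by apply: ler_sum => j _; exact: codegree_le.
by rewrite sumr_const card_ord -(mulr_natr (_^-1)) mulVf// natr_neq0.
Qed.

Local Notation M_ge0 := (M_ge0 km kp).

Lemma weighted_norm (e w : 'I_N -> R) K : 0 <= K ->
  (forall j, `|w j| <= K / N%:R) ->
  `|\sum_j e j * w j| <= avg (fun j => `|e j|) * K.
Proof.
move=> K0 wK; apply: (le_trans (ler_norm_sum _ _ _)).
rewrite /avg mulrAC (mulrC _ K) mulr_sumr; apply: ler_sum => j _.
by rewrite normrM (mulrC `|e j|); exact: ler_wpM2r.
Qed.

(** As [t] is Lipschitz, the conditional means deviate from [c] at most in proportion to the
    deviation of the local fields from their average, so [Tstat] controls the last two errors of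
    [local_field_decomp] and [fluct] the first two. The factor 3 splits a square of three terms, and
    [12 = 3 * 4] as the third term is itself a sum of two. *)
Lemma local_field_close x c : bx x -> c = t (b * avg (local_field A x) + h) ->
  avg (fun i => (local_field A x i - c ^+ 2 * degree i) ^+ 2) <=
  3 * fluct x + 12 * M ^+ 6 * b ^+ 2 * Tstat A x.
Proof.
move=> Bx cE; have NR : 0 < N%:R :> R by rewrite ltr0n.
have M0 := M_ge0.
have cM : `|c| <= M by rewrite cE; exact: tmean_norm.
pose e j := cm x j - c; pose a := avg (fun j => `|e j|).
have a0 : 0 <= a by exact: avg_ge0.
have a2 : a ^+ 2 <= M ^+ 4 * b ^+ 2 * Tstat A x.
  apply: (le_trans (sqr_avg_le N0 _)); rewrite TstatE -avgZ; apply: le_avg => j.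
  rewrite real_normK ?num_real// /e /cond_mean cE.
  have := tmean_lip mu_on (b * local_field A x j + h)
    (b * avg (local_field A x) + h).
  rewrite opprD addrACA subrr addr0 -mulrBr normrM => tl.
  rewrite -(real_normK (num_real (t _ - _))).
  have -> : M ^+ 4 * b ^+ 2 * (local_field A x j - avg (local_field A x)) ^+ 2 =
    (M ^+ 2 * (`|b| * `|local_field A x j - avg (local_field A x)|)) ^+ 2.
    by rewrite !exprMn !real_normK ?num_real//; ring.
  by rewrite ler_pXn2r ?nnegrE ?mulr_ge0 ?sqr_ge0.
apply: (@le_trans _ _ (3 * fluct x + 12 * M ^+ 2 * a ^+ 2)); last first.
  rewrite lerD2l.
  have -> : 12 * M ^+ 6 * b ^+ 2 * Tstat A x =
    12 * M ^+ 2 * (M ^+ 4 * b ^+ 2 * Tstat A x) by ring.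
  by rewrite ler_wpM2l// mulr_ge0// sqr_ge0.
rewrite -[12 * _ * _](avg_cst N0) /fluct -avgZ -avgD; apply: le_avg => i.
rewrite local_field_decomp -/e.
set p := fluct_pair x i; set q := fluct_deg x i.
set r1 := \sum_j _; set r2 := \sum_k _.
have r1M : `|r1| <= a * M.
  by apply: weighted_norm => // j; exact: pair_field_norm.
have r2M : `|c * r2| <= a * M.
  rewrite normrM mulrC ler_pM//.
  rewrite -[leRHS]mulr1; apply: weighted_norm => // j.
  by rewrite ger0_norm ?codegree_ge0// mul1r codegree_le.
have r12 : (r1 + c * r2) ^+ 2 <= 4 * (M ^+ 2 * a ^+ 2).
  have -> : 4 * (M ^+ 2 * a ^+ 2) = (2 * (a * M)) ^+ 2 by ring.
  have aM0 : 0 <= a * M by apply: mulr_ge0.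
  rewrite -(real_normK (num_real (_ + _))) ler_pXn2r ?nnegrE//; last first.
    by apply: mulr_ge0.
  by rewrite (le_trans (ler_normD _ _))//; lra.
have cq : (c * q) ^+ 2 <= M ^+ 2 * q ^+ 2.
  rewrite exprMn ler_wpM2r ?sqr_ge0// -(real_normK (num_real c)).
  by rewrite ler_pXn2r ?nnegrE.
rewrite -addrA; move: r12 cq; set w := r1 + _; set y := c * q => r12 cq.
have : (p + y + w) ^+ 2 <= 3 * (p ^+ 2 + y ^+ 2 + w ^+ 2).
  by have := sqr_ge0 (p - y); have := sqr_ge0 (p - w); have := sqr_ge0 (y - w); nra.
by move=> H; apply: (le_trans H); lra.
Qed.

Lemma bmeas_fluct_pair i : bmN (fun x => fluct_pair x i).
Proof.
apply: bmeas_sum => j; apply: bmeasM; last exact: bmeas_pair_field.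
by apply: bmeasB; [exact: bmeas_tnth|exact: bmeas_cond_mean].
Qed.

Lemma bmeas_fluct_deg i : bmN (fun x => fluct_deg x i).
Proof.
apply: bmeas_sum => j; apply: bmeasM; last exact: bmeas_cst.
by apply: bmeasB; [exact: bmeas_tnth|exact: bmeas_cond_mean].
Qed.

Let bfl i : bmN (fun x => fluct_pair x i ^+ 2 + M ^+ 2 * fluct_deg x i ^+ 2).
Proof.
apply: bmeasD; first by apply: bmeasX; exact: bmeas_fluct_pair.
by apply: bmeasM; [exact: bmeas_cst|apply: bmeasX; exact: bmeas_fluct_deg].
Qed.

Lemma bmeas_fluct : bmN fluct.
Proof. by apply: bmeasM; [exact: bmeas_cst|apply: bmeas_sum => i; exact: bfl]. Qed.

(** [gmean_second_moment] applies with [B = 2 * M / N] for the pair fields and [B = 1 / N] for the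
    codegrees; with the weight [M ^+ 2] this makes [4 + 1 = 5]. The pair field [(i, j)] does not see
    spin [j] because [A i j j = 0]. *)
Lemma gmean_fluct : gm fluct <=
  5 * M ^+ 2 * (8 * M ^+ 5 * `|b| + 8 * M ^+ 2) / N%:R.
Proof.
have M0 := M_ge0; set C := 8 * _ * _ + _.
have NR : 0 < N%:R :> R by rewrite ltr0n.
rewrite /fluct /avg gmeanZ//; last by apply: bmeas_sum => i; exact: bfl.
rewrite gmean_sum//.
have -> : 5 * M ^+ 2 * C / N%:R =
    N%:R^-1 * \sum_(i < N) (5 * M ^+ 2 * C / N%:R).
  rewrite sumr_const card_ord -mulr_natr; field; exact: natr_neq0.
apply: ler_wpM2l; first by rewrite invr_ge0.
apply: ler_sum => i _.
rewrite gmeanD//; last 2 first.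
- by apply: bmeasX; exact: bmeas_fluct_pair.
- by apply: bmeasM; [exact: bmeas_cst|apply: bmeasX; exact: bmeas_fluct_deg].
rewrite gmeanZ//; last by apply: bmeasX; exact: bmeas_fluct_deg.
have h1 : gm (fun x => fluct_pair x i ^+ 2) <= C * N%:R * (2 * M / N%:R) ^+ 2.
  apply: gmean_second_moment => //.
  - by move=> j; exact: bmeas_pair_field.
  - move=> j x Bx; apply: (le_trans (pair_field_norm tA i j N0 Bx)).
    by rewrite ler_wpM2r ?invr_ge0//; lra.
  - by move=> j x z; rewrite pair_field_set (tensor_diag tA) mulr0 addr0.
  - move=> j l x Bx; rewrite pair_field_set opprD addrA subrr add0r normrN.
    have -> : 2 * M / N%:R / N%:R = 2 * M * N%:R ^- 2.
      by field; exact: natr_neq0.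
    rewrite normrM (ger0_norm (tensor_ge0 tA _ _ _)).
    rewrite ler_pM ?(tensor_ge0 tA) ?(tensor_le tA)//.
    apply: (le_trans (ler_normB _ _)); have := tnth_norm j Bx.
    by have := normr_ge0 kp; lra.
have h2 : gm (fun x => fluct_deg x i ^+ 2) <= C * N%:R * (N%:R^-1) ^+ 2.
  apply: gmean_second_moment => //.
  - by move=> j; exact: bmeas_cst.
  - by move=> j x _; rewrite ger0_norm ?codegree_ge0 ?codegree_le.
  - by move=> j l x _; rewrite subrr normr0 mulr_ge0 ?invr_ge0.
apply: (@le_trans _ _ (C * N%:R * (2 * M / N%:R) ^+ 2 +
   M ^+ 2 * (C * N%:R * (N%:R^-1) ^+ 2))).
  by rewrite lerD// ler_wpM2l// sqr_ge0.
rewrite le_eqVlt; apply/orP; left; apply/eqP; field; exact: natr_neq0.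
Qed.

Variables (v : R).
Hypotheses (v0 : 0 < v)
  (vdeg : forall s, v <= avg (fun i => (degree i - s) ^+ 2)).

(* If all local fields nearly agree, they are close to both a constant and
   [c ^+ 2 * degree i]; hence [c] and then the fields nearly vanish, and
   [c] is also close to [t h]. *)
Lemma Tstat_fluct_lb x th : bx x -> t h != 0 ->
  th = 3 * fluct x + (12 * M ^+ 6 * b ^+ 2 + 1) * Tstat A x ->
  3 / 4 * t h ^+ 2 <=
  th * (8 / (v * t h ^+ 2) + 2 * M ^+ 4 * b ^+ 2 * (2 + 4 / v)).
Proof.
move=> Bx t0 thD; set m := local_field A x; set c := t (b * avg m + h).
have M0 := M_ge0.
set eta := 3 * fluct x + 12 * M ^+ 6 * b ^+ 2 * Tstat A x.
have etaP := local_field_close Bx (erefl c); rewrite -/eta -/m in etaP.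
have T0 : 0 <= Tstat A x by rewrite TstatE; apply: avg_ge0 => i; exact: sqr_ge0.
have eta0 : 0 <= eta by apply: le_trans etaP; apply: avg_ge0 => i; exact: sqr_ge0.
have thE : th = eta + Tstat A x by rewrite thD /eta; ring.
(* If [c] is non-zero, the near constancy of [c ^+ 2 * degree i] confines the degrees to a
   neighbourhood of [avg m / c ^+ 2], against [vdeg]. *)
have c4 : c ^+ 4 * v <= 2 * th.
  apply: (@le_trans _ _ (avg (fun i => (c ^+ 2 * degree i - avg m) ^+ 2))).
    have [c0|c0] := eqVneq c 0.
      by rewrite c0 expr0n mul0r; apply: avg_ge0 => i; exact: sqr_ge0.
    rewrite (eq_avg (v := fun i => c ^+ 4 * (degree i - avg m / c ^+ 2) ^+ 2)).
      by rewrite avgZ ler_wpM2l// exprn_even_ge0.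
    by move=> i; field; rewrite c0.
  apply: (@le_trans _ _ (2 * avg (fun i => (m i - c ^+ 2 * degree i) ^+ 2) +
     2 * Tstat A x)); last by rewrite thE; lra.
  rewrite TstatE -/m -!avgZ -avgD; apply: le_avg => i.
  set y := c ^+ 2 * _; set z := avg m.
  by have := sqr_ge0 (m i - y + (m i - z)); nra.
have m2 : avg m ^+ 2 <= 2 * eta + 2 * c ^+ 4.
  apply: (le_trans (sqr_avg_le N0 _)).
  apply: (@le_trans _ _ (2 * avg (fun i => (m i - c ^+ 2 * degree i) ^+ 2) +
     2 * c ^+ 4)); last by lra.
  rewrite -[2 * c ^+ 4](avg_cst N0) -avgZ -avgD; apply: le_avg => i.
  have /andP[d0 d1] := degree_itv i.
  have : (c ^+ 2 * degree i) ^+ 2 <= c ^+ 4.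
    rewrite exprMn -exprM -[leRHS]mulr1 ler_wpM2l ?exprn_even_ge0//.
    by rewrite expr_le1.
  set y := c ^+ 2 * _ => y4.
  by have := sqr_ge0 (m i - 2 * y); nra.
have tc : t h ^+ 2 <= 2 * c ^+ 2 + 2 * (M ^+ 4 * b ^+ 2 * avg m ^+ 2).
  have := tmean_lip mu_on (b * avg m + h) h; rewrite addrK -/c => tl.
  have : (c - t h) ^+ 2 <= M ^+ 4 * b ^+ 2 * avg m ^+ 2.
    rewrite -(real_normK (num_real (c - _))).
    have -> : M ^+ 4 * b ^+ 2 * avg m ^+ 2 = (M ^+ 2 * `|b * avg m|) ^+ 2.
      by rewrite [RHS]exprMn real_normK ?num_real//; ring.
    by rewrite ler_pXn2r ?nnegrE ?mulr_ge0 ?sqr_ge0.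
  by have := sqr_ge0 (2 * c - t h); nra.
set t2 := t h ^+ 2 in tc *.
have t20 : 0 < t2 by rewrite /t2 exprn_even_gt0.
(* Weighted so that a quarter of [t2] is absorbed on the left, which leaves the factor [3 / 4] of
   the conclusion. *)
have c2 : 2 * c ^+ 2 <= t2 / 4 + 4 / t2 * c ^+ 4.
  rewrite -subr_ge0.
  have -> : t2 / 4 + 4 / t2 * c ^+ 4 - 2 * c ^+ 2 = (t2 / 2 - 2 * c ^+ 2) ^+ 2 / t2.
    by field; rewrite gt_eqF.
  by rewrite divr_ge0 ?sqr_ge0// ltW.
have c4' : c ^+ 4 <= 2 * th / v by rewrite ler_pdivlMr.
have m2' : avg m ^+ 2 <= (2 + 4 / v) * th.
  have -> : (2 + 4 / v) * th = 2 * th + 2 * (2 * th / v) by ring.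
  by apply: (le_trans m2); rewrite thE in c4' *; lra.
have Mb : 0 <= 2 * (M ^+ 4 * b ^+ 2).
  by apply: mulr_ge0 => //; apply: mulr_ge0; [exact: exprn_ge0|exact: sqr_ge0].
have u1 := ler_wpM2l Mb m2'.
have u2 : 4 / t2 * c ^+ 4 <= 4 / t2 * (2 * th / v).
  by rewrite ler_wpM2l// divr_ge0// ltW.
have -> : th * (8 / (v * t2) + 2 * M ^+ 4 * b ^+ 2 * (2 + 4 / v)) =
   4 / t2 * (2 * th / v) + 2 * (M ^+ 4 * b ^+ 2) * ((2 + 4 / v) * th).
  by field; rewrite !gt_eqF.
move: u1 u2 tc c2; rewrite -[2 * _ * avg m ^+ 2]mulrA.
set p1 := M ^+ 4 * b ^+ 2 * _; set p2 := 4 / t2 * c ^+ 4.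
lra.
Qed.

End tstat.

Section ereal_limits.
Context (R : realType).

Lemma cvge_to0 (u : nat -> \bar R) :
  (forall e : R, 0 < e -> \forall N \near \oo, (0 <= u N <= e%:E)%E) ->
  u N @[N --> \oo] --> 0%E.
Proof.
move=> H; apply/fine_cvgP; split.
  have := H 1 ltr01; apply: filterS => N /andP[u0 u1].
  by rewrite ge0_fin_numE// (le_lt_trans u1)// ltry.
apply/cvgrPdist_le => e e0; have := H _ e0.
apply: filterS => N /andP[u0 ue].
have uf : u N \is a fin_num by rewrite ge0_fin_numE// (le_lt_trans ue)// ltry.
by rewrite /= sub0r normrN ger0_norm ?fine_ge0// -lee_fin fineK.
Qed.

Lemma near_natr_gt (c : R) : \forall N \near \oo, c < N%:R :> R.
Proof.
near=> N; apply: (@lt_le_trans _ _ (Num.truncn `|c|).+1%:R).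
  by apply: (le_lt_trans (ler_norm _)); exact: truncnS_gt.
by rewrite ler_nat; near: N; exact: nbhs_infty_ge.
Unshelve. all: by end_near. Qed.

(** Uses the cover by [B] followed by empty sets, so that [P] need only vanish at the empty set and
    no additivity is involved. *)
Lemma mu_ext_le_cover d (T : measurableType d) (P : set T -> \bar R)
  (X B : set T) : P set0 = 0%E -> measurable B -> X `<=` B ->
  (P^*%mu X <= P B)%E.
Proof.
move=> P0 mB XB; rewrite /mu_ext; apply: ereal_inf_lbound.
exists (fun k => if k is 0%N then B else set0).
  by split=> [[|k]//|x /XB Bx]; exists 0%N.
apply: lim_near_cst => //; near=> n.
have n0 : (0 < n)%N by near: n; exact: nbhs_infty_gt.
by rewrite big_ltn// big_nat_cond big1 ?adde0// => -[|k] //=.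
Unshelve. all: by end_near. Qed.

End ereal_limits.

(** * Tail bounds and the maximum pseudo-likelihood estimator *)

Section tail_bounds.
Context (R : realType) (km kp : R) (mu : probability (measurableTypeR R) R).
Hypothesis km_lt_kp : km < kp.
Hypothesis mu_on : mu [set` `[km, kp]] = 1%E.
Local Notation T := (measurableTypeR R).
Local Notation M := (`|km| + `|kp|).
Local Notation t := (tmean km kp mu).
Variables (b h : R).
Local Notation gm N A := (@gmean R km kp mu N A b h).

Lemma measurable_le d (S : measurableType d) (F : S -> R) c :
  measurable_fun setT F -> measurable [set x | F x <= c].
Proof.
move=> mF; rewrite -[X in measurable X]setTI.
rewrite (_ : [set x | _] = F @^-1` `]-oo, c]); first exact: mF.
by apply/seteqP; split => x /=; rewrite in_itv.
Qed.

Lemma measurable_gt d (S : measurableType d) (F : S -> R) c :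
  measurable_fun setT F -> measurable [set x | c < F x].
Proof.
move=> mF; rewrite -[X in measurable X]setTI.
rewrite (_ : [set x | _] = F @^-1` `]c, +oo[); first exact: mF.
by apply/seteqP; split => x /=; rewrite in_itv andbT.
Qed.

Lemma bmeas_Tstat N (A : 'I_N -> 'I_N -> 'I_N -> R) :
  bmeas (@box R km kp N) (Tstat A).
Proof.
apply: bmeasM; first exact: bmeas_cst.
apply: bmeas_sum => i; apply: bmeasX; apply: bmeasB.
  exact: bmeas_local_field.
apply: bmeasM; first exact: bmeas_cst.
by apply: bmeas_sum => j; exact: bmeas_local_field.
Qed.

Lemma markov_gmean N (A : 'I_N -> 'I_N -> 'I_N -> R)
  (S : set (N.-tuple T)) F c :
  measurable S -> bmeas (@box R km kp N) F -> 0 < c ->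
  (forall x, box km kp x -> 0 <= F x) ->
  (forall x, box km kp x -> S x -> c <= F x) ->
  gm N A \1_S <= gm N A F / c.
Proof.
move=> mS bF c0 F0 SF; rewrite mulrC -gmeanZ//; apply: le_gmean => //.
- exact: bmeas_indic.
- by apply: bmeasM => //; exact: bmeas_cst.
move=> x Bx; rewrite indicE; case: (boolP (x \in S)) => [/set_mem Sx|_] /=.
  by rewrite ler_pdivlMl// mulr1 SF.
by rewrite mulr_ge0 ?invr_ge0 ?(ltW c0) ?F0.
Qed.

Lemma Tstat_tail (v : R) : 0 < v -> t h != 0 ->
  exists d C : R, [/\ 0 < d, 0 < C & forall N (A : 'I_N -> 'I_N -> 'I_N -> R),
    (0 < N)%N -> is_tensor A ->
    (forall s, v <= avg (fun i => (degree A i - s) ^+ 2)) ->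
    gm N A \1_[set x | Tstat A x <= d] <= C / N%:R].
Proof.
move=> v0 th0; have M0 : 0 <= M by rewrite addr_ge0.
pose Q := 8 / (v * t h ^+ 2) + 2 * M ^+ 4 * b ^+ 2 * (2 + 4 / v).
have t20 : 0 < t h ^+ 2 by rewrite exprn_even_gt0.
have Q0 : 0 < Q.
  apply: ltr_pwDl; first by rewrite divr_gt0// mulr_gt0.
  apply: mulr_ge0; last by rewrite addr_ge0// divr_ge0// ltW.
  apply: mulr_ge0; last exact: sqr_ge0.
  by apply: mulr_ge0 => //; exact: exprn_ge0.
(* If [fluct < tau] and [Tstat <= tau / k], the quantity [th] of [Tstat_fluct_lb] is below
   [4 * tau], and [4 * tau * Q] is a quarter of [t h ^+ 2], less than the three quarters required.
   So a small [Tstat] forces [tau <= fluct], to which Markov's inequality applies. *)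
pose tau := t h ^+ 2 / (16 * Q).
have tau0 : 0 < tau by rewrite divr_gt0// mulr_gt0.
pose k := 12 * M ^+ 6 * b ^+ 2 + 1.
have k0 : 0 < k.
  apply: ltr_wpDl => //; apply: mulr_ge0; last exact: sqr_ge0.
  by apply: mulr_ge0 => //; exact: exprn_ge0.
pose C := 5 * M ^+ 2 * (8 * M ^+ 5 * `|b| + 8 * M ^+ 2) / tau.
have C0 : 0 <= C.
  apply: mulr_ge0; last by rewrite invr_ge0 ltW.
  apply: mulr_ge0; first by apply: mulr_ge0 => //; exact: exprn_ge0.
  by apply: addr_ge0; rewrite ?mulr_ge0 ?exprn_ge0.
exists (tau / k), (C + 1); split.
- by rewrite divr_gt0.
- by rewrite ltr_wpDl.
move=> N A N0 tA vdeg.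
have NR : 0 < N%:R :> R by rewrite ltr0n.
apply: (@le_trans _ _ (C / N%:R)); last by rewrite ler_wpM2r ?invr_ge0 ?lerDl.
apply: (@le_trans _ _ (gm N A (fluct km kp mu A b h) / tau)).
  apply: markov_gmean => //.
  - by apply: measurable_le; case: (bmeas_Tstat A).
  - exact: bmeas_fluct.
  - move=> x _; apply: avg_ge0 => i.
    by rewrite addr_ge0 ?sqr_ge0// mulr_ge0 ?sqr_ge0.
  move=> x Bx /= Tx; rewrite leNgt; apply/negP => flx.
  have := Tstat_fluct_lb (b := b) mu_on tA N0 v0 vdeg Bx th0 erefl.
  rewrite -/Q -/k leNgt => /negP; apply.
  have kT : k * Tstat A x <= tau by rewrite mulrC -ler_pdivlMr.
  apply: (@le_lt_trans _ _ (4 * tau * Q)).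
    by rewrite ler_wpM2r ?(ltW Q0)//; lra.
  have -> : 4 * tau * Q = t h ^+ 2 / 4 by rewrite /tau; field; rewrite gt_eqF.
  by lra.
rewrite ler_pdivrMr//.
have -> : C / N%:R * tau = 5 * M ^+ 2 * (8 * M ^+ 5 * `|b| + 8 * M ^+ 2) / N%:R.
  by rewrite /C; field; rewrite !gt_eqF.
exact: gmean_fluct.
Qed.

Let sc1 N (A : 'I_N -> 'I_N -> 'I_N -> R) (x : N.-tuple T) :=
  \sum_i (tnth x i - cond_mean km kp mu A b h x i) * local_field A x i.
Let sc2 N (A : 'I_N -> 'I_N -> 'I_N -> R) (x : N.-tuple T) :=
  \sum_i (tnth x i - cond_mean km kp mu A b h x i) * 1.

Let btc N (A : 'I_N -> 'I_N -> 'I_N -> R) j :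
  bmeas (@box R km kp N) (fun x => tnth x j - cond_mean km kp mu A b h x j).
Proof. by apply: bmeasB; [exact: bmeas_tnth|exact: bmeas_cond_mean]. Qed.

Let bsc1 N (A : 'I_N -> 'I_N -> 'I_N -> R) : bmeas (@box R km kp N) (sc1 A).
Proof.
apply: bmeas_sum => i; apply: bmeasM; first exact: btc.
exact: bmeas_local_field.
Qed.

Let bsc2 N (A : 'I_N -> 'I_N -> 'I_N -> R) : bmeas (@box R km kp N) (sc2 A).
Proof. by apply: bmeas_sum => i; apply: bmeasM; [exact: btc|exact: bmeas_cst]. Qed.

(** Chebyshev's inequality: at the true parameters both scores have the form treated by
    [gmean_second_moment], with the local fields and the constant one as weights. *)
Lemma score_tail : exists2 C : R, 0 < C &
  forall N (A : 'I_N -> 'I_N -> 'I_N -> R) S,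
    (0 < N)%N -> is_tensor A -> 0 < S ->
    gm N A \1_[set x | S ^+ 2 * N%:R < sc1 A x ^+ 2] <= C / S ^+ 2 /\
    gm N A \1_[set x | S ^+ 2 * N%:R < sc2 A x ^+ 2] <= C / S ^+ 2.
Proof.
have M0 : 0 <= M by rewrite addr_ge0.
pose C1 := 8 * M ^+ 5 * `|b| + 8 * M ^+ 2.
have C10 : 0 <= C1 by apply: addr_ge0; rewrite ?mulr_ge0 ?exprn_ge0.
pose C := C1 * ((4 * M ^+ 2) ^+ 2 + 1) + 1.
have C0 : 0 < C by rewrite ltr_wpDl// mulr_ge0// addr_ge0// sqr_ge0.
exists C => // N A S N0 tA S0.
have NR : 0 < N%:R :> R by rewrite ltr0n.
have SN : 0 < S ^+ 2 * N%:R by rewrite mulr_gt0// exprn_gt0.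
have key F : bmeas (@box R km kp N) F -> gm N A (fun x => F x ^+ 2) <= C * N%:R ->
    gm N A \1_[set x | S ^+ 2 * N%:R < F x ^+ 2] <= C / S ^+ 2.
  move=> bF FC; apply: (@le_trans _ _ (gm N A (fun x => F x ^+ 2) / (S ^+ 2 * N%:R))).
    apply: markov_gmean => //.
    - by apply: measurable_gt; case: (bmeasX 2 bF).
    - exact: bmeasX.
    - by move=> x _; exact: sqr_ge0.
    - by move=> x _ /= /ltW.
  rewrite ler_pdivrMr// mulrA divfK// gt_eqF// exprn_gt0//.
split; apply: key => //.
- apply: (@le_trans _ _ (C1 * N%:R * (4 * M ^+ 2) ^+ 2)).
    apply: gmean_second_moment => //.
    + by move=> j; exact: bmeas_local_field.
    + move=> j x Bx; rewrite (le_trans (local_field_norm tA j N0 Bx))//.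
      by rewrite ler_peMl ?exprn_ge0// ler1n.
    + by move=> j x z; exact: local_field_set_same.
    + move=> j l x Bx; apply: local_field_lip => //.
      by rewrite /= in_itv/= lexx ltW.
  rewrite mulrAC ler_wpM2r ?(ltW NR)// /C.
  by have := C10; set q := (4 * _) ^+ 2; rewrite mulrDr mulr1; lra.
- apply: (@le_trans _ _ (C1 * N%:R * 1 ^+ 2)).
    apply: gmean_second_moment => //.
    + by move=> j; exact: bmeas_cst.
    + by move=> j x _; rewrite normr1.
    + by move=> j l x _; rewrite subrr normr0 mulr_ge0 ?invr_ge0.
  rewrite expr1n mulr1 ler_wpM2r ?(ltW NR)// /C.
  have : 0 <= C1 * (4 * M ^+ 2) ^+ 2 by rewrite mulr_ge0 ?sqr_ge0.
  by rewrite mulrDr mulr1; lra.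
Qed.

Hypothesis km_supp : supp mu km.
Hypothesis kp_supp : supp mu kp.

Lemma mple_deterministic (d S : R) : 0 < d -> 0 < S ->
  exists K N1 : R, 0 < K /\ forall N (A : 'I_N -> 'I_N -> 'I_N -> R) x,
    (0 < N)%N -> N1 < N%:R -> is_tensor A -> box km kp x ->
    d < Tstat A x -> sc1 A x ^+ 2 <= S ^+ 2 * N%:R ->
    sc2 A x ^+ 2 <= S ^+ 2 * N%:R ->
    exists bh, is_mple mu A x bh /\
      Num.max `|bh.1 - b| `|bh.2 - h| <= K / Num.sqrt N%:R.
Proof.
move=> d0 S0; have M0 : 0 <= M by rewrite addr_ge0.
pose d' := Num.min d 1.
have d'0 : 0 < d' <= 1.
  by rewrite /d' lt_min d0 ltr01 ge_min lexx orbT.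
pose K2 := M ^+ 2; have K20 : 0 <= K2 by exact: exprn_ge0.
pose L0 := (`|b| + 1) * K2 + `|h| + 1.
have [c c0 Lc] := Lambda_strong_convex km_lt_kp mu_on km_supp kp_supp L0.
pose c1 := d' / (4 * (K2 ^+ 2 + 1)).
have K21 : 0 < 4 * (K2 ^+ 2 + 1) by rewrite mulr_gt0// ltr_wpDl ?sqr_ge0.
have c10 : 0 < c1 by rewrite divr_gt0//; case/andP: d'0.
(* Gradient divided by curvature; the [+ 1] makes the comparison strict. Requiring [K ^+ 2 < N]
   keeps the radius [K / Num.sqrt N%:R] below one, where the curvature constant [c] chosen for [L0]
   is valid. *)
pose K := 2 * S / (c / 2 * c1) + 1.
have cc1 : 0 < c / 2 * c1 by rewrite mulr_gt0// divr_gt0.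
have K0 : 0 < K by rewrite ltr_wpDl// divr_ge0 ?(ltW cc1)// mulr_ge0// ltW.
exists K, (K ^+ 2); split=> // N A x N0 N1 tA Bx dT s1 s2.
have NR : 0 < N%:R :> R by rewrite ltr0n.
pose w := Num.sqrt N%:R : R.
have w0 : 0 < w by rewrite sqrtr_gt0.
have w2 : w ^+ 2 = N%:R by rewrite sqr_sqrtr// ltW.
pose r := K / w.
have r0 : 0 < r by rewrite divr_gt0.
have r1 : r <= 1.
  rewrite ler_pdivrMr// mul1r -(@ler_pXn2r _ 2) ?nnegrE ?(ltW K0) ?(ltW w0)//.
  by rewrite w2 ltW.
pose m := local_field A x; pose y i : R := tnth x i.
have scE1 : score1 t y m (b, h) = sc1 A x.
  by apply: eq_bigr => i _; rewrite mulrC.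
have scE2 : score2 t y m (b, h) = sc2 A x.
  by apply: eq_bigr => i _; rewrite mulr1.
have mK i : `|m i| <= K2 by exact: local_field_norm.
have dvar : d' <= N%:R^-1 * \sum_i (m i - N%:R^-1 * \sum_i m i) ^+ 2.
  by apply: (le_trans _ (ltW dT)); rewrite /d' ge_min lexx.
have nrm (z : R) : z ^+ 2 <= S ^+ 2 * N%:R -> `|z| <= S * w.
  rewrite -w2 -exprMn -(real_normK (num_real z)).
  by rewrite ler_pXn2r ?nnegrE// mulr_ge0 ?(ltW S0) ?(ltW w0).
have rL : (`|(b, h).1| + r) * K2 + `|(b, h).2| + r <= L0.
  rewrite /= /L0 lerD// lerD2r ler_wpM2r// lerD2l//.
have Sr : 2 * (S * w) < c / 2 * (d' / (4 * (K2 ^+ 2 + 1)) * N%:R) * r.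
  rewrite -/c1 -w2 /r.
  have -> : c / 2 * (c1 * w ^+ 2) * (K / w) = (c / 2 * c1) * K * w.
    by field; rewrite gt_eqF.
  have -> : c / 2 * c1 * K = 2 * S + c / 2 * c1.
    by rewrite /K; field; rewrite !gt_eqF.
  by rewrite mulrA ltr_pM2r// ltrDl.
have [u [u1 u2 [u3 u4]]] := score_exists (is_derive_Lambda mu_on) N0 K20 mK
  d'0 dvar c0 r0 rL (fun a' b' ha hb => (Lc a' b' ha hb).2)
  (eq_ind_r (fun z => `|z| <= _) (nrm _ s1) scE1)
  (eq_ind_r (fun z => `|z| <= _) (nrm _ s2) scE2) Sr.
have szE bh : score_zero mu A x bh <-> score1 t y m bh = 0 /\ score2 t y m bh = 0.
  rewrite /score_zero /score1 /score2 /theta /y /m.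
  under eq_bigr do rewrite (derive1_Lambda mu_on).
  by under [X in _ /\ X = 0]eq_bigr do rewrite (derive1_Lambda mu_on).
exists u; split; last by rewrite ge_max u3.
split; first exact/szE.
move=> bh' /szE[v1 v2]; apply: (score_unique N0 K20 mK d'0 dvar _ u1 u2 v1 v2).
move=> a' b' ab.
(* Uniqueness is claimed in the whole plane, so strict monotonicity of [t] is needed at arbitrary
   points; the constant may depend on them. *)
have [c' c'0 Lc'] := Lambda_strong_convex km_lt_kp mu_on km_supp kp_supp
  (Num.max `|a'| `|b'|).
have [|| Hc _] := Lc' a' b'; rewrite ?le_max ?lexx ?orbT//.
apply: (lt_le_trans _ Hc); rewrite mulr_gt0// exprn_even_gt0//=.
by rewrite subr_eq0.
Qed.

Section sequence.
Variables (A : forall N, 'I_N -> 'I_N -> 'I_N -> R) (v : R).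
Arguments A : clear implicits.
Hypotheses (v0 : 0 < v) (th0 : t h != 0).
Hypothesis A_good : \forall N \near \oo,
  is_tensor (A N) /\ forall s, v <= avg (fun i => (degree (A N) i - s) ^+ 2).
Let P N := gibbs mu (A N) b h.

Lemma gibbs_set0 N : @P N set0 = 0%E.
Proof. by rewrite /P /gibbs integral_set0. Qed.

Lemma Omega_P_Tstat : Omega_P P (fun N => Tstat (A N)).
Proof.
have [d [C [d0 C0 tail]]] := Tstat_tail v0 th0.
move=> eps eps0; apply: cvge_to0 => e e0.
near=> N; have [tA vdeg] : is_tensor (A N) /\
    forall s, v <= avg (fun i => (degree (A N) i - s) ^+ 2) by near: N.
have N0 : (0 < N)%N by near: N; exact: nbhs_infty_gt.
have ed : eps N <= d.
  near: N; have := cvgr_le (0 : R) eps0 d d0; exact.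
have CN : C / e < N%:R by near: N; exact: near_natr_gt.
rewrite /P (gibbsE mu_on)//; last by apply: measurable_le; case: (bmeas_Tstat (A N)).
rewrite !lee_fin; apply/andP; split.
  by apply: gmean_ge0 => // x _; rewrite indicE.
apply: le_trans (le_trans _ (tail N (A N) N0 tA vdeg)) _.
  apply: le_gmean => //.
  - by apply: bmeas_indic; apply: measurable_le; case: (bmeas_Tstat (A N)).
  - by apply: bmeas_indic; apply: measurable_le; case: (bmeas_Tstat (A N)).
  move=> x _; rewrite !indicE.
  case: (boolP (x \in [set _ | _ <= eps N])) => [/set_mem/= h1|_] //.
  by rewrite mem_set//=; exact: le_trans h1 ed.
rewrite ler_pdivrMr ?ltr0n// mulrC -ler_pdivrMr//; exact: ltW.
Unshelve. all: by end_near. Qed.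

Lemma mple_sqrt_consistent_Tstat : mple_sqrt_consistent P mu A b h.
Proof.
have [d [C [d0 C0 tail]]] := Tstat_tail v0 th0.
have [C1 C10 stail] := score_tail.
move=> e e0.
(* Each of the two score events, and for large [N] also the event of a small [Tstat], then has
   probability at most [e / 4]; the complement of the box is null. *)
pose S := Num.sqrt (4 * C1 / e).
have S0 : 0 < S by rewrite sqrtr_gt0 divr_gt0// mulr_gt0.
have S2 : C1 / S ^+ 2 = e / 4.
  rewrite sqr_sqrtr; last by rewrite divr_ge0 ?ltW// mulr_gt0.
  by field; rewrite !gt_eqF.
have [K [N1 [K0 det]]] := mple_deterministic d0 S0.
exists K => //; near=> N; have [tA vdeg] : is_tensor (A N) /\
    forall s, v <= avg (fun i => (degree (A N) i - s) ^+ 2) by near: N.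
have N0 : (0 < N)%N by near: N; exact: nbhs_infty_gt.
have N1N : N1 < N%:R by near: N; exact: near_natr_gt.
have CN : 4 * C / e < N%:R by near: N; exact: near_natr_gt.
pose B1 := [set x | Tstat (A N) x <= d].
pose B2 := [set x | S ^+ 2 * N%:R < sc1 (A N) x ^+ 2].
pose B3 := [set x | S ^+ 2 * N%:R < sc2 (A N) x ^+ 2].
pose B4 : set (N.-tuple T) := ~` (box km kp (N:=N)).
have mB1 : measurable B1 by apply: measurable_le; case: (bmeas_Tstat (A N)).
have mB2 : measurable B2 by apply: measurable_gt; case: (bmeasX 2 (bsc1 (A N))).
have mB3 : measurable B3 by apply: measurable_gt; case: (bmeasX 2 (bsc2 (A N))).
have mB4 : measurable B4 by apply: measurableC; exact: measurable_box.
have mB : measurable (B1 `|` B2 `|` B3 `|` B4).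
  by do 3 (apply: measurableU => //).
apply: le_trans (mu_ext_le_cover (gibbs_set0 N) mB _) _.
  move=> x /= nx; apply: contrapT => nB; apply: nx.
  apply: det => //.
  - by apply: contrapT => nbx; apply: nB; right.
  - by rewrite ltNge; apply/negP => h1; apply: nB; left; left; left.
  - by rewrite leNgt; apply/negP => h1; apply: nB; left; left; right.
  - by rewrite leNgt; apply/negP => h1; apply: nB; left; right.
rewrite /P (gibbsE mu_on)// lee_fin.
have b1 : bmeas (@box R km kp N) (\1_B1 : _ -> R) by exact: bmeas_indic.
have b2 : bmeas (@box R km kp N) (\1_B2 : _ -> R) by exact: bmeas_indic.
have b3 : bmeas (@box R km kp N) (\1_B3 : _ -> R) by exact: bmeas_indic.
have b12 := bmeasD b1 b2; have b123 := bmeasD b12 b3.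
apply: (@le_trans _ _ (gm N (A N) (fun x => \1_B1 x + \1_B2 x + \1_B3 x))).
  apply: le_gmean => //; first exact: bmeas_indic.
  move=> x Bx; rewrite !indicE !in_setU.
  have -> : (x \in B4) = false by apply/negP => /set_mem; apply.
  by do 3 (case: (_ \in _)); rewrite /= ?addr0 ?add0r ?lexx//; lra.
rewrite gmeanD// gmeanD//.
have [t2 t3] := stail N (A N) S N0 tA S0.
have t1 := tail N (A N) N0 tA vdeg.
have Ce : C / N%:R <= e / 4.
  rewrite ler_pdivrMr ?ltr0n// mulrC -ler_pdivrMr ?divr_gt0//.
  have -> : C / (e / 4) = 4 * C / e by field; rewrite gt_eqF.
  exact: ltW.
rewrite S2 in t2 t3; rewrite -/B1 in t1; rewrite -/B2 in t2; rewrite -/B3 in t3.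
move: t1 t2 t3 Ce; set g1 := gmean _ _ _ _ _ _ _; set g2 := gmean _ _ _ _ _ _ _.
set g3 := gmean _ _ _ _ _ _ _.
set CN' := C / _; clear -e0; lra.
Unshelve. all: by end_near. Qed.

(** Existence is contained in the consistency event, whose radius is forgotten. What remains is that
    the outer measure is non-negative, as every cover has non-negative total weight. *)
Lemma mple_exists_whp_Tstat : mple_exists_whp P mu A.
Proof.
apply: cvge_to0 => e e0; have [K K0] := mple_sqrt_consistent_Tstat e0.
apply: filterS => N h1; apply/andP; split; last first.
  apply: le_trans h1; apply: le_mu_ext; apply: subsetC => x [bh [h1 _]].
  by exists bh.
apply: le_ereal_inf_tmp => x [B [mB _] <-{x}]; rewrite lime_ge //=.
  apply: is_cvg_nneseries => n _ _; apply: integral_ge0 => x _.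
  rewrite lee_fin divr_ge0 ?expR_ge0//; exact: Rintegral_ge0.
near=> n; apply: sume_ge0 => k _; apply: integral_ge0 => x _.
rewrite lee_fin divr_ge0 ?expR_ge0//; exact: Rintegral_ge0.
Unshelve. all: by end_near. Qed.

End sequence.

End tail_bounds.

(** * Degrees and Riemann sums *)

Section monotone_integral.
Context d (T : measurableType d) (R : realType) (mu : {measure set T -> \bar R}).

(* The integral is a supremum over simple minorants, so that monotonicity also
   holds for the a priori non-measurable sections of the kernel. *)
Lemma ge0_le_integral_any (D : set T) (f1 f2 : T -> \bar R) :
  (forall x, D x -> 0 <= f1 x)%E -> (forall x, D x -> f1 x <= f2 x)%E ->
  (\int[mu]_(x in D) f1 x <= \int[mu]_(x in D) f2 x)%E.
Proof.
move=> f10 f12.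
have f20 x : D x -> (0 <= f2 x)%E by move=> Dx; exact: le_trans (f10 _ Dx) (f12 _ Dx).
rewrite !ge0_integralE//; apply: ereal_sup_le => _ [h hf1 <-].
exists h => // x; apply: (le_trans (hf1 x)); rewrite !patchE.
by case: ifPn => // /set_mem; exact: f12.
Qed.

End monotone_integral.

Section kernel_regularity.
Context (R : realType) (g : R * R * R -> R).
Hypothesis g_cont : {within @cube R, continuous g}.
Hypothesis g_01 : forall p, cube p -> 0 <= g p <= 1.
Local Notation leb := (@lebesgue_measure R).
Local Notation G := (degree_fun g).

Lemma cubeP (x y z : R) :
  cube (x, y, z) <-> [/\ 0 <= x <= 1, 0 <= y <= 1 & 0 <= z <= 1].
Proof.
by rewrite /cube /= !in_itv/=; split => [[[? ?] ?]|[? ? ?]]; split.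
Qed.

Lemma compact_cube : compact (@cube R).
Proof.
rewrite /cube; apply: compact_setX; last exact: segment_compact.
by apply: compact_setX; exact: segment_compact.
Qed.

Lemma kernel_unif_continuous (w : R) : 0 < w ->
  exists2 e, 0 < e & forall p q, cube p -> cube q -> ball p e q ->
    `|g p - g q| <= w.
Proof.
move=> w0; have /compact_near_coveringP cK := compact_cube.
have := cK R (0^'+) (fun r p => cube p -> forall q, cube q -> ball p r q ->
  `|g p - g q| <= w) _.
have H x : cube x -> \forall x' \near x & r \near 0^'+,
    cube x' -> forall q, cube q -> ball x' r q -> `|g x' - g q| <= w.
  move=> Kx; have w2 : 0 < w / 2 by rewrite divr_gt0.
  have /subspace_continuousP/(_ x Kx)/cvgrPdist_lt/(_ _ w2) := g_cont.
  rewrite /= -nbhs_nearE; move=> /nbhs_ballP[e /= e0 He].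
  have e2 : 0 < e / 2 by rewrite divr_gt0.
  exists (ball x (e / 2), [set r | r < e / 2]).
    split; first by apply: nbhsx_ballx.
    near=> r; near: r; exact: nbhs_right_lt.
  move=> [x' r] [/= xx' re] Kx' q Kq x'q.
  have xx'e : ball x e x' by apply: le_ball xx'; lra.
  have xqe : ball x e q.
    rewrite (splitr e); apply: ball_triangle xx' _.
    by apply: le_ball x'q; exact: ltW.
  have h1 := He _ xx'e Kx'; have h2 := He _ xqe Kq.
  by have := ler_distD (g x) (g x') (g q); rewrite (distrC (g x') (g x)); lra.
move=> /(_ _ H) [e /= e0 He]; exists (e / 2); first by rewrite divr_gt0.
move=> p q Kp Kq; apply: (He (e / 2)) => //=.
  by rewrite sub0r normrN gtr0_norm ?divr_gt0// ltr_pdivrMr// ltr_pMr// ltr1n.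
by rewrite divr_gt0.
Unshelve. all: by end_near. Qed.

Section riemann_sum.
Variable N : nat.
Hypothesis N0 : (0 < N)%N.
Let NR : 0 < N%:R :> R. Proof. by rewrite ltr0n. Qed.

Definition node (i : 'I_N) : R := i.+1%:R / N%:R.

Lemma node_itv i : 0 <= node i <= 1.
Proof.
rewrite /node divr_ge0//= ler_pdivrMr// mul1r ler_nat; exact: ltn_ord.
Qed.

(** Left-open and right-closed, except that the first cell also contains its left end point 0, so
    that the cells partition the unit interval. *)
Definition cell (i : 'I_N) : set R :=
  [set` Interval (BSide (i == 0%N :> nat) (i%:R / N%:R)) (BRight (node i))].

Lemma cell_ub i t : cell i t -> i%:R / N%:R <= t <= node i.
Proof.
rewrite /cell /= in_itv/= => /andP[l ->]; rewrite andbT.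
by move: l; case: eqP => //= _ /ltW.
Qed.

Lemma cell_dist i t : cell i t -> `|node i - t| <= N%:R^-1.
Proof.
move=> /cell_ub/andP[t1 t2]; rewrite ger0_norm ?subr_ge0//.
rewrite lerBlDr addrC -lerBlDr; apply: le_trans t1.
by rewrite /node -natr1 mulrDl mul1r addrK.
Qed.

Lemma cell_cover t : 0 <= t <= 1 -> exists i, cell i t.
Proof.
move=> /andP[t0 t1]; pose p k := t <= k.+1%:R / N%:R.
have pN : exists k, p k.
  by exists N.-1; rewrite /p prednK// divff// gt_eqF.
case: (ex_minnP pN) => k pk kmin.
have kN : (k < N)%N.
  by rewrite (leq_ltn_trans (kmin N.-1 _)) ?prednK// /p prednK// divff// gt_eqF.
exists (Ordinal kN); rewrite /cell /= in_itv/= /node/= (pk : t <= k.+1%:R / N%:R) andbT.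
case: k kmin pk kN => [|k] kmin pk kN /=; first by rewrite mul0r.
by rewrite ltNge; apply/negP => /kmin; rewrite ltnn.
Qed.

Lemma cell_disjoint i j t : cell i t -> cell j t -> i = j.
Proof.
suff H (a b : 'I_N) : (a < b)%N -> cell a t -> cell b t -> False.
  move=> ci cj; apply/val_inj; case: (ltngtP i j) => // ij.
  - by case: (H _ _ ij ci cj).
  - by case: (H _ _ ij cj ci).
move=> ab; rewrite /cell /= !in_itv/= => /andP[_ ta] /andP[tb _].
move: tb; rewrite gtn_eqF ?(leq_ltn_trans _ ab)//= => tb.
move: (lt_le_trans tb ta); rewrite ltr_pM2r ?invr_gt0// ltr_nat.
by rewrite ltnS leqNgt ab.
Qed.

Lemma measurable_cell i : measurable (cell i).
Proof. exact: measurable_itv. Qed.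

Lemma lebesgue_cell i : leb (cell i) = (N%:R^-1)%:E.
Proof.
rewrite /cell lebesgue_measure_itv/= /node lte_fin ltr_pM2r ?invr_gt0//.
rewrite ltr_nat ltnSn.
by rewrite -EFinB -mulrBl -natrB// subSnn mul1r.
Qed.

Lemma cell_sub i t : cell i t -> 0 <= t <= 1.
Proof.
move=> /cell_ub/andP[t1 t2]; have /andP[_ n1] := node_itv i.
rewrite (le_trans t2 n1) andbT (le_trans _ t1)// divr_ge0//.
Qed.

Let D : set (R * R) := `[0, 1]%classic `*` `[0, 1]%classic.

Let mD : measurable D.
Proof. by apply: measurableX; exact: measurable_itv. Qed.

Let step (a : 'I_N * 'I_N -> R) (p : R * R) : \bar R :=
  (\sum_(c : 'I_N * 'I_N) (a c * \1_(cell c.1 `*` cell c.2) p)%:E)%E.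

Lemma stepE a i j p : cell i p.1 -> cell j p.2 -> step a p = (a (i, j))%:E.
Proof.
move=> ci cj; rewrite /step (bigD1 (i, j))//= big1.
  by rewrite indicE mem_set//= mulr1 adde0.
move=> [i' j'] /= ne; rewrite indicE memNset ?mulr0// => -[/= ci' cj'].
by move/eqP: ne; apply; rewrite (cell_disjoint ci ci') (cell_disjoint cj cj').
Qed.

Lemma integral_step a : (forall c, 0 <= a c) ->
  (\int[(leb \x leb)%E]_(p in D) step a p)%E =
  ((\sum_c a c) * N%:R ^- 2)%:E.
Proof.
move=> a0; rewrite ge0_integral_sum//; last 2 first.
- move=> c; apply/measurable_EFinP/measurable_funM; first exact: measurable_cst.
  by apply: measurable_indic; apply: measurableX; exact: measurable_cell.
- by move=> c p _; rewrite lee_fin mulr_ge0// indicE.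
rewrite mulr_suml -sumEFin; apply: eq_bigr => c _.
under eq_integral do rewrite EFinM.
have mc : measurable (cell c.1 `*` cell c.2).
  by apply: measurableX; exact: measurable_cell.
rewrite ge0_integralZl_EFin//; last first.
  by apply/measurable_EFinP; exact: measurable_indic.
rewrite integral_indic// (_ : _ `&` D = cell c.1 `*` cell c.2); last first.
  apply/seteqP; split => [p [//]|p [/= c1 c2]]; split => //.
  by split; rewrite /= in_itv/=; [exact: cell_sub c1|exact: cell_sub c2].
transitivity ((a c)%:E * (leb (cell c.1) * leb (cell c.2)))%E.
  by congr (_ * _)%E; apply: product_measure1E; exact: measurable_cell.
by rewrite !lebesgue_cell -!EFinM -invfM -expr2.
Qed.

(** The section of [g] is squeezed between two step functions on the cells. The comparison takes
    place between extended-real integrals, and the upper step function shows that the integral is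
    finite. *)
Lemma degree_riemann (w e x : R) : 0 < w -> 0 <= x <= 1 ->
  (forall p q, cube p -> cube q -> ball p e q -> `|g p - g q| <= w) ->
  N%:R^-1 < e ->
  `|G x - N%:R ^- 2 * \sum_j \sum_k g (x, node j, node k)| <= w.
Proof.
move=> w0 x01 ucg Ne; pose a (c : 'I_N * 'I_N) := g (x, node c.1, node c.2).
have -> : \sum_j \sum_k g (x, node j, node k) = \sum_c a c.
  by rewrite pair_big; apply: eq_bigr => -[].
have cubea c : cube (x, node c.1, node c.2).
  by apply/cubeP; split => //; exact: node_itv.
have a0 c : 0 <= a c by have /andP[] := g_01 (cubea c).
have D2 p : D p -> exists i j, cell i p.1 /\ cell j p.2.
  move=> [/=]; rewrite !in_itv/= => p1 p2.
  have [i ci] := cell_cover p1; have [j cj] := cell_cover p2.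
  by exists i, j.
have ga p i j : cell i p.1 -> cell j p.2 -> `|g (x, p.1, p.2) - a (i, j)| <= w.
  move=> ci cj; rewrite distrC; apply: ucg.
  - exact: cubea.
  - by apply/cubeP; split => //; [exact: cell_sub ci|exact: cell_sub cj].
  have e0 : 0 < e by rewrite (lt_trans _ Ne)// invr_gt0.
  split; first split.
  - exact: ballxx.
  - exact: le_lt_trans (cell_dist ci) Ne.
  - exact: le_lt_trans (cell_dist cj) Ne.
set Int := (\int[(leb \x leb)%E]_(p in D) (g (x, p.1, p.2))%:E)%E.
(* Truncated at zero because monotonicity of the integral is used for non-negative functions
   only. *)
pose lo c := Num.max (a c - w) 0.
have N2 : 0 < N%:R ^- 2 :> R by rewrite invr_gt0 exprn_gt0.
have I1 : (Int <= ((\sum_c (a c + w)) * N%:R ^- 2)%:E)%E.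
  rewrite -integral_step; last by move=> c; rewrite addr_ge0// ltW.
  apply: ge0_le_integral_any => p Dp; have [i [j [ci cj]]] := D2 p Dp.
    have : cube (x, p.1, p.2).
      by apply/cubeP; split => //; [exact: cell_sub ci|exact: cell_sub cj].
    by move=> /g_01/andP[? _]; rewrite lee_fin.
  rewrite (stepE _ ci cj) lee_fin; have := ga p i j ci cj.
  by rewrite ler_norml => /andP[_]; lra.
have I2 : (((\sum_c lo c) * N%:R ^- 2)%:E <= Int)%E.
  rewrite -integral_step; last by move=> c; rewrite /lo le_max lexx orbT.
  apply: ge0_le_integral_any => p Dp; have [i [j [ci cj]]] := D2 p Dp.
    by rewrite (stepE _ ci cj) lee_fin /lo le_max lexx orbT.
  rewrite (stepE _ ci cj) lee_fin /lo ge_max.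
  have : cube (x, p.1, p.2).
    by apply/cubeP; split => //; [exact: cell_sub ci|exact: cell_sub cj].
  move=> /g_01/andP[-> _]; rewrite andbT; have := ga p i j ci cj.
  by rewrite ler_norml => /andP[+ _]; lra.
have Gfin : Int = (G x)%:E.
  rewrite /degree_fun /Rintegral -/D -/Int fineK// ge0_fin_numE.
    by rewrite (le_lt_trans I1)// ltry.
  apply: le_trans I2; rewrite lee_fin mulr_ge0 ?(ltW N2)//.
  by apply: sumr_ge0 => c _; rewrite /lo le_max lexx orbT.
rewrite Gfin !lee_fin in I1 I2.
have card2 : \sum_(c : 'I_N * 'I_N) w * N%:R ^- 2 = w.
  rewrite sumr_const card_prod card_ord -(mulr_natr (w / _)) natrM.
  by field; rewrite gt_eqF.
have lo1 : (\sum_c a c) * N%:R ^- 2 - w <= (\sum_c lo c) * N%:R ^- 2.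
  rewrite -[X in _ - X]card2 !mulr_suml -sumrB; apply: ler_sum => c _.
  by rewrite -mulrBl ler_wpM2r ?(ltW N2)// /lo le_max lexx.
rewrite big_split/= mulrDl [X in _ + X]mulr_suml card2 in I1.
rewrite mulrC ler_norml; apply/andP; split; lra.
Qed.

End riemann_sum.

(** Both values are compared with Riemann sums over one auxiliary grid, whose difference is finite
    and termwise small; the difference of the two integrals is never formed. *)
Lemma degree_unif_continuous (w : R) : 0 < w -> exists2 e, 0 < e &
  forall x y, 0 <= x <= 1 -> 0 <= y <= 1 -> `|x - y| < e -> `|G x - G y| <= w.
Proof.
move=> w0; have w3 : 0 < w / 3 by rewrite divr_gt0.
have [e e0 ucg] := kernel_unif_continuous w3; exists e => // x y x01 y01 xy.
pose N := (Num.truncn e^-1).+1.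
have N0 : (0 < N)%N by [].
have Ne : N%:R^-1 < e.
  rewrite -[ltRHS]invrK ltf_pV2 ?posrE ?invr_gt0 ?ltr0n//.
  exact: truncnS_gt.
have r1 := degree_riemann N0 w3 x01 ucg Ne.
have r2 := degree_riemann N0 w3 y01 ucg Ne.
have NN : 0 < N%:R ^- 2 :> R by rewrite invr_gt0 exprn_gt0// ltr0n.
have r3 : `|N%:R ^- 2 * (\sum_(j < N) \sum_(k < N) g (x, node j, node k)) -
     N%:R ^- 2 * (\sum_(j < N) \sum_(k < N) g (y, node j, node k))| <= w / 3.
  rewrite -mulrBr normrM (gtr0_norm NN) -sumrB ler_pdivrMl ?exprn_gt0 ?ltr0n//.
  apply: (le_trans (ler_norm_sum _ _ _)).
  apply: (@le_trans _ _ (\sum_(j < N) \sum_(k < N) w / 3)).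
    apply: ler_sum => j _; rewrite -sumrB; apply: (le_trans (ler_norm_sum _ _ _)).
    apply: ler_sum => k _; apply: ucg.
    - by apply/cubeP; split => //; exact: node_itv.
    - by apply/cubeP; split => //; exact: node_itv.
    - by split; [split; [exact: xy|exact: ballxx]|exact: ballxx].
  by rewrite !sumr_const !card_ord -mulrnA -[_ *+ (N * N)]mulr_natl natrM expr2.
move: r1 r2 r3; set s1 := N%:R ^- 2 * _; set s2 := N%:R ^- 2 * _.
have := ler_distD s1 (G x) (G y); have := ler_distD s2 s1 (G y).
by rewrite (distrC s2 (G y)); lra.
Qed.

Lemma card_near_nodes (N : nat) (x e : R) : (0 < N)%N -> 0 <= x <= 1 -> 0 < e <= 1 ->
  4 / e <= N%:R ->
  e / 4 * N%:R <= #|[set i : 'I_N | `|node i - x| < e]%SET|%:R.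
Proof.
move=> N0 /andP[x0 x1] /andP[e0 e1] Ne; have NR : 0 < N%:R :> R by rewrite ltr0n.
have eN : 4 <= e * N%:R by rewrite mulrC -ler_pdivrMr.
pose k := Num.truncn (e * N%:R / 2).
have k0 : 0 <= e * N%:R / 2 by rewrite divr_ge0// mulr_ge0// ltW.
have k1 : k%:R <= e * N%:R / 2 by have /andP[] := truncn_itv k0.
have k2 : e * N%:R / 2 < k.+1%:R by have /andP[] := truncn_itv k0.
have kN : (k <= N)%N.
  rewrite -(ler_nat R); apply: (le_trans k1).
  by rewrite ler_pdivrMr//; move: NR e1; nra.
have xN0 : 0 <= x * N%:R by rewrite mulr_ge0// ltW.
pose f := Num.truncn (x * N%:R).
have f1 : f%:R <= x * N%:R by have /andP[] := truncn_itv xN0.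
have f2 : x * N%:R < f.+1%:R by have /andP[] := truncn_itv xN0.
(* A window of [k] consecutive indices starting near [x * N], shifted back when it would run past
   the right end. As [e * N >= 4], rounding down still leaves [k >= e * N / 4]. *)
pose a := minn f (N - k).
have aj (j : 'I_k) : (a + j < N)%N.
  apply: (@leq_trans ((N - k) + k)%N); last by rewrite subnK.
  by rewrite -addnS leq_add// geq_minr.
pose phi j := Ordinal (aj j).
have phi_inj : injective phi by move=> i j /(congr1 val)/= /addnI/val_inj.
apply: (@le_trans _ _ k%:R).
  have -> : e / 4 * N%:R = e * N%:R / 4 by ring.
  by move: k2 eN; rewrite -(natr1 k); lra.
rewrite ler_nat -[leqLHS]card_ord -cardsT -(card_imset _ phi_inj).
apply/subset_leq_card/fintype.subsetP => _ /imsetP[j _ ->]; rewrite inE /node /=.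
have jk : j.+1%:R <= k%:R :> R by rewrite ler_nat.
have ub : (a + j).+1%:R <= x * N%:R + k%:R :> R.
  rewrite -addnS natrD lerD//; apply: le_trans f1.
  by rewrite ler_nat geq_minl.
have lb : x * N%:R - k%:R <= (a + j).+1%:R :> R.
  rewrite /a; have [fk|fk] := leqP f (N - k).
    apply: (@le_trans _ _ f.+1%:R).
      by have := ler0n R k; move: f2; lra.
    by rewrite ler_nat ltnS leq_addr.
  apply: (@le_trans _ _ (N%:R - k%:R)).
    by rewrite lerD2r -[leRHS]mul1r ler_wpM2r// ltW.
  by rewrite -natrB// ler_nat -addnS leq_addr.
have -> : (a + j).+1%:R / N%:R - x = ((a + j).+1%:R - x * N%:R) / N%:R.
  by field; rewrite gt_eqF.
rewrite normrM (gtr0_norm (_ : 0 < N%:R^-1)) ?invr_gt0// ltr_pdivrMr//.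
apply: (@le_lt_trans _ _ k%:R).
  by rewrite ler_norml; apply/andP; split; lra.
by apply: (le_lt_trans k1); rewrite ltr_pdivrMr//; lra.
Qed.

(** No [s] is close to both of two distinct values of the degree function: with [w] a quarter of
    their difference, one value is at least [2 * w] away from [s]. By uniform continuity a fixed
    fraction of the nodes then stays at distance [w]. *)
Lemma degree_variance :
  ~ (exists c : R, forall x, 0 <= x <= 1 -> degree_fun g x = c) ->
  exists2 v, 0 < v & \forall N \near \oo, forall s : R,
    v <= avg (fun i : 'I_N => (G (node i) - s) ^+ 2).
Proof.
move=> nc; have [x1 [x101 Gx1]] : exists x, 0 <= x <= 1 /\ G x != G 0.
  apply: contrapT => /forallNP h; apply: nc; exists (G 0) => x x01.
  by have /not_andP[//|/negP/negPn/eqP] := h x.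
pose w := `|G x1 - G 0| / 4.
have w0 : 0 < w by rewrite divr_gt0// normr_gt0 subr_eq0.
have [e' e'0 ucG] := degree_unif_continuous w0.
pose e := Num.min e' 1.
have e01 : 0 < e <= 1 by rewrite lt_min e'0 ltr01 ge_min lexx orbT.
have /andP[e0 _] := e01.
exists (e / 4 * w ^+ 2); first by rewrite mulr_gt0 ?divr_gt0 ?exprn_gt0.
near=> N; have N0 : (0 < N)%N by near: N; exact: nbhs_infty_gt.
have NR : 0 < N%:R :> R by rewrite ltr0n.
have Ne : 4 / e < N%:R by near: N; exact: near_natr_gt.
have key (y s : R) : 0 <= y <= 1 -> 2 * w <= `|G y - s| ->
    e / 4 * w ^+ 2 <= avg (fun i : 'I_N => (G (node i) - s) ^+ 2).
  move=> y01 ys; set S := [set i : 'I_N | `|node i - y| < e]%SET.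
  rewrite /avg ler_pdivlMl//.
  apply: (@le_trans _ _ (\sum_(i in S) w ^+ 2)).
    rewrite sumr_const -(mulr_natl (w ^+ 2)) mulrA ler_wpM2r ?sqr_ge0//.
    by rewrite mulrC; apply: card_near_nodes => //; exact: ltW.
  rewrite big_mkcond/=; apply: ler_sum => i _; case: ifPn => [|_]; last exact: sqr_ge0.
  rewrite inE => iy; rewrite -(real_normK (num_real (_ - _))).
  rewrite ler_pXn2r ?nnegrE ?(ltW w0)//.
  have := ucG _ _ (node_itv N0 i) y01 (lt_le_trans iy _).
  rewrite ge_min lexx => /(_ isT).
  have := ler_distD (G (node i)) (G y) s; rewrite (distrC (G y) (G (node i))).
  by lra.
move=> s; have [h|h] := leP (2 * w) `|G x1 - s|; first exact: key h.
apply: (key 0); first by rewrite lexx ler01.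
have := ler_distD s (G x1) (G 0); rewrite (distrC s).
have : `|G x1 - G 0| = 4 * w by rewrite /w; field.
by lra.
Unshelve. all: by end_near. Qed.

End kernel_regularity.

(** * Concentration of the random tensor *)

Section sign_vectors.
Context (R : realType) (N : nat).
Implicit Types (s t r : {ffun 'I_N -> bool}) (x y z : 'I_N -> R).

Definition spin s i : R := (-1) ^+ s i.

Lemma spin_norm s i : `|spin s i| = 1.
Proof. by rewrite /spin normrX normrN1 expr1n. Qed.

Lemma linear_sign_bound (L x : 'I_N -> R) (M K : R) : 0 <= M ->
  (forall i, `|x i| <= M) -> (forall s, `|\sum_i L i * spin s i| <= K) ->
  `|\sum_i L i * x i| <= K * M.
Proof.
move=> M0 xM LK; pose s : {ffun 'I_N -> bool} := [ffun i => L i < 0].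
have sE i : `|L i| = L i * spin s i.
  rewrite /spin ffunE; case: ltrP => L0.
    by rewrite ltr0_norm// expr1 mulrN1.
  by rewrite ger0_norm// expr0 mulr1.
apply: (le_trans (ler_norm_sum _ _ _)).
apply: (@le_trans _ _ (\sum_i `|L i| * M)).
  by apply: ler_sum => i _; rewrite normrM ler_wpM2l.
rewrite -mulr_suml ler_wpM2r// (le_trans _ (LK s))// (le_trans _ (ler_norm _))//.
by apply: ler_sum => i _; rewrite sE.
Qed.

(** A form linear in each argument is extremal at the vertices of a product of cubes; the arguments
    are released from the vertices one after the other. This reduces uniformity over all vectors to
    a finite union bound. *)
Lemma trilinear_sign_bound (D : 'I_N -> 'I_N -> 'I_N -> R) x y z
  (M1 M2 M3 K : R) : 0 <= M1 -> 0 <= M2 -> 0 <= M3 ->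
  (forall i, `|x i| <= M1) -> (forall i, `|y i| <= M2) ->
  (forall i, `|z i| <= M3) ->
  (forall s t r, `|\sum_i \sum_j \sum_k
     D i j k * spin s i * spin t j * spin r k| <= K) ->
  `|\sum_i \sum_j \sum_k D i j k * x i * y j * z k| <= K * M1 * M2 * M3.
Proof.
move=> M10 M20 M30 xM yM zM DK.
have step1 t r : `|\sum_i \sum_j \sum_k D i j k * x i * spin t j * spin r k| <= K * M1.
  have -> : \sum_i \sum_j \sum_k D i j k * x i * spin t j * spin r k =
      \sum_i (\sum_j \sum_k D i j k * spin t j * spin r k) * x i.
    apply: eq_bigr => i _; rewrite mulr_suml; apply: eq_bigr => j _.
    by rewrite mulr_suml; apply: eq_bigr => k _; ring.
  apply: linear_sign_bound => // s; apply: le_trans (DK s t r).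
  rewrite le_eqVlt; apply/orP; left; apply/eqP; congr `|_|.
  apply: eq_bigr => i _; rewrite mulr_suml; apply: eq_bigr => j _.
  by rewrite mulr_suml; apply: eq_bigr => k _; ring.
have step2 r : `|\sum_i \sum_j \sum_k D i j k * x i * y j * spin r k| <= K * M1 * M2.
  have -> : \sum_i \sum_j \sum_k D i j k * x i * y j * spin r k =
      \sum_j (\sum_i \sum_k D i j k * x i * spin r k) * y j.
    rewrite exchange_big/=; apply: eq_bigr => j _; rewrite mulr_suml.
    apply: eq_bigr => i _; rewrite mulr_suml; apply: eq_bigr => k _; ring.
  apply: linear_sign_bound => // t; apply: le_trans (step1 t r).
  rewrite le_eqVlt; apply/orP; left; apply/eqP; congr `|_|.
  rewrite [RHS]exchange_big/=; apply: eq_bigr => j _; rewrite mulr_suml.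
  apply: eq_bigr => i _; rewrite mulr_suml; apply: eq_bigr => k _; ring.
have -> : \sum_i \sum_j \sum_k D i j k * x i * y j * z k =
    \sum_k (\sum_i \sum_j D i j k * x i * y j) * z k.
  under eq_bigr do rewrite exchange_big/=.
  rewrite exchange_big/=; apply: eq_bigr => k _; rewrite mulr_suml.
  by apply: eq_bigr => i _; rewrite mulr_suml.
apply: linear_sign_bound => // r; apply: le_trans (step2 r).
rewrite le_eqVlt; apply/orP; left; apply/eqP; congr `|_|.
under [RHS]eq_bigr do rewrite exchange_big/=.
rewrite [RHS]exchange_big/=; apply: eq_bigr => k _; rewrite mulr_suml.
by apply: eq_bigr => i _; rewrite mulr_suml.
Qed.

End sign_vectors.

Section random_hypergraph.
Context (R : realType) (g : R * R * R -> R).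
Hypothesis g_sym : symmetric3 g.
Hypothesis g_01 : forall p, cube p -> 0 <= g p <= 1.
Variable N : nat.
Hypothesis N0 : (0 < N)%N.
Let NR : 0 < N%:R :> R. Proof. by rewrite ltr0n. Qed.
Let N20 : 0 <= N%:R ^- 2 :> R. Proof. by rewrite invr_ge0 exprn_ge0. Qed.
Implicit Types (i j k : 'I_N) (xi : hypergraph N) (e : triple N).

Definition to_triple i j k : option (triple N) := insub [set i; j; k]%SET.

Definition mean_tensor i j k : R :=
  if to_triple i j k is Some e then N%:R ^- 2 * edge_prob g e else 0.

(** Unlike [mean_tensor] it is not set to zero at coinciding indices, so that it inherits the
    continuity of [g]. The two differ only at coincidences, which number at most [3 * N] for each
    [i]. *)
Definition grid_tensor i j k : R := N%:R ^- 2 * g (node R i, node R j, node R k).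

Lemma to_triple_some i j k e : to_triple i j k = Some e ->
  [/\ val e = [set i; j; k]%SET, i != j, i != k & j != k].
Proof.
rewrite /to_triple; case: insubP => // e' ce <- [<-]; split => //.
- apply: contraTneq ce => ->; rewrite finset.setUid cards2.
  by case: (j != k).
- apply: contraTneq ce => ->; rewrite finset.setUAC finset.setUid cards2.
  by case: (k != j).
- apply: contraTneq ce => ->; rewrite -finset.setUA finset.setUid cards2.
  by case: (i != k).
Qed.

Lemma to_triple_none i j k : to_triple i j k = None ->
  (1 <= (i == j) + (j == k) + (i == k))%N.
Proof.
rewrite /to_triple; case: insubP => // ce _.
case: (eqVneq i j) ce => //= ij; case: (eqVneq j k) => //= jk.
case: (eqVneq i k) => //= ik.
by rewrite -finset.setUA cardsU1 cards2 !inE (negbTE ij) (negbTE ik) jk.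
Qed.

Lemma to_tripleC12 i j k : to_triple i j k = to_triple j i k.
Proof. by rewrite /to_triple (finset.setUC [set i]%SET). Qed.

Lemma to_tripleC23 i j k : to_triple i j k = to_triple i k j.
Proof. by rewrite /to_triple finset.setUAC. Qed.

Lemma to_triple_diag i j : to_triple i j j = None.
Proof.
by case E : to_triple => [e|//]; have [_ _ _ /eqP] := to_triple_some E.
Qed.

Lemma tensor_is_tensor xi : is_tensor (tensor R xi).
Proof.
have tE i j k : tensor R xi i j k =
    if to_triple i j k is Some e then N%:R ^- 2 * (xi e)%:R else 0 by [].
split=> [i j k|i j k|i j|i j k|i j k]; rewrite !tE.
- by rewrite to_tripleC12.
- by rewrite to_tripleC23.
- by rewrite to_triple_diag.
- by case: to_triple => // e; rewrite mulr_ge0.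
- case: to_triple => [e|//]; rewrite -[leRHS]mulr1 ler_wpM2l//.
  by case: (xi e).
Qed.

Lemma cube_node i j k : cube (node R i, node R j, node R k).
Proof. by apply/cubeP; split; exact: node_itv. Qed.

(** The enumeration of the set lists the three indices in one of six orders, each undone by
    transpositions covered by [g_sym]. *)
Lemma edge_probE i j k e : to_triple i j k = Some e ->
  edge_prob g e = g (node R i, node R j, node R k).
Proof.
move=> /to_triple_some[ve ij ik jk].
have gs12 (a b c : 'I_N) : g (node R a, node R b, node R c) = g (node R b, node R a, node R c).
  exact: (g_sym (cube_node a b c)).1.
have gs23 (a b c : 'I_N) : g (node R a, node R b, node R c) = g (node R a, node R c, node R b).
  exact: (g_sym (cube_node a b c)).2.
rewrite /edge_prob ve.
have sz : size (enum [set i; j; k]%SET) = 3%N.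
  by rewrite -cardE -ve; apply/eqP; exact: (valP e).
have un := enum_uniq [set i; j; k]%SET.
have mem l : l \in enum [set i; j; k]%SET -> [|| l == i, l == j | l == k].
  by rewrite mem_enum !inE -orbA.
case: (enum _) sz un mem => [|a [|b [|c []]]] //= _.
rewrite !inE !andbT negb_or => /andP[/andP[ab ac] bc] mem.
have /or3P ma := mem a (mem_head _ _).
have /or3P mb : [|| b == i, b == j | b == k] by apply: mem; rewrite !inE eqxx orbT.
have /or3P mc : [|| c == i, c == j | c == k] by apply: mem; rewrite !inE eqxx !orbT.
rewrite -!/(node R _).
case: ma mb mc ab ac bc => /eqP -> [] /eqP -> [] /eqP ->; rewrite ?eqxx// => _ _ _.
- by rewrite gs23.
- by rewrite gs12.
- by rewrite gs12 gs23.
Qed.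

Lemma edge_prob_01 e : 0 <= edge_prob g e <= 1.
Proof.
rewrite /edge_prob.
have sz : size (enum (val e)) = 3%N by rewrite -cardE; apply/eqP; exact: (valP e).
case: (enum _) sz => [|a [|b [|c []]]] //= _; apply: g_01.
exact: cube_node.
Qed.

Lemma mean_tensor_grid i j k :
  `|mean_tensor i j k - grid_tensor i j k| <=
  N%:R ^- 2 * ((i == j) + (j == k) + (i == k))%:R.
Proof.
rewrite /mean_tensor /grid_tensor; case E : to_triple => [e|].
  by rewrite (edge_probE E) subrr normr0 mulr_ge0.
have /andP[g0 g1] := g_01 (cube_node i j k).
rewrite sub0r normrN ger0_norm ?mulr_ge0// ler_wpM2l//.
by rewrite (le_trans g1)// ler1n; exact: to_triple_none.
Qed.

Lemma mean_tensor_itv i j k : 0 <= mean_tensor i j k <= N%:R ^- 2.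
Proof.
rewrite /mean_tensor; case: to_triple => [e|]; last by rewrite lexx.
have /andP[p0 p1] := edge_prob_01 e; rewrite mulr_ge0//=.
by rewrite -[leRHS]mulr1 ler_wpM2l.
Qed.

Definition deviation xi (s t r : {ffun 'I_N -> bool}) : R :=
  \sum_i \sum_j \sum_k (tensor R xi i j k - mean_tensor i j k) *
    spin R s i * spin R t j * spin R r k.

(* The threshold [162 = 6 * 27] lets the Chernoff bound with parameter [N / 27]
   beat the number [8 ^ N] of choices of signs. *)
Definition good_hypergraphs : {set hypergraph N} :=
  [set xi | [forall s, [forall t, [forall r,
    `|deviation xi s t r| <= 162]]]]%SET.

(** Gathers the entries of all orderings of one triple, which share a Bernoulli variable; the
    deviation thereby becomes a sum of independent centred terms. *)
Definition edge_coef (s t r : {ffun 'I_N -> bool}) e : R :=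
  \sum_i \sum_j \sum_k N%:R ^- 2 * (to_triple i j k == Some e)%:R *
    (spin R s i * spin R t j * spin R r k).

Lemma deviationE xi s t r : deviation xi s t r =
  \sum_e edge_coef s t r e * ((xi e)%:R - edge_prob g e).
Proof.
rewrite /edge_coef.
under [RHS]eq_bigr => e _.
  rewrite mulr_suml; under eq_bigr => i _.
    rewrite mulr_suml; under eq_bigr => j _ do rewrite mulr_suml.
  over.
over.
rewrite [RHS]exchange_big/=; apply: eq_bigr => i _.
rewrite [RHS]exchange_big/=; apply: eq_bigr => j _.
rewrite [RHS]exchange_big/=; apply: eq_bigr => k _.
rewrite /tensor /mean_tensor -/(to_triple i j k).
case E : (to_triple i j k) => [e|]; last first.
  by rewrite subrr !mul0r big1// => e _; rewrite mulr0 !mul0r.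
rewrite (bigD1 e)//= eqxx big1 ?addr0; last first.
  move=> e' ne; rewrite (_ : (Some e == Some e') = false) ?mulr0 ?mul0r//.
  by apply/negP => /eqP[ee]; rewrite ee eqxx in ne.
by rewrite mulr1; ring.
Qed.

(** A crude count: all [3 ^ 3 = 27] index triples with entries in [e], coinciding or not. *)
Lemma edge_coef_norm s t r e : `|edge_coef s t r e| <= 27 * N%:R ^- 2.
Proof.
apply: (@le_trans _ _ (\sum_i \sum_j \sum_k N%:R ^- 2 *
   ((i \in val e)%:R * (j \in val e)%:R * (k \in val e)%:R))).
  apply: (le_trans (ler_norm_sum _ _ _)); apply: ler_sum => i _.
  apply: (le_trans (ler_norm_sum _ _ _)); apply: ler_sum => j _.
  apply: (le_trans (ler_norm_sum _ _ _)); apply: ler_sum => k _.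
  rewrite !normrM !spin_norm !mulr1 (ger0_norm N20) ler_wpM2l//.
  case: eqP => [/to_triple_some[-> _ _ _]|_]; last first.
    by rewrite normr0 !mulr_ge0.
  by rewrite !inE !eqxx !orbT normr1 !mulr1.
have c3 : \sum_i (i \in val e)%:R = 3 :> R.
  transitivity (\sum_(i in val e) 1 : R); last by rewrite sumr_const (eqP (valP e)).
  by rewrite [RHS]big_mkcond/=; apply: eq_bigr => i _; case: (_ \in _).
rewrite le_eqVlt; apply/orP; left; apply/eqP.
transitivity (\sum_i \sum_j N%:R ^- 2 * 3 * ((i \in val e)%:R * (j \in val e)%:R) : R).
  apply: eq_bigr => i _; apply: eq_bigr => j _.
  by rewrite -mulr_sumr -mulr_sumr c3; ring.
transitivity (\sum_i N%:R ^- 2 * 3 * 3 * (i \in val e)%:R : R).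
  by apply: eq_bigr => i _; rewrite -mulr_sumr -mulr_sumr c3; ring.
by rewrite -mulr_sumr c3; ring.
Qed.

Let W xi : R := \prod_e bernoulli_pmf (edge_prob g e) (xi e).

Lemma W_ge0 xi : 0 <= W xi.
Proof.
apply: prodr_ge0 => e _; apply: bernoulli_pmf_ge0; exact: edge_prob_01.
Qed.

Lemma hypergraph_prob_fun (f : triple N -> bool -> R) :
  \sum_xi W xi * \prod_e f e (xi e) =
  \prod_e (edge_prob g e * f e true + (1 - edge_prob g e) * f e false).
Proof.
rewrite (eq_bigr (fun xi : hypergraph N => \prod_e
    (bernoulli_pmf (edge_prob g e) (xi e) * f e (xi e)))); last first.
  by move=> xi _; rewrite /W -big_split.
rewrite -(bigA_distr_bigA (fun e b => bernoulli_pmf (edge_prob g e) b * f e b)).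
by apply: eq_bigr => e _; rewrite big_bool.
Qed.

Lemma hypergraph_prob_setT : \sum_xi W xi = 1.
Proof.
have := hypergraph_prob_fun (fun _ _ => 1).
rewrite [RHS]big1 => [<-|e _]; last by rewrite !mulr1 addrC subrK.
by apply: eq_bigr => xi _; rewrite big1_eq mulr1.
Qed.

Lemma bernoulli_mgf (p u : R) : 0 <= p <= 1 -> `|u| <= 2^-1 ->
  p * expR (u * (1 - p)) + (1 - p) * expR (u * (0 - p)) <= expR (2 * u ^+ 2).
Proof.
move=> /andP[p0 p1] u1; apply: le_trans (expR_ge1Dx _).
have E v : `|v| <= 1 -> expR (u * v) <= 1 + u * v + 2 * u ^+ 2 * v ^+ 2.
  move=> v1; have := @expR_quadratic _ (u * v) _.
  rewrite normrM => /(_ (le_trans (ler_piMr (normr_ge0 u) v1) u1)).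
  by rewrite ler_norml exprMn => /andP[_]; lra.
have e1 : expR (u * (1 - p)) <= _ := E (1 - p) _.
have {}e1 := e1 ltac:(by rewrite ler_norml; apply/andP; split; lra).
have e2 : expR (u * (0 - p)) <= _ := E (0 - p) _.
have {}e2 := e2 ltac:(by rewrite ler_norml; apply/andP; split; lra).
have h1 := ler_wpM2l p0 e1.
have p1' : 0 <= 1 - p by lra.
have h2 := ler_wpM2l p1' e2.
apply: (le_trans (lerD h1 h2)).
have -> : p * (1 + u * (1 - p) + 2 * u ^+ 2 * (1 - p) ^+ 2) +
    (1 - p) * (1 + u * (0 - p) + 2 * u ^+ 2 * (0 - p) ^+ 2) =
  1 + 2 * u ^+ 2 * (p * (1 - p)) by ring.
have u20 := sqr_ge0 u; rewrite lerD2l -[leRHS]mulr1 ler_wpM2l//; first by lra.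
by nra.
Qed.

Lemma card_triple : (#|{: triple N}| <= N ^ 3)%N.
Proof.
rewrite card_sig -[X in (_ <= X ^ _)%N]card_ord.
have -> : #|[pred e : {set 'I_N} | #|e| == 3%N]| = 'C(N, 3).
  by rewrite -[in RHS](card_ord N) -card_draws; apply: eq_card => e; rewrite !inE.
rewrite card_ord; apply: (@leq_trans ('C(N, 3) * 3`!)%N).
  by rewrite leq_pmulr.
rewrite bin_ffact; elim: 3%N => // m IH.
by rewrite ffactnSr expnSr leq_mul// leq_subr.
Qed.

(** This [c] makes each exponent coefficient at most [1 / N], hence at most [1 / 2] as
    [bernoulli_mgf] requires. Each triple contributes a factor at most [expR (2 / N ^ 2)], and there
    are at most [N ^ 3] triples. *)
Lemma deviation_mgf (c : R) s t r : (2 <= N)%N -> `|c| = N%:R / 27 ->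
  \sum_xi W xi * expR (c * deviation xi s t r) <= expR (2 * N%:R).
Proof.
move=> N2 cN.
have -> : \sum_xi W xi * expR (c * deviation xi s t r) =
    \sum_xi W xi * \prod_e expR (c * edge_coef s t r e * ((xi e)%:R - edge_prob g e)).
  apply: eq_bigr => xi _; congr (_ * _); rewrite -expR_sum; congr expR.
  by rewrite deviationE mulr_sumr; apply: eq_bigr => e _; rewrite mulrA.
rewrite (hypergraph_prob_fun (fun e b =>
  expR (c * edge_coef s t r e * (b%:R - edge_prob g e)))) /=.
have cc e : `|c * edge_coef s t r e| <= N%:R^-1.
  rewrite normrM cN.
  have -> : N%:R^-1 = N%:R / 27 * (27 * N%:R ^- 2) :> R by field; rewrite gt_eqF.
  by apply: ler_wpM2l; [rewrite divr_ge0// ltW|exact: edge_coef_norm].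
have c2 : N%:R^-1 <= 2^-1 :> R by rewrite lef_pV2 ?posrE// (ler_nat _ 2).
apply: (@le_trans _ _ (\prod_(e : triple N) expR (2 / N%:R ^+ 2))).
  apply: ler_prod => e _; have /andP[p0 p1] := edge_prob_01 e.
  apply/andP; split.
    by rewrite addr_ge0// mulr_ge0// ?expR_ge0// subr_ge0.
  apply: (le_trans (bernoulli_mgf (edge_prob_01 e) (le_trans (cc e) c2))).
  rewrite ler_expR -(real_normK (num_real (c * _))).
  rewrite ler_pM2l// -exprVn ler_pXn2r ?nnegrE ?invr_ge0//.
rewrite -expR_sum ler_expR sumr_const -(mulr_natl (2 / _)).
apply: (@le_trans _ _ (N%:R ^+ 3 * (2 / N%:R ^+ 2))).
  apply: ler_wpM2r; first by rewrite divr_ge0// exprn_ge0.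
  by rewrite -natrX ler_nat; exact: card_triple.
rewrite le_eqVlt; apply/orP; left; apply/eqP; field; by rewrite gt_eqF.
Qed.

Lemma card_sign_vectors : #|{: {ffun 'I_N -> bool}}|%:R <= expR N%:R :> R.
Proof.
rewrite card_ffun card_bool card_ord natrX.
have -> : expR N%:R = expR 1 ^+ N :> R by rewrite -expRM_natl mulr1.
rewrite ler_pXn2r ?nnegrE ?expR_ge0//.
by have := expR_ge1Dx (1 : R); lra.
Qed.

(** Union bound over three sign vectors and both signs of the deviation: at most [expR (3 * N)]
    choices of signs, the moment bound [expR (2 * N)] and the threshold factor [expR (- (6 * N))]
    leave [2 * expR (- N)], which is at most [2 / (1 + N)]. *)
Lemma good_hypergraphs_prob : (2 <= N)%N ->
  1 - 2 / (1 + N%:R) <= hypergraph_prob g good_hypergraphs <= 1.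
Proof.
move=> N2; have split1 : hypergraph_prob g good_hypergraphs +
    \sum_(xi | xi \notin good_hypergraphs) W xi = 1.
  by rewrite -hypergraph_prob_setT [RHS](bigID (mem good_hypergraphs)).
have bad0 : 0 <= \sum_(xi | xi \notin good_hypergraphs) W xi.
  by apply: sumr_ge0 => xi _; exact: W_ge0.
suff bad1 : \sum_(xi | xi \notin good_hypergraphs) W xi <= 2 / (1 + N%:R).
  by apply/andP; split; lra.
pose a : R := N%:R / 27.
have a0 : 0 <= a by rewrite divr_ge0// ltW.
pose B c s t r xi : R := expR (c * deviation xi s t r) * expR (- (6 * N%:R)).
have B0 c s t r xi : 0 <= B c s t r xi by rewrite mulr_ge0 ?expR_ge0.
apply: (@le_trans _ _ (\sum_xi W xi * \sum_s \sum_t \sum_r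
    (B a s t r xi + B (- a) s t r xi))).
  rewrite big_mkcond/=; apply: ler_sum => xi _; case: ifPn => [bad|_]; last first.
    rewrite mulr_ge0 ?W_ge0//; do 3 (apply: sumr_ge0 => ? _).
    exact: addr_ge0.
  rewrite -[leLHS]mulr1 ler_wpM2l ?W_ge0//.
  move: bad; rewrite inE negb_forall => /existsP[s].
  rewrite negb_forall => /existsP[t]; rewrite negb_forall => /existsP[r].
  rewrite -ltNge => dev.
  rewrite (bigD1 s)//= (bigD1 t)//= (bigD1 r)//=.
  have pos3 (b c d : R) : 0 <= b -> 0 <= c -> 0 <= d ->
      1 <= B a s t r xi + B (- a) s t r xi ->
      1 <= B a s t r xi + B (- a) s t r xi + b + c + d by clear; lra.
  apply: pos3.
  - by apply: sumr_ge0 => ? _; exact: addr_ge0.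
  - by do 2 (apply: sumr_ge0 => ? _); exact: addr_ge0.
  - by do 3 (apply: sumr_ge0 => ? _); exact: addr_ge0.
  have big v : 162 < v -> 1 <= expR (a * v) * expR (- (6 * N%:R)).
    move=> v162; rewrite -expRD -[leLHS]expR0 ler_expR subr_ge0.
    have -> : 6 * N%:R = a * 162 :> R by rewrite /a; field.
    by rewrite ler_wpM2l// ltW.
  have [d0|d0] := leP 0 (deviation xi s t r).
    rewrite ger0_norm// in dev; rewrite (le_trans (big _ dev))//.
    by rewrite lerDl B0.
  rewrite ltr0_norm// in dev; rewrite (le_trans (big _ dev))//.
  by rewrite mulrN -mulNr lerDr B0.
have -> : \sum_xi W xi * \sum_s \sum_t \sum_r
    (B a s t r xi + B (- a) s t r xi) = \sum_s \sum_t \sum_r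
    ((\sum_xi W xi * expR (a * deviation xi s t r)) +
     (\sum_xi W xi * expR (- a * deviation xi s t r))) * expR (- (6 * N%:R)).
  under eq_bigr do rewrite mulr_sumr.
  rewrite exchange_big/=; apply: eq_bigr => s _.
  under eq_bigr do rewrite mulr_sumr.
  rewrite exchange_big/=; apply: eq_bigr => t _.
  under eq_bigr do rewrite mulr_sumr.
  rewrite exchange_big/=; apply: eq_bigr => r _.
  rewrite -big_split/= mulr_suml; apply: eq_bigr => xi _.
  by rewrite /B; ring.
have aN : `|a| = N%:R / 27 by rewrite ger0_norm.
have aN' : `|- a| = N%:R / 27 by rewrite normrN.
set S := #|{: {ffun 'I_N -> bool}}|%:R : R.
apply: (@le_trans _ _ (S * S * S * (2 * expR (2 * N%:R) * expR (- (6 * N%:R))))).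
  have -> : S * S * S * (2 * expR (2 * N%:R) * expR (- (6 * N%:R))) =
    \sum_(s : {ffun 'I_N -> bool}) \sum_(t : {ffun 'I_N -> bool})
    \sum_(r : {ffun 'I_N -> bool}) (2 * expR (2 * N%:R) * expR (- (6 * N%:R))).
    by rewrite !sumr_const -!mulrnA -[RHS]mulr_natl !natrM /S; ring.
  apply: ler_sum => s _; apply: ler_sum => t _; apply: ler_sum => r _.
  apply: ler_wpM2r; first exact: expR_ge0.
  have := deviation_mgf s t r N2 aN; have := deviation_mgf s t r N2 aN'.
  set x1 := \sum_xi _; set x2 := \sum_xi _; clear; lra.
apply: (@le_trans _ _ (expR N%:R * expR N%:R * expR N%:R *
    (2 * expR (2 * N%:R) * expR (- (6 * N%:R))))).
  apply: ler_wpM2r; first by rewrite !mulr_ge0 ?expR_ge0.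
  have S0 : 0 <= S by [].
  have SN : S <= expR N%:R := card_sign_vectors.
  by rewrite ler_pM ?mulr_ge0// ler_pM.
rewrite -!expRD [X in _ * X](_ : _ = 2 * (expR (2 * N%:R) * expR (- (6 * N%:R)))); last by ring.
rewrite -expRD mulrCA -expRD ler_pM2l//.
rewrite (_ : _ + _ = - N%:R); last by ring.
rewrite expRN lef_pV2 ?posrE ?expR_gt0//; first exact: expR_ge1Dx.
Qed.

End random_hypergraph.

(** * Local fields and energy on the good event *)

Section good_tensor.
Context (R : realType) (g : R * R * R -> R).
Hypothesis g_sym : symmetric3 g.
Hypothesis g_01 : forall p, cube p -> 0 <= g p <= 1.
Variable N : nat.
Hypothesis N0 : (0 < N)%N.
Let NR : 0 < N%:R :> R. Proof. by rewrite ltr0n. Qed.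
Let N20 : 0 <= N%:R ^- 2 :> R. Proof. by rewrite invr_ge0 exprn_ge0. Qed.
Variable xi : hypergraph N.
Hypothesis xi_good : xi \in good_hypergraphs g N.
Local Notation A := (tensor R xi).
Local Notation Ag := (@grid_tensor R g N).
Local Notation Am := (@mean_tensor R g N).

Definition quad_field (B : 'I_N -> 'I_N -> 'I_N -> R) (x : 'I_N -> R) i : R :=
  \sum_j \sum_k B i j k * x j * x k.

Lemma good_trilinear x y z (M1 M2 M3 : R) : 0 <= M1 -> 0 <= M2 -> 0 <= M3 ->
  (forall i, `|x i| <= M1) -> (forall i, `|y i| <= M2) ->
  (forall i, `|z i| <= M3) ->
  `|\sum_i \sum_j \sum_k (A i j k - Am i j k) * x i * y j * z k| <=
  162 * M1 * M2 * M3.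
Proof.
move=> M10 M20 M30 xM yM zM; apply: trilinear_sign_bound => // s t r.
move: xi_good; rewrite inE => /forallP/(_ s)/forallP/(_ t)/forallP/(_ r).
exact.
Qed.

Lemma sum_coincidences (i : 'I_N) :
  \sum_(j < N) \sum_(k < N) ((i == j) + (j == k) + (i == k))%:R = 3 * N%:R :> R.
Proof.
under eq_bigr => j _.
  under eq_bigr => k _ do rewrite !natrD.
  rewrite !big_split/= sumr_const card_ord.
  under [X in _ + X + _]eq_bigr => k _ do rewrite eq_sym -[_%:R]mul1r.
  under [X in _ + X]eq_bigr => k _ do rewrite eq_sym -[_%:R]mul1r.
  rewrite !(sum_indic (fun=> 1)).
over.
rewrite !big_split/= !sumr_const card_ord.
under eq_bigr => j _ do rewrite eq_sym -(mulr_natl (_%:R)).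
rewrite (sum_indic (fun=> N%:R)); ring.
Qed.

Variables (x : 'I_N -> R) (M : R).
Hypotheses (M0 : 0 <= M) (xM : forall i, `|x i| <= M).

Lemma quad_field_mean_grid i :
  `|quad_field Am x i - quad_field Ag x i| <= 3 * M ^+ 2 / N%:R.
Proof.
rewrite /quad_field -sumrB; apply: (le_trans (ler_norm_sum _ _ _)).
apply: (@le_trans _ _ (\sum_j \sum_k
    (N%:R ^- 2 * M ^+ 2) * ((i == j) + (j == k) + (i == k))%:R)).
  apply: ler_sum => j _; rewrite -sumrB; apply: (le_trans (ler_norm_sum _ _ _)).
  apply: ler_sum => k _; rewrite -!mulrBl !normrM.
  set c := (_ + _ + _)%:R; have -> : N%:R ^- 2 * M ^+ 2 * c = N%:R ^- 2 * c * (M * M) by ring.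
  rewrite -mulrA; apply: ler_pM; [by []|exact: mulr_ge0| |exact: ler_pM].
  exact: mean_tensor_grid.
under eq_bigr => j _ do rewrite -mulr_sumr.
rewrite -mulr_sumr sum_coincidences le_eqVlt; apply/orP; left; apply/eqP.
by field; rewrite gt_eqF.
Qed.

Lemma quad_field_norm (B : 'I_N -> 'I_N -> 'I_N -> R) i :
  (forall j k, 0 <= B i j k <= N%:R ^- 2) -> `|quad_field B x i| <= M ^+ 2.
Proof.
move=> B01; apply: (le_trans (ler_norm_sum _ _ _)).
apply: (@le_trans _ _ (\sum_(j < N) \sum_(k < N) N%:R ^- 2 * M ^+ 2)).
  apply: ler_sum => j _; apply: (le_trans (ler_norm_sum _ _ _)).
  apply: ler_sum => k _; have /andP[b0 b1] := B01 j k.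
  rewrite !normrM -mulrA expr2 (ger0_norm b0) ler_pM ?mulr_ge0// ler_pM//.
rewrite !sumr_const card_ord -mulrnA -[leLHS]mulr_natl natrM.
by rewrite le_eqVlt; apply/orP; left; apply/eqP; field; rewrite gt_eqF.
Qed.

(** The error vector [u] is itself a test vector: its squared norm is the trilinear form at
    [(u, x, x)], at most [162 * (2 * M ^ 2) * M * M]. Passing to the grid costs [9 * M ^ 4] more,
    and [666 = 2 * (324 + 9)]. *)
Lemma quad_field_close :
  \sum_i (quad_field A x i - quad_field Ag x i) ^+ 2 <= 666 * M ^+ 4.
Proof.
have tA := tensor_is_tensor R xi.
pose u i := quad_field A x i - quad_field Am x i.
pose v i := quad_field Am x i - quad_field Ag x i.
have uM i : `|u i| <= 2 * M ^+ 2.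
  rewrite /u (le_trans (ler_normB _ _))//.
  have h1 : `|quad_field A x i| <= M ^+ 2.
    by apply: quad_field_norm => j k; rewrite (tensor_ge0 tA) (tensor_le tA).
  have h2 : `|quad_field Am x i| <= M ^+ 2.
    by apply: quad_field_norm => j k; exact: mean_tensor_itv.
  by move: h1 h2; lra.
have u2 : \sum_i u i ^+ 2 <= 324 * M ^+ 4.
  have -> : \sum_i u i ^+ 2 =
      \sum_i \sum_j \sum_k (A i j k - Am i j k) * u i * x j * x k.
    apply: eq_bigr => i _; rewrite expr2 {1}/u /quad_field -sumrB mulr_suml.
    apply: eq_bigr => j _; rewrite -sumrB mulr_suml.
    by apply: eq_bigr => k _; ring.
  have uM0 : 0 <= 2 * M ^+ 2 by rewrite mulr_ge0 ?exprn_ge0.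
  apply: (le_trans (ler_norm _)).
  apply: (le_trans (good_trilinear uM0 M0 M0 uM xM xM)).
  by rewrite le_eqVlt; apply/orP; left; apply/eqP; ring.
have v2 : \sum_i v i ^+ 2 <= 9 * M ^+ 4.
  apply: (@le_trans _ _ (\sum_(i < N) (3 * M ^+ 2 / N%:R) ^+ 2)).
    apply: ler_sum => i _; rewrite -(real_normK (num_real (v i))).
    have q0 : 0 <= 3 * M ^+ 2 / N%:R.
      by rewrite divr_ge0 ?(ltW NR)// mulr_ge0// exprn_ge0.
    by rewrite ler_pXn2r ?nnegrE//; exact: quad_field_mean_grid.
  rewrite sumr_const card_ord -[leLHS]mulr_natl.
  have -> : N%:R * (3 * M ^+ 2 / N%:R) ^+ 2 = 9 * M ^+ 4 * N%:R^-1.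
    by field; rewrite gt_eqF.
  rewrite -[leRHS]mulr1 ler_wpM2l//; first by rewrite mulr_ge0// exprn_ge0.
  by rewrite invf_le1// ler1n.
apply: (@le_trans _ _ (\sum_i (2 * u i ^+ 2 + 2 * v i ^+ 2))).
  apply: ler_sum => i _; have -> : quad_field A x i - quad_field Ag x i = u i + v i.
    by rewrite /u /v; ring.
  have := sqr_ge0 (u i - v i); set p := u i; set q := v i; nra.
rewrite big_split/= -!mulr_sumr; move: u2 v2.
set p := \sum_i u i ^+ 2; set q := \sum_i v i ^+ 2; lra.
Qed.

(** [165 = 162 + 3]: the trilinear bound, plus the coincidences between mean and grid tensor. *)
Lemma cubic_close :
  `|\sum_i x i * quad_field A x i - \sum_i x i * quad_field Ag x i| <= 165 * M ^+ 3.
Proof.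
have -> : \sum_i x i * quad_field A x i - \sum_i x i * quad_field Ag x i =
   \sum_i \sum_j \sum_k (A i j k - Am i j k) * x i * x j * x k +
   \sum_i x i * (quad_field Am x i - quad_field Ag x i).
  rewrite -sumrB -big_split/=; apply: eq_bigr => i _.
  have -> : \sum_j \sum_k (A i j k - Am i j k) * x i * x j * x k =
      x i * (quad_field A x i - quad_field Am x i).
    rewrite /quad_field -sumrB mulr_sumr; apply: eq_bigr => j _.
    by rewrite -sumrB mulr_sumr; apply: eq_bigr => k _; ring.
  by ring.
have h1 := good_trilinear M0 M0 M0 xM xM xM.
have h2 : `|\sum_i x i * (quad_field Am x i - quad_field Ag x i)| <= 3 * M ^+ 3.
  apply: (le_trans (ler_norm_sum _ _ _)).
  apply: (@le_trans _ _ (\sum_(i < N) M * (3 * M ^+ 2 / N%:R))).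
    by apply: ler_sum => i _; rewrite normrM ler_pM// quad_field_mean_grid.
  rewrite sumr_const card_ord -[leLHS]mulr_natl.
  by rewrite le_eqVlt; apply/orP; left; apply/eqP; field; rewrite gt_eqF.
apply: (le_trans (ler_normD _ _)); move: h1 h2.
have -> : 162 * M * M * M = 162 * M ^+ 3 by ring.
set p := `|_|; set q := `|_|; lra.
Qed.

End good_tensor.

Section good_events.
Context (R : realType) (g : R * R * R -> R).
Hypothesis g_sym : symmetric3 g.
Hypothesis g_cont : {within @cube R, continuous g}.
Hypothesis g_01 : forall p, cube p -> 0 <= g p <= 1.

Lemma good_hypergraphs_cvg :
  hypergraph_prob g (good_hypergraphs g N) @[N --> \oo] --> (1 : R).
Proof.
apply/cvgrPdist_le => e e0; near=> N.
have N2 : (2 <= N)%N by near: N; exact: nbhs_infty_ge.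
have N0 : (0 < N)%N by exact: leq_trans N2.
have NR : 0 < N%:R :> R by rewrite ltr0n.
have Ne : 2 / e < N%:R by near: N; exact: near_natr_gt.
have /andP[p1 p2] := good_hypergraphs_prob g_01 N0 N2.
rewrite ger0_norm ?subr_ge0// lerBlDr -lerBlDl (le_trans _ p1)// lerD2l lerN2.
rewrite ler_pdivrMr; last by rewrite ltr_wpDr// ltW.
move: Ne; rewrite ltr_pdivrMr// mulrDr mulr1 mulrC => h; lra.
Unshelve. all: by end_near. Qed.

Lemma good_degree_variance :
  ~ (exists c : R, forall x, 0 <= x <= 1 -> degree_fun g x = c) ->
  exists2 v : R, 0 < v & \forall N \near \oo,
    forall xi : hypergraph N, xi \in good_hypergraphs g N ->
    forall s, v <= avg (fun i => (degree (tensor R xi) i - s) ^+ 2).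
Proof.
move=> nc; have [v v0 vG] := degree_variance g_cont g_01 nc.
exists (v / 4); first by rewrite divr_gt0.
(* Then [2 * w ^+ 2 = v / 8]; the random error is made to contribute at most another [v / 8].
   Degrees and kernel degrees thus differ by [v / 4] in mean square, which leaves [v / 4] of the
   variance. *)
pose w := Num.sqrt v / 4.
have w0 : 0 < w by rewrite divr_gt0// sqrtr_gt0.
have w2 : w ^+ 2 = v / 16.
  by rewrite /w exprMn sqr_sqrtr ?(ltW v0)//; field.
have [e e0 ucg] := kernel_unif_continuous g_cont w0.
near=> N => xi xig s.
have N0 : (0 < N)%N by near: N; exact: nbhs_infty_gt.
have NR : 0 < N%:R :> R by rewrite ltr0n.
have Ne : e^-1 < N%:R by near: N; exact: near_natr_gt.
have Nv : 666 / N%:R <= v / 16.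
  rewrite ler_pdivrMr// mulrC -ler_pdivrMr ?divr_gt0// ltW//.
  by near: N; exact: near_natr_gt.
have vGN : forall s : R, v <= avg (fun i : 'I_N => (degree_fun g (node R i) - s) ^+ 2).
  by near: N.
have Ne' : N%:R^-1 < e by rewrite -[ltRHS]invrK ltf_pV2 ?posrE ?invr_gt0.
pose d i := degree (tensor R xi) i; pose Gn (i : 'I_N) := degree_fun g (node R i).
pose one (_ : 'I_N) : R := 1.
have dq i : d i = quad_field (tensor R xi) one i.
  by apply: eq_bigr => j _; apply: eq_bigr => k _; rewrite !mulr1.
have Gq i : `|Gn i - quad_field (@grid_tensor R g N) one i| <= w.
  have := degree_riemann g_01 N0 w0 (node_itv R N0 i) ucg Ne'.
  congr (`|_ - _| <= _); rewrite mulr_sumr; apply: eq_bigr => j _.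
  by rewrite mulr_sumr; apply: eq_bigr => k _; rewrite !mulr1.
have close := quad_field_close g_sym g_01 N0 xig ler01
  (fun i => eq_ind_r (fun z => z <= 1) (lexx 1) (normr1 R)).
have c1 : avg (fun i => (d i - Gn i) ^+ 2) <= v / 4.
  apply: (@le_trans _ _ (2 * avg (fun i =>
     (quad_field (tensor R xi) one i - quad_field (@grid_tensor R g N) one i) ^+ 2) +
     2 * w ^+ 2)).
    rewrite -[2 * w ^+ 2](avg_cst N0) -avgZ -avgD; apply: le_avg => i.
    have Gw : (Gn i - quad_field (@grid_tensor R g N) one i) ^+ 2 <= w ^+ 2.
      rewrite -(real_normK (num_real (Gn i - _))).
      by rewrite ler_pXn2r ?nnegrE// ltW.
    rewrite dq; move: Gw; set p := Gn i; set q := quad_field _ _ _.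
    set r := quad_field _ _ _ => Gw.
    by have := sqr_ge0 (r - q + (p - q)); nra.
  have : avg (fun i => (quad_field (tensor R xi) one i -
      quad_field (@grid_tensor R g N) one i) ^+ 2) <= 666 / N%:R.
    by rewrite /avg mulrC ler_wpM2r ?invr_ge0 ?(ltW NR)// (le_trans close)// expr1n mulr1.
  by move: Nv; rewrite w2; set p := avg _; set q := _ / N%:R; lra.
have c2 : avg (fun i => (Gn i - s) ^+ 2) <=
    2 * avg (fun i => (d i - s) ^+ 2) + 2 * avg (fun i => (d i - Gn i) ^+ 2).
  rewrite -!avgZ -avgD; apply: le_avg => i.
  set p := Gn i; set q := d i.
  by have := sqr_ge0 (q - s + (q - p)); nra.
have := vGN s; move: c1 c2; rewrite -/Gn -/d.
set p := avg _; set q := avg _; set r := avg _; lra.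
Unshelve. all: by end_near. Qed.

End good_events.

(** * Block averages *)

Section blocks.
Context (R : realType) (N K : nat).
Hypotheses (N0 : (0 < N)%N) (K0 : (0 < K)%N).
Implicit Types (x c : 'I_N -> R) (i j : 'I_N).

Lemma block_subproof i : ((K * i) %/ N < K)%N.
Proof. by rewrite ltn_divLR// ltn_pmul2l. Qed.

Definition block i : 'I_K := Ordinal (block_subproof i).

Lemma block_node_dist i j : block i = block j -> `|node R i - node R j| <= K%:R^-1.
Proof.
move=> /(congr1 val)/= ij; have NR : 0 < N%:R :> R by rewrite ltr0n.
have KR : 0 < K%:R :> R by rewrite ltr0n.
have key (a b : 'I_N) : ((K * a) %/ N = (K * b) %/ N)%N -> (K * a <= K * b + N)%N.
  move=> ab; rewrite (divn_eq (K * a) N) ab (leq_trans _ (leq_add (leq_trunc_div _ N) (leqnn _)))//.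
  by rewrite leq_add2l ltnW// ltn_mod.
have h1 := key _ _ ij; have h2 := key _ _ (esym ij).
rewrite -(ler_nat R) natrD !natrM in h1; rewrite -(ler_nat R) natrD !natrM in h2.
have -> : node R i - node R j = (i%:R - j%:R) / N%:R.
  by rewrite /node -!natr1; ring.
rewrite normrM (gtr0_norm (_ : 0 < N%:R^-1)) ?invr_gt0// ler_pdivrMr//.
rewrite mulrC ler_pdivlMr// mulrC -[X in X * _](gtr0_norm KR) -normrM mulrBr ler_norml.
by apply/andP; split; lra.
Qed.

(** A function of the index, constant on blocks, rather than of the block. Blocks may be empty when
    [K] exceeds [N], but the block of an index never is, so the quotient is always meaningful. *)
Definition bavg x i : R :=
  (\sum_(j | block j == block i) x j) / #|[pred j | block j == block i]|%:R.

Lemma block_card_gt0 i : 0 < #|[pred j | block j == block i]|%:R :> R.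
Proof. by rewrite ltr0n; apply/card_gt0P; exists i; rewrite inE. Qed.

Lemma bavg_block x i j : block i = block j -> bavg x i = bavg x j.
Proof. by rewrite /bavg => ->. Qed.

Lemma bavg_le x i B : (forall j, block j = block i -> x j <= B) -> bavg x i <= B.
Proof.
move=> xB; rewrite ler_pdivrMr ?block_card_gt0// mulr_natr -sumr_const.
by apply: ler_sum => j /eqP; exact: xB.
Qed.

Lemma bavg_ge x i B : (forall j, block j = block i -> B <= x j) -> B <= bavg x i.
Proof.
move=> xB; rewrite ler_pdivlMr ?block_card_gt0// mulr_natr -sumr_const.
by apply: ler_sum => j /eqP; exact: xB.
Qed.

Lemma sum_block (F : 'I_K -> R) x :
  \sum_i F (block i) * bavg x i = \sum_i F (block i) * x i.
Proof.
rewrite (partition_big block xpredT)//= [RHS](partition_big block xpredT)//=.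
apply: eq_bigr => a _.
have [/existsP[i /eqP ia]|/existsPn na] := boolP [exists i, block i == a].
  rewrite (eq_bigr (fun=> F a * bavg x i)); last first.
    by move=> j /eqP ja; rewrite ja (bavg_block x (_ : block j = block i)) // ja.
  rewrite [RHS](eq_bigr (fun j => F a * x j)); last by move=> j /eqP ->.
  rewrite -[LHS]mulr_sumr -[RHS]mulr_sumr sumr_const -(mulr_natr (bavg x i)); congr (F a * _).
  have nz : #|[pred j | block j == a]|%:R != 0 :> R.
    by rewrite gt_eqF// -ia; exact: block_card_gt0.
  by rewrite /bavg ia; exact: divfK.
by rewrite !big_pred0// => i; apply/negbTE.
Qed.

Lemma sum_bavg x : \sum_i bavg x i = \sum_i x i.
Proof.
transitivity (\sum_i 1 * bavg x i); first by apply: eq_bigr => i _; rewrite mul1r.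
by rewrite (sum_block (fun=> 1)); apply: eq_bigr => i _; rewrite mul1r.
Qed.

(** The vector [x - bavg x] is orthogonal to all functions constant on blocks, so [c] may be
    replaced by [c - bavg c], which is at most [w]. *)
Lemma block_osc c x (w M : R) : 0 <= w ->
  (forall i j, block i = block j -> `|c i - c j| <= w) ->
  (forall i, `|x i| <= M) ->
  `|\sum_i c i * (x i - bavg x i)| <= 2 * M * w * N%:R.
Proof.
move=> w0 cw xM.
have yM i : `|bavg x i| <= M.
  rewrite ler_norml; apply/andP; split.
    by apply: bavg_ge => j _; have := xM j; rewrite ler_norml => /andP[].
  by apply: bavg_le => j _; have := xM j; rewrite ler_norml => /andP[].
have bc i : `|c i - bavg c i| <= w.
  rewrite ler_distlC; apply/andP; split.
    by apply: bavg_ge => j ji; have := cw _ _ ji; rewrite ler_norml; lra.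
  by apply: bavg_le => j ji; have := cw _ _ ji; rewrite ler_norml; lra.
have e : \sum_i bavg c i * (x i - bavg x i) = 0.
  have F i : exists F, forall i, bavg c i = F (block i).
    exists (fun a => if [pick i | block i == a] is Some i then bavg c i else 0).
    move=> j; case: pickP => [k /eqP kj|/(_ j)]; last by rewrite eqxx.
    exact: bavg_block.
  have [F' FE] := F (Ordinal N0).
  under eq_bigr => i _ do rewrite FE mulrBr.
  by rewrite sumrB sum_block subrr.
have -> : \sum_i c i * (x i - bavg x i) =
    \sum_i (c i - bavg c i) * (x i - bavg x i).
  rewrite -[LHS]subr0 -[X in _ - X]e -sumrB.
  by apply: eq_bigr => i _; rewrite mulrBl.
rewrite (le_trans (ler_norm_sum _ _ _))//.
apply: (@le_trans _ _ (\sum_(i < N) w * (2 * M))).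
  apply: ler_sum => i _; rewrite normrM ler_pM//.
  by rewrite (le_trans (ler_normB _ _))//; have := xM i; have := yM i; lra.
rewrite sumr_const card_ord -[leLHS]mulr_natr.
by rewrite le_eqVlt; apply/orP; left; apply/eqP; ring.
Qed.

Variables (g : R * R * R -> R) (d M : R) (x : 'I_N -> R).
Local Notation Ag := (@grid_tensor R g N).
Hypotheses (d0 : 0 <= d) (M0 : 0 <= M) (xM : forall i, `|x i| <= M).
Hypothesis g_sym : symmetric3 g.
Hypothesis g_osc : forall i i' j (k : 'I_N), block i = block i' ->
  `|g (node R i, node R j, node R k) - g (node R i', node R j, node R k)| <= d.

Lemma grid_sym12 i j k : Ag i j k = Ag j i k.
Proof. by rewrite /grid_tensor (g_sym (cube_node R N0 i j k)).1. Qed.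

Lemma grid_sym23 i j k : Ag i j k = Ag i k j.
Proof. by rewrite /grid_tensor (g_sym (cube_node R N0 i j k)).2. Qed.

Let NR : 0 < N%:R :> R. Proof. by rewrite ltr0n. Qed.
Let N20 : 0 < N%:R ^- 2 :> R. Proof. by rewrite invr_gt0 exprn_gt0. Qed.

Lemma grid_osc i i' j k : block i = block i' ->
  `|Ag i j k - Ag i' j k| <= N%:R ^- 2 * d.
Proof.
move=> ii; rewrite /grid_tensor -mulrBr normrM (gtr0_norm N20).
by apply: ler_wpM2l; [exact: ltW|exact: g_osc].
Qed.

Lemma bavg_norm i : `|bavg x i| <= M.
Proof.
rewrite ler_norml; apply/andP; split.
  by apply: bavg_ge => j _; have := xM j; rewrite ler_norml => /andP[].
by apply: bavg_le => j _; have := xM j; rewrite ler_norml => /andP[].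
Qed.

Let row_osc (z : 'I_N -> R) i : (forall k, `|z k| <= M) ->
  forall j j', block j = block j' ->
  `|\sum_k Ag i j k * z k - \sum_k Ag i j' k * z k| <= d * M / N%:R.
Proof.
move=> zM j j' jj; rewrite -sumrB (le_trans (ler_norm_sum _ _ _))//.
apply: (@le_trans _ _ (\sum_(k < N) N%:R ^- 2 * d * M)).
  apply: ler_sum => k _; rewrite -mulrBl normrM ler_pM//.
  by rewrite !(grid_sym12 i) grid_osc.
rewrite sumr_const card_ord -[leLHS]mulr_natr.
by rewrite le_eqVlt; apply/orP; left; apply/eqP; field; rewrite gt_eqF.
Qed.

(** The two factors are averaged one after the other; each time the coefficients are row sums of the
    grid tensor, which oscillate by at most [d * M / N] within a block. *)
Lemma grid_field_block i :
  `|quad_field Ag x i - quad_field Ag (bavg x) i| <= 4 * d * M ^+ 2.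
Proof.
pose y := bavg x.
have -> : quad_field Ag x i - quad_field Ag y i =
    \sum_j (\sum_k Ag i j k * x k) * (x j - y j) +
    \sum_k (\sum_j Ag i k j * y j) * (x k - y k).
  have -> : \sum_k (\sum_j Ag i k j * y j) * (x k - y k) =
      \sum_j \sum_k Ag i j k * y j * (x k - y k).
    rewrite exchange_big/=; apply: eq_bigr => k _; rewrite mulr_suml.
    by apply: eq_bigr => j _; rewrite (grid_sym23 i).
  rewrite /quad_field -sumrB -big_split/=; apply: eq_bigr => j _.
  rewrite -sumrB mulr_suml -big_split/=; apply: eq_bigr => k _; ring.
have q0 : 0 <= d * M / N%:R by rewrite divr_ge0 ?(ltW NR)// mulr_ge0.
have h1 := block_osc q0 (row_osc i xM) xM.
have h2 := block_osc q0 (row_osc i bavg_norm) xM.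
apply: (le_trans (ler_normD _ _)); apply: (le_trans (lerD h1 h2)).
by rewrite le_eqVlt; apply/orP; left; apply/eqP; field; rewrite gt_eqF.
Qed.

Lemma grid_cubic_block :
  `|\sum_i x i * quad_field Ag x i - \sum_i bavg x i * quad_field Ag (bavg x) i| <=
  6 * d * M ^+ 3 * N%:R.
Proof.
pose y := bavg x.
have -> : \sum_i x i * quad_field Ag x i - \sum_i y i * quad_field Ag y i =
    \sum_i x i * (quad_field Ag x i - quad_field Ag y i) +
    \sum_i quad_field Ag y i * (x i - y i).
  by rewrite -sumrB -big_split/=; apply: eq_bigr => i _; ring.
have h1 : `|\sum_i x i * (quad_field Ag x i - quad_field Ag y i)| <=
    4 * d * M ^+ 3 * N%:R.
  apply: (le_trans (ler_norm_sum _ _ _)).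
  apply: (@le_trans _ _ (\sum_(i < N) M * (4 * d * M ^+ 2))).
    by apply: ler_sum => i _; rewrite normrM ler_pM// grid_field_block.
  rewrite sumr_const card_ord -[leLHS]mulr_natr.
  by rewrite le_eqVlt; apply/orP; left; apply/eqP; ring.
have q0 : 0 <= d * M ^+ 2 by rewrite mulr_ge0 ?exprn_ge0.
have osc i i' : block i = block i' ->
    `|quad_field Ag y i - quad_field Ag y i'| <= d * M ^+ 2.
  move=> ii; rewrite /quad_field -sumrB (le_trans (ler_norm_sum _ _ _))//.
  apply: (@le_trans _ _ (\sum_(j < N) \sum_(k < N) N%:R ^- 2 * d * (M * M))).
    apply: ler_sum => j _; rewrite -sumrB (le_trans (ler_norm_sum _ _ _))//.
    apply: ler_sum => k _; rewrite -!mulrBl -mulrA normrM [X in _ * X]normrM.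
    apply: ler_pM => //; first exact: grid_osc.
    by apply: ler_pM => //; exact: bavg_norm.
  rewrite !sumr_const card_ord -mulrnA -[leLHS]mulr_natr natrM.
  by rewrite le_eqVlt; apply/orP; left; apply/eqP; field; rewrite gt_eqF.
have h2 := block_osc q0 osc xM.
apply: (le_trans (ler_normD _ _)); apply: (le_trans (lerD h1 h2)).
by rewrite le_eqVlt; apply/orP; left; apply/eqP; ring.
Qed.

End blocks.

(** * The mean-field variational problem *)

Section variational.
Context (R : realType) (km kp : R) (mu : probability (measurableTypeR R) R).
Hypothesis mu_on : mu [set` `[km, kp]] = 1%E.
Hypothesis km_supp : supp mu km.
Hypothesis kp_supp : supp mu kp.
Hypothesis mu_nonneg : stochastically_nonneg mu.
Local Notation M := (`|km| + `|kp|).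
Local Notation t := (tmean km kp mu).
Local Notation L := (Lambda mu).
Variables (p h : R).

Definition energy (z : R) : R := p * z ^+ 3 + h * z.
(** The subtracted term is the relative entropy of the tilted law with respect to [mu], which is the
    rate at its mean [t l]. *)
Definition tilt_value (l : R) : R := energy (t l) - (l * t l - L l).
(* The mean-field value of the limit of [N^-1 * ln Z_N]. *)
Definition pressure : R := sup (range tilt_value).

Lemma energy_lip a b : `|a| <= M -> `|b| <= M ->
  `|energy a - energy b| <= (3 * `|p| * M ^+ 2 + `|h|) * `|a - b|.
Proof.
move=> aM bM; have M0 : 0 <= M by rewrite addr_ge0.
have -> : energy a - energy b = (p * (a * a + a * b + b * b) + h) * (a - b).
  by rewrite /energy; ring.
rewrite normrM ler_wpM2r// (le_trans (ler_normD _ _))// lerD2r normrM.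
rewrite -mulrA mulrCA ler_wpM2l//.
have -> : 3 * M ^+ 2 = M * M + M * M + M * M by ring.
have nM c e : `|c| <= M -> `|e| <= M -> `|c * e| <= M * M.
  by move=> cM eM; rewrite normrM ler_pM.
apply: (le_trans (ler_normD _ _)); apply: lerD; last exact: nM.
by apply: (le_trans (ler_normD _ _)); apply: lerD; exact: nM.
Qed.

Lemma energy_norm a : `|a| <= M -> `|energy a| <= `|p| * M ^+ 3 + `|h| * M.
Proof.
move=> aM; have M0 : 0 <= M by rewrite addr_ge0.
rewrite /energy (le_trans (ler_normD _ _))//; apply: lerD; rewrite normrM ler_wpM2l//.
by rewrite normrX ler_pXn2r ?nnegrE.
Qed.

Lemma tilt_value_ub : has_ubound (range tilt_value).
Proof.
exists (`|p| * M ^+ 3 + `|h| * M) => _ [l _ <-]; rewrite /tilt_value.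
have := Lambda_tangent mu_on l 0; rewrite (Lambda_0 mu_on) sub0r => h1.
have := energy_norm (tmean_norm mu_on l); rewrite ler_norml => /andP[_].
by move: h1; rewrite sub0r mulrN lerN2 (mulrC l); set a := L l; lra.
Qed.

Lemma tilt_value_le l : tilt_value l <= pressure.
Proof. by apply: ub_le_sup; [exact: tilt_value_ub|exists l]. Qed.

Lemma pressure_approx e : 0 < e -> exists l, pressure - e <= tilt_value l.
Proof.
move=> e0; have hs : has_sup (range tilt_value).
  by split; [exists (tilt_value 0); exists 0|exact: tilt_value_ub].
have [_ [l _ <-] /ltW le] := sup_adherent e0 hs; by exists l.
Qed.

(** Only an approximation, since an end point of the interval need not be a tilted mean. The sign
    condition ensures that replacing [t l] by [z] in [l * t l - L l] can only increase the
    entropy. *)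
Lemma tmean_approx z d : km <= z <= kp -> 0 < d ->
  exists l, `|z - t l| <= d /\ 0 <= l * (z - t l).
Proof.
move=> /andP[z1 z2] d0.
have [lp lp0 lpd] := tmean_endpoint mu_on (expr1n R 2) kp_supp d0.
have s2 : (-1) ^+ 2 = 1 :> R by rewrite sqrrN expr1n.
have [lm lm0 lmd] := tmean_endpoint mu_on s2 km_supp d0.
rewrite !mul1r in lp0 lpd; rewrite !mulN1r in lm0 lmd.
have [h1|h1] := leP (t lp) z.
  exists lp; split; last by rewrite mulr_ge0// subr_ge0.
  by rewrite ger0_norm ?subr_ge0//; move: lpd; set a := t lp; lra.
have [h2|h2] := leP z (t lm).
  exists lm; split; last by rewrite mulr_le0// ?subr_le0//; lra.
  by rewrite ler0_norm ?subr_le0//; move: lmd; set a := t lm; lra.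
have lmp : lm <= lp by lra.
have [l _ tl] : exists2 c, c \in `[lm, lp]%R & t c = z.
  apply: IVT => //; first exact/continuous_subspaceT/tmean_continuous.
  rewrite min_l ?max_r; try exact: ltW (lt_trans h2 h1).
  by rewrite !ltW.
by exists l; rewrite tl subrr normr0 mulr0 lexx ltW.
Qed.

Lemma rate_step_ge0 z e : km <= z <= kp -> 0 < e ->
  exists l, energy z - (l * z - L l) <= pressure + e.
Proof.
move=> zI e0; pose C := 3 * `|p| * M ^+ 2 + `|h| + 1.
have M0 : 0 <= M by rewrite addr_ge0.
have C0 : 0 < C by rewrite ltr_wpDl// addr_ge0// mulr_ge0 ?exprn_ge0// mulr_ge0.
have [l [l1 l2]] := tmean_approx zI (divr_gt0 e0 C0); exists l.
have zM : `|z| <= M by apply: norm_itv; rewrite /= in_itv.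
have := energy_lip zM (tmean_norm mu_on l) => el.
have : `|energy z - energy (t l)| <= e.
  apply: (le_trans el); apply: (@le_trans _ _ (C * (e / C))).
    apply: (@le_trans _ _ (C * `|z - t l|)); first by rewrite ler_wpM2r// lerDl.
    by rewrite ler_wpM2l// ltW.
  by rewrite mulrC divfK// gt_eqF.
rewrite ler_norml => /andP[_ h1].
have := tilt_value_le l; rewrite /tilt_value; move: l2; rewrite mulrBr.
move: h1; set a := l * z; set b := l * t l; set c := L l.
set u := energy z; set v := energy (t l); lra.
Qed.

(* For [z < 0] the sign may be dropped in the energy because, by stochastic
   non-negativity, the entropy cost at [z] is at least that at [- z]. *)
Lemma rate_step z e : km <= z <= kp -> 0 < e ->
  exists l, energy `|z| - (l * z - L l) <= pressure + e.
Proof.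
move=> zI e0; have [z0|z0] := leP 0 z.
  by rewrite ger0_norm//; exact: rate_step_ge0.
rewrite ltr0_norm//; apply: contrapT => /forallNP none.
(* If no tilt works, the rate at [z] is at most [C], hence so is the rate at [- z]. For [- z <= kp]
   this contradicts [rate_step_ge0] at [- z]. *)
pose C := energy (- z) - pressure - e.
have lt1 l : l * z - L l <= C.
  by have /negP := none l; rewrite -ltNge /C; set a := l * z; set b := L l; lra.
have lt2 l : l * - z - L l <= C.
  rewrite -lee_fin; apply: (@le_trans _ _ (rate mu (- z))).
    by apply: ereal_sup_ubound; exists l.
  have := mu_nonneg (_ : 0 <= - z); rewrite opprK => h1.
  apply: (le_trans (h1 _)); first by rewrite oppr_ge0 ltW.
  by apply: ge_ereal_sup => _ [l' _ <-]; rewrite lee_fin.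
case/andP: zI => zm zp; have [zk|zk] := leP (- z) kp.
  have zI' : km <= - z <= kp by rewrite zk andbT; lra.
  have [l] := rate_step_ge0 zI' (divr_gt0 e0 (ltr0Sn R 1)).
  have := lt2 l; rewrite /C; set a := l * _; set b := L l; lra.
(* For [- z > kp] the rate at [- z] is infinite: [L l <= l * kp] for [l >= 0], so this tilt already
   yields a value above [C]. *)
pose l := (`|C| + 1) / (- z - kp).
have dz : 0 < - z - kp by rewrite subr_gt0.
have l0 : 0 <= l by rewrite divr_ge0 ?(ltW dz)// addr_ge0.
have := Lambda_tangent mu_on l 0; rewrite (Lambda_0 mu_on) !sub0r mulrN lerN2 => h1.
have /andP[_ tk] : km <= t l <= kp by have := tmean_itv mu_on l; rewrite /= in_itv.
have h2 : L l <= l * kp by rewrite (le_trans h1)// mulrC ler_wpM2l.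
have := lt2 l; rewrite leNgt => /negP; apply.
apply: (@lt_le_trans _ _ (l * (- z - kp))).
  rewrite /l divfK ?gt_eqF//; have := ler_norm C; lra.
by rewrite mulrBr lerD2l lerN2.
Qed.

Lemma energy_continuous : continuous energy.
Proof.
move=> z; apply: cvgD; apply: cvgM; try exact: cvg_cst; last exact: cvg_id.
exact: exprn_continuous.
Qed.

(** For a fixed tilt the inequality is an open condition on [z], so compactness of the interval
    extracts finitely many tilts. Applying [rate_step] with [e / 2] gives the strict inequality
    needed for openness. *)
Lemma rate_net e : 0 < e -> exists s : seq R, forall z, km <= z <= kp ->
  exists2 l, l \in s & energy `|z| - (l * z - L l) <= pressure + e.
Proof.
move=> e0; have e2 : 0 < e / 2 by rewrite divr_gt0.
have := @segment_compact R km kp; rewrite compact_cover.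
pose U (l : R) : set R :=
  (fun z => energy `|z| - (l * z - L l)) @^-1` [set y | y < pressure + e].
move=> /(_ R setT U) [| |D _ Dcov].
- move=> l _; apply: open_comp; last exact: open_lt.
  move=> z _; apply: cvgB.
    apply: (@cvg_comp _ _ _ (fun z : R => `|z|) energy); last exact: energy_continuous.
    exact: norm_continuous.
  by apply: cvgB; [apply: cvgM; [exact: cvg_cst|exact: cvg_id]|exact: cvg_cst].
- move=> z; rewrite /= in_itv/= => zI; have [l hl] := rate_step zI e2.
  by exists l => //; apply: (le_lt_trans hl); rewrite ltrD2l ltr_pdivrMr// ltr_pMr// ltr1n.
exists (finmap.enum_fset D) => z zI.
have [|l /= lD hl] := Dcov z; first by rewrite /= in_itv.
by exists l; [exact: lD|exact: ltW].
Qed.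

End variational.

(** * The energy deficit of non-constant configurations *)

Section deficit.
Context (R : realType).

(** [a ^ 3 + b ^ 3 + c ^ 3 - 3 * a * b * c] is half of [a + b + c] times the sum of the squared
    differences; only [(a + b) * (a - b) ^ 2] is kept, which is at least [|a - b| ^ 3]. *)
Lemma amgm3_deficit (a b c : R) : 0 <= a -> 0 <= b -> 0 <= c ->
  a * b * c <= (a ^+ 3 + b ^+ 3 + c ^+ 3) / 3 - `|a - b| ^+ 3 / 6.
Proof.
move=> a0 b0 c0; have h1 : `|a - b| ^+ 3 <= (a + b) * (a - b) ^+ 2.
  rewrite exprS real_normK ?num_real// ler_wpM2r ?sqr_ge0//.
  by rewrite ler_norml; apply/andP; split; lra.
have h2 : 0 <= (a + b) * ((b - c) ^+ 2 + (a - c) ^+ 2) +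
    c * ((a - b) ^+ 2 + (b - c) ^+ 2 + (a - c) ^+ 2).
  by rewrite addr_ge0// mulr_ge0// ?addr_ge0// ?sqr_ge0.
move: h1 h2; set z := `|a - b| ^+ 3.
have e : a ^+ 3 + b ^+ 3 + c ^+ 3 - 3 * (a * b * c) =
   ((a + b) * (a - b) ^+ 2 + ((a + b) * ((b - c) ^+ 2 + (a - c) ^+ 2) +
    c * ((a - b) ^+ 2 + (b - c) ^+ 2 + (a - c) ^+ 2))) / 2 by field.
move: e; set u := (a + b) * (a - b) ^+ 2; set v := (a + b) * _ + _.
set s := a * b * c; set q := a ^+ 3 + _ + _; lra.
Qed.

Variable N : nat.
Hypothesis N0 : (0 < N)%N.
Let NR : 0 < N%:R :> R. Proof. by rewrite ltr0n. Qed.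
Let N20 : 0 < N%:R ^- 2 :> R. Proof. by rewrite invr_gt0 exprn_gt0. Qed.
Variables (y : 'I_N -> R) (M : R).
Hypotheses (M0 : 0 <= M) (yM : forall i, `|y i| <= M).

Definition gap_sum q : R := avg (fun i => avg (fun j => `| `|y i| - `|y j| | ^+ q)).
Definition negative_part : R := avg (fun i => `|y i| - y i).
(** Centred at the mean of the absolute values, so that negative entries and unequal absolute values
    both count, and can be charged separately to [negative_part] and [gap_sum]. *)
Definition spread : R := avg (fun i => `|y i - avg (fun j => `|y j|)|).

Lemma spread_le : spread <= negative_part + gap_sum 1.
Proof.
rewrite -avgD; apply: le_avg => i; set c := avg _.
have h1 : `| `|y i| - c| <= avg (fun j => `| `|y i| - `|y j| | ^+ 1).
  have -> : `|y i| - c = avg (fun j => `|y i| - `|y j|).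
    rewrite (eq_avg (v := fun j => `|y i| + (- 1) * `|y j|)).
      by rewrite avgD avgZ avg_cst// mulN1r.
    by move=> j; rewrite mulN1r.
  exact: norm_avg.
have h2 := ler_distD `|y i| (y i) c.
have h3 : `|y i - `|y i| | = `|y i| - y i.
  by rewrite distrC ger0_norm// subr_ge0 ler_norm.
by rewrite h3 in h2; apply: (le_trans h2); rewrite lerD2l.
Qed.

Lemma gap_young r : 0 < r -> gap_sum 1 <= r + gap_sum 3 / r ^+ 2.
Proof.
move=> r0; rewrite -[X in X + _](avg_cst N0) mulrC -avgZ -avgD.
apply: le_avg => i; rewrite -[X in X + _](avg_cst N0) -avgZ -avgD.
apply: le_avg => j; set d := `|_ - _|; have d0 : 0 <= d by exact: normr_ge0.
have [dr|rd] := leP d r.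
  rewrite expr1 (le_trans dr)// lerDl mulr_ge0 ?exprn_ge0// invr_ge0.
  by rewrite exprn_ge0// ltW.
rewrite expr1 (@le_trans _ _ ((r ^+ 2)^-1 * d ^+ 3))// ?lerDr ?(ltW r0)//.
rewrite ler_pdivlMl ?exprn_gt0// (exprSr d 2) ler_wpM2r//.
by rewrite ler_pXn2r ?nnegrE// ltW.
Qed.

Lemma gap_sum_ge0 q : 0 <= gap_sum q.
Proof. by apply: avg_ge0 => i; apply: avg_ge0 => j; rewrite exprn_ge0. Qed.

Lemma negative_part_ge0 : 0 <= negative_part.
Proof. by apply: avg_ge0 => i; rewrite subr_ge0 ler_norm. Qed.

Lemma spread_ub : spread <= 2 * M.
Proof.
rewrite -[leRHS](avg_cst N0); apply: le_avg => i.
rewrite (le_trans (ler_normB _ _))//; have := yM i.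
have c0 : 0 <= avg (fun j => `|y j|) by apply: avg_ge0 => j.
have : avg (fun j => `|y j|) <= M.
  by rewrite -[leRHS](avg_cst N0); apply: le_avg.
by rewrite (ger0_norm c0); lra.
Qed.

Variables (g : R * R * R -> R) (gam c0 w : R).
Local Notation Ag := (@grid_tensor R g N).
Hypotheses (g_sym : symmetric3 g) (gam0 : 0 <= gam)
  (g_gam : forall p, cube p -> gam <= g p)
  (deg_c0 : forall i : 'I_N, `|\sum_j \sum_k Ag i j k - c0| <= w).

Let Agam i j k : N%:R ^- 2 * gam <= Ag i j k.
Proof. by rewrite /grid_tensor ler_wpM2l ?(ltW N20)// g_gam//; exact: cube_node. Qed.

Let Age0 i j k : 0 <= Ag i j k.
Proof. by apply: le_trans (Agam i j k); rewrite mulr_ge0// ltW. Qed.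

(** AM-GM is applied to each triple. By symmetry the three cubes sum to the same quantity, weighted
    by the nearly constant degrees, while each deficit carries a weight at least [gam / N ^ 2]. *)
Lemma cubic_deficit :
  \sum_i y i * quad_field Ag y i <=
  N%:R * (avg (fun i => c0 * `|y i| ^+ 3) + w * M ^+ 3 - gam / 6 * gap_sum 3).
Proof.
pose a i := `|y i|.
have a0 i : 0 <= a i by exact: normr_ge0.
pose S1 := \sum_i \sum_j \sum_k Ag i j k * a i ^+ 3.
have S2E : \sum_i \sum_j \sum_k Ag i j k * a j ^+ 3 = S1.
  rewrite exchange_big/=; apply: eq_bigr => i _; apply: eq_bigr => j _.
  by apply: eq_bigr => k _; rewrite (grid_sym12 N0 g_sym).
have S3E : \sum_i \sum_j \sum_k Ag i j k * a k ^+ 3 = S1.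
  rewrite -S2E; apply: eq_bigr => i _; rewrite exchange_big/=.
  by apply: eq_bigr => j _; apply: eq_bigr => k _; rewrite (grid_sym23 N0 g_sym).
have step1 : \sum_i y i * quad_field Ag y i <= \sum_i \sum_j \sum_k
    (3^-1 * (Ag i j k * a i ^+ 3) + 3^-1 * (Ag i j k * a j ^+ 3) +
     3^-1 * (Ag i j k * a k ^+ 3) - N%:R ^- 2 * (gam / 6) * `|a i - a j| ^+ 3).
  apply: ler_sum => i _; rewrite /quad_field mulr_sumr; apply: ler_sum => j _.
  rewrite mulr_sumr; apply: ler_sum => k _.
  have h1 : y i * (Ag i j k * y j * y k) <= Ag i j k * (a i * a j * a k).
    have -> : y i * (Ag i j k * y j * y k) = Ag i j k * (y i * y j * y k) by ring.
    by rewrite ler_wpM2l// /a -!normrM ler_norm.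
  apply: (le_trans h1); have h2 := amgm3_deficit (a0 i) (a0 j) (a0 k).
  apply: (le_trans (ler_wpM2l (Age0 i j k) h2)).
  have h3 : N%:R ^- 2 * gam * (`|a i - a j| ^+ 3 / 6) <=
      Ag i j k * (`|a i - a j| ^+ 3 / 6).
    by rewrite ler_wpM2r// divr_ge0// exprn_ge0.
  have -> : N%:R ^- 2 * (gam / 6) * `|a i - a j| ^+ 3 =
    N%:R ^- 2 * gam * (`|a i - a j| ^+ 3 / 6) by ring.
  rewrite mulrBr; move: h3; set u := _ * (_ / 6); set v := _ * (_ / 6) => h3.
  have -> : Ag i j k * ((a i ^+ 3 + a j ^+ 3 + a k ^+ 3) / 3) =
    3^-1 * (Ag i j k * a i ^+ 3) + 3^-1 * (Ag i j k * a j ^+ 3) +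
     3^-1 * (Ag i j k * a k ^+ 3) by ring.
  by rewrite lerD2l lerN2.
apply: (le_trans step1).
have -> : \sum_i \sum_j \sum_k
    (3^-1 * (Ag i j k * a i ^+ 3) + 3^-1 * (Ag i j k * a j ^+ 3) +
     3^-1 * (Ag i j k * a k ^+ 3) - N%:R ^- 2 * (gam / 6) * `|a i - a j| ^+ 3) =
    3^-1 * S1 + 3^-1 * S1 + 3^-1 * S1 - N%:R * (gam / 6 * gap_sum 3).
  rewrite -[X in 3^-1 * S1 + 3^-1 * X + _ - _]S2E -[X in _ + 3^-1 * X - _]S3E.
  have -> : N%:R * (gam / 6 * gap_sum 3) =
     \sum_i \sum_j \sum_(k < N) N%:R ^- 2 * (gam / 6) * `|a i - a j| ^+ 3.
    transitivity (N%:R ^- 1 * (gam / 6) * \sum_i \sum_j `|a i - a j| ^+ 3).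
      rewrite /gap_sum /avg -mulr_sumr; field; by rewrite gt_eqF.
    rewrite mulr_sumr; apply: eq_bigr => i _; rewrite mulr_sumr.
    apply: eq_bigr => j _; rewrite sumr_const card_ord -[RHS]mulr_natl.
    by field; rewrite gt_eqF.
  rewrite /S1 !mulr_sumr -!big_split/= -sumrB; apply: eq_bigr => i _.
  rewrite !mulr_sumr -!big_split/= -sumrB; apply: eq_bigr => j _.
  by rewrite !mulr_sumr -!big_split/= -sumrB.
have S1le : S1 <= N%:R * (avg (fun i => c0 * a i ^+ 3) + w * M ^+ 3).
  have -> : N%:R * (avg (fun i => c0 * a i ^+ 3) + w * M ^+ 3) =
      \sum_i (c0 * a i ^+ 3 + w * M ^+ 3).
    rewrite big_split/= mulrDr /avg mulVKf ?gt_eqF//.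
    by rewrite sumr_const card_ord -(mulr_natl (w * _)).
  apply: ler_sum => i _; have := deg_c0 i; rewrite ler_norml => /andP[_ h1].
  have -> : \sum_j \sum_k Ag i j k * a i ^+ 3 = (\sum_j \sum_k Ag i j k) * a i ^+ 3.
    by rewrite mulr_suml; apply: eq_bigr => j _; rewrite mulr_suml.
  have w0 : 0 <= w := le_trans (normr_ge0 _) (deg_c0 i).
  apply: (@le_trans _ _ ((c0 + w) * a i ^+ 3)).
    by rewrite ler_wpM2r ?exprn_ge0//; lra.
  rewrite mulrDl lerD2l ler_wpM2l// ler_pXn2r ?nnegrE//.
  exact: yM.
rewrite mulrBr; have -> : 3^-1 * S1 + 3^-1 * S1 + 3^-1 * S1 = S1 by field.
by rewrite lerD2r.
Qed.

Hypothesis g_le1 : forall p, cube p -> g p <= 1.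
Local Notation c := (avg (fun j => `|y j|)).

Let c_itv : 0 <= c <= M.
Proof.
apply/andP; split; first by apply: avg_ge0 => j.
by rewrite -[leRHS](avg_cst N0); apply: le_avg.
Qed.

Lemma grid_field_near_const i :
  `|quad_field Ag y i - c ^+ 2 * \sum_j \sum_k Ag i j k| <= 2 * M * spread.
Proof.
have /andP[c0' cM] := c_itv.
rewrite /quad_field mulr_sumr -sumrB (le_trans (ler_norm_sum _ _ _))//.
apply: (@le_trans _ _ (\sum_j \sum_k
   (N%:R ^- 2 * M * `|y k - c| + N%:R ^- 2 * M * `|y j - c|))).
  apply: ler_sum => j _; rewrite mulr_sumr -sumrB (le_trans (ler_norm_sum _ _ _))//.
  apply: ler_sum => k _.
  have -> : Ag i j k * y j * y k - c ^+ 2 * Ag i j k =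
    Ag i j k * (y j * (y k - c) + c * (y j - c)) by ring.
  have -> : N%:R ^- 2 * M * `|y k - c| + N%:R ^- 2 * M * `|y j - c| =
    N%:R ^- 2 * (M * `|y k - c| + M * `|y j - c|) by ring.
  rewrite normrM (ger0_norm (Age0 _ _ _)).
  apply: ler_pM => //.
    rewrite /grid_tensor -[leRHS]mulr1 ler_wpM2l ?(ltW N20)// g_le1//.
    exact: cube_node.
  apply: (le_trans (ler_normD _ _)); rewrite normrM [X in _ + X]normrM.
  by rewrite (ger0_norm c0'); apply: lerD; apply: ler_wpM2r.
have double_sum (u : 'I_N -> R) :
    \sum_j \sum_k (N%:R ^- 2 * M * u k + N%:R ^- 2 * M * u j) = 2 * M * avg u.
  have uE : \sum_j u j = N%:R * avg u by rewrite /avg mulVKf// gt_eqF.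
  transitivity (\sum_(j < N) (N%:R ^- 1 * M * avg u + N%:R ^- 1 * M * u j)).
    apply: eq_bigr => j _; rewrite big_split/= -mulr_sumr uE sumr_const card_ord.
    congr (_ + _); first by field; rewrite gt_eqF.
    by rewrite -[LHS]mulr_natl; field; rewrite gt_eqF.
  rewrite big_split/= sumr_const card_ord -mulr_sumr uE.
  by rewrite -(mulr_natl (N%:R ^- 1 * M * avg u)); field; rewrite gt_eqF.
by rewrite (double_sum (fun j => `|y j - c|)).
Qed.

(** The variance is at most the mean square about [c0 * c ^ 2], the value of the field if [y] were
    constantly [c] and the degrees [c0]. Four errors separate [m] from it; the one due to the spread
    is quadratic, and one factor is bounded by [2 * M]. *)
Lemma field_variance (m mg : 'I_N -> R) (e1 e2 : R) :
  avg (fun i => (m i - mg i) ^+ 2) <= e1 ->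
  (forall i, `|mg i - quad_field Ag y i| <= e2) ->
  avg (fun i => (m i - avg m) ^+ 2) <=
  4 * (e1 + e2 ^+ 2 + M ^+ 4 * w ^+ 2) + 32 * M ^+ 3 * spread.
Proof.
move=> h1 h2; have /andP[c0' cM] := c_itv.
have sp0 : 0 <= spread by apply: avg_ge0 => i.
apply: (le_trans (variance_le N0 m (c0 * c ^+ 2))).
apply: (@le_trans _ _ (4 * avg (fun i => (m i - mg i) ^+ 2) +
   (4 * (e2 ^+ 2 + M ^+ 4 * w ^+ 2) + 32 * M ^+ 3 * spread))); last by lra.
rewrite -[X in _ + X](avg_cst N0) -avgZ -avgD; apply: le_avg => i.
set q := quad_field Ag y i; set D := \sum_j \sum_k Ag i j k.
have a2 : (mg i - q) ^+ 2 <= e2 ^+ 2.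
  rewrite -(real_normK (num_real (_ - _))) ler_pXn2r ?nnegrE//.
  exact: le_trans (normr_ge0 _) (h2 i).
have a3 : (q - c ^+ 2 * D) ^+ 2 <= 8 * M ^+ 3 * spread.
  have := grid_field_near_const i; rewrite -/q -/D => h3.
  have ms0 : 0 <= 2 * M * spread by apply: mulr_ge0 => //; apply: mulr_ge0.
  apply: (@le_trans _ _ ((2 * M * spread) ^+ 2)).
    by rewrite -(real_normK (num_real (_ - _))) ler_pXn2r ?nnegrE.
  have -> : (2 * M * spread) ^+ 2 = 4 * M ^+ 2 * spread * spread by ring.
  have -> : 8 * M ^+ 3 * spread = 4 * M ^+ 2 * spread * (2 * M) by ring.
  apply: ler_wpM2l; last exact: spread_ub.
  by apply: mulr_ge0 => //; apply: mulr_ge0 => //; apply: exprn_ge0.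
have a4 : (c ^+ 2 * (D - c0)) ^+ 2 <= M ^+ 4 * w ^+ 2.
  have -> : M ^+ 4 * w ^+ 2 = (M ^+ 2 * w) ^+ 2 by ring.
  have w0 : 0 <= w := le_trans (normr_ge0 _) (deg_c0 i).
  rewrite -(real_normK (num_real (_ * _))) ler_pXn2r ?nnegrE ?mulr_ge0 ?exprn_ge0//.
  rewrite normrM ler_pM//; last exact: deg_c0.
  by rewrite ger0_norm ?exprn_ge0// ler_pXn2r ?nnegrE.
have -> : m i - c0 * c ^+ 2 = (m i - mg i) + (mg i - q) + (q - c ^+ 2 * D) +
  c ^+ 2 * (D - c0) by ring.
move: a2 a3 a4; set z1 := m i - mg i; set z2 := mg i - q; set z3 := q - _.
set z4 := c ^+ 2 * _ => a2 a3 a4.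
have : (z1 + z2 + z3 + z4) ^+ 2 <= 4 * (z1 ^+ 2 + z2 ^+ 2 + z3 ^+ 2 + z4 ^+ 2).
  have := sqr_ge0 (z1 - z2); have := sqr_ge0 (z1 - z3); have := sqr_ge0 (z1 - z4).
  have := sqr_ge0 (z2 - z3); have := sqr_ge0 (z2 - z4); have := sqr_ge0 (z3 - z4).
  have -> : (z1 + z2 + z3 + z4) ^+ 2 = z1 ^+ 2 + z2 ^+ 2 + z3 ^+ 2 + z4 ^+ 2 +
    2 * (z1 * z2) + 2 * (z1 * z3) + 2 * (z1 * z4) + 2 * (z2 * z3) +
    2 * (z2 * z4) + 2 * (z3 * z4) by ring.
  by rewrite !sqrrB !mulr2n; lra.
move=> h5; apply: (le_trans h5).
have -> : 32 * M ^+ 3 * spread = 4 * (8 * M ^+ 3 * spread) by ring.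
by move: a2 a3 a4; set y2 := 8 * _ * _; lra.
Qed.

End deficit.

Section gap_bound.
Context (R : realType) (km kp : R).

(* A large spread of the block magnetizations [y] comes either from negative
   ones, which [h] penalizes, or from distinct absolute values, which cost an
   AM-GM deficit in the cubic energy. *)
Lemma deficit_lb (W0 k h : R) : 0 < W0 -> 0 < k -> 0 <= h -> 0 < h \/ 0 <= km ->
  exists2 D0, 0 < D0 & forall N (y : 'I_N -> R), (0 < N)%N ->
    (forall i, km <= y i <= kp) -> W0 <= spread y ->
    D0 <= k * gap_sum y 3 + h * negative_part y.
Proof.
(* If [gap_sum y 1] carries half of [W0], Young's inequality with this [r] leaves [W0 / 4 = r] for
   [gap_sum y 3 / r ^+ 2]. *)
move=> W00 k0 h0 hk; have [r rE] : exists r, r = W0 / 4 by exists (W0 / 4).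
have r0 : 0 < r by rewrite rE divr_gt0.
have gap3 N (y : 'I_N -> R) : (0 < N)%N -> W0 / 2 <= gap_sum y 1 ->
    r ^+ 3 <= gap_sum y 3.
  move=> N0 h1; have := gap_young N0 y r0.
  have -> : r ^+ 3 = r * r ^+ 2 by ring.
  rewrite -(ler_pdivlMr _ _ (exprn_gt0 2 r0)) => h2.
  by move: h1 h2; set u := gap_sum y 3 / _; set v := gap_sum y 1; lra.
have kr : 0 < k * r ^+ 3 by rewrite mulr_gt0// exprn_gt0.
case: hk => [hp|km0].
  exists (Num.min (h * (W0 / 2)) (k * r ^+ 3)).
    by rewrite lt_min kr mulr_gt0// divr_gt0.
  move=> N y N0 yI Wy; have sl := spread_le N0 y.
  have g0 := gap_sum_ge0 y 3; have n0 := negative_part_ge0 y.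
  have [h1|h1] := leP (W0 / 2) (negative_part y).
    rewrite ge_min; apply/orP; left.
    apply: (@le_trans _ _ (h * negative_part y)); first by rewrite ler_wpM2l.
    by rewrite lerDr mulr_ge0// ltW.
  rewrite ge_min; apply/orP; right.
  apply: (@le_trans _ _ (k * gap_sum y 3)).
    by rewrite ler_wpM2l ?(ltW k0)// gap3//; lra.
  by rewrite lerDl mulr_ge0.
exists (k * r ^+ 3) => // N y N0 yI Wy; have sl := spread_le N0 y.
have n0 : negative_part y = 0.
  rewrite /negative_part (eq_avg (v := fun=> 0)) ?avg_cst// => i.
  have /andP[yk _] := yI i; rewrite ger0_norm ?subrr//; lra.
rewrite n0 mulr0 addr0 ler_wpM2l ?(ltW k0)// gap3//.
by rewrite n0 in sl; lra.
Qed.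

End gap_bound.

(** * Product tilts *)

Section tilting.
Context (R : realType) (km kp : R) (mu : probability (measurableTypeR R) R).
Hypothesis km_lt_kp : km < kp.
Hypothesis mu_on : mu [set` `[km, kp]] = 1%E.
Local Notation T := (measurableTypeR R).
Local Notation I := ([set` `[km, kp]] : set T).
Local Notation M := (`|km| + `|kp|).
Local Notation E1 := (expect1 km kp mu).
Local Notation EN := (@expectN R km kp mu _).
Local Notation t := (tmean km kp mu).
Local Notation L := (Lambda mu).
Context (N : nat).
Local Notation bmN := (bmeas (@box R km kp N)).
Local Notation bx := (@box R km kp N).
Implicit Types (x : N.-tuple T) (i j k : 'I_N).

Lemma EN_tilt (th : 'I_N -> R) :
  EN (fun x : N.-tuple T => expR (\sum_i (th i * tnth x i - L (th i)))) = 1.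
Proof.
have bth l : bmeas I (fun z : T => expR (l * z - L l)).
  apply: bmeas_expR; apply: bmeasB; last exact: bmeas_cst.
  by apply: bmeasM; [exact: bmeas_cst|exact: bmeas_id].
transitivity (EN (fun x : N.-tuple T =>
    \prod_(i < N) (fun z => expR (th i * z - L (th i))) (tnth x i))).
  by apply: eq_expect => x _; rewrite expR_sum.
rewrite (EN_prod mu_on (f := fun i z => expR (th i * z - L (th i))))//.
apply: big1 => i _.
have be : bmeas I (fun z : T => expR (th i * z)).
  by apply: bmeas_expR; apply: bmeasM; [exact: bmeas_cst|exact: bmeas_id].
transitivity (E1 (fun z => expR (th i * z)) * expR (- L (th i))).
  rewrite /expect1 -expectZr//.
  by apply: eq_expect => z _; rewrite expRD.
rewrite -moment0E -(expR_Lambda mu_on) -expRD subrr expR0//.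
Qed.

Variable (A : 'I_N -> 'I_N -> 'I_N -> R).
Hypothesis tA : is_tensor A.

Lemma expR_tangent (u c : R) : expR c * (1 + (u - c)) <= expR u.
Proof.
have -> : expR u = expR c * expR (u - c) by rewrite -expRD addrC subrK.
by rewrite ler_wpM2l ?expR_ge0// expR_ge1Dx.
Qed.

Section product_tilt.
Variable l : R.
Local Notation G := (gmean km kp mu A 0 l).

(** At [b = 0] the Gibbs measure is a product of tilts and conditional means are constantly [t l],
    so [gmean_null] turns into independence. *)
Let G_spin j F : bmN F -> (forall x z, F (set_coord x j z) = F x) ->
  G (fun x => tnth x j * F x) = t l * G F.
Proof.
move=> bF Fj; have := gmean_null km_lt_kp mu_on 0 l tA bF Fj.
have cmE x : cond_mean km kp mu A 0 l x j = t l.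
  by rewrite /cond_mean mul0r add0r.
rewrite -(gmeanZ mu A 0 l (t l) bF) => h0; apply/eqP; rewrite -subr_eq0; apply/eqP.
rewrite -[RHS]h0 -(gmeanB mu A 0 l)//; last 2 first.
- by apply: bmeasM => //; exact: bmeas_tnth.
- by apply: bmeasM => //; exact: bmeas_cst.
by apply: eq_gmean => x _; rewrite cmE; ring.
Qed.

Let G_one : G (fun=> 1) = 1.
Proof. exact: (gmean_cst mu_on). Qed.

Lemma gmean_spin j : G (fun x => tnth x j) = t l.
Proof.
have := @G_spin j (fun=> 1) (bmeas_cst _ 1) (fun _ _ => erefl).
by rewrite G_one mulr1 => <-; apply: eq_gmean => x _; rewrite mulr1.
Qed.

Lemma gmean_cubic i j k :
  G (fun x => A i j k * tnth x i * tnth x j * tnth x k) = A i j k * t l ^+ 3.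
Proof.
have [ij|ij] := eqVneq i j.
  have A0 : A i j k = 0.
    by rewrite ij (tensor_sym23 tA) (tensor_sym12 tA) (tensor_diag tA).
  rewrite mulrC A0 mulr0 -[RHS](gmean_cst mu_on A 0 l).
  by apply: eq_gmean => x _; rewrite !mul0r.
have [ik|ik] := eqVneq i k.
  have A0 : A i j k = 0 by rewrite ik (tensor_sym12 tA) (tensor_diag tA).
  rewrite mulrC A0 mulr0 -[RHS](gmean_cst mu_on A 0 l).
  by apply: eq_gmean => x _; rewrite !mul0r.
have [jk|jk] := eqVneq j k.
  have A0 : A i j k = 0 by rewrite jk (tensor_diag tA).
  rewrite mulrC A0 mulr0 -[RHS](gmean_cst mu_on A 0 l).
  by apply: eq_gmean => x _; rewrite !mul0r.
have bt m : bmN (fun x => tnth x m : R) by exact: bmeas_tnth.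
transitivity (A i j k * G (fun x => tnth x i * (tnth x j * tnth x k))).
  rewrite -(gmeanZ mu A 0 l)//; last by apply: bmeasM => //; apply: bmeasM.
  by apply: eq_gmean => x _; ring.
congr (_ * _); rewrite G_spin; last 2 first.
- exact: bmeasM.
- by move=> x z; rewrite !tnth_set_coord ![_ == i]eq_sym (negbTE ij) (negbTE ik).
rewrite G_spin//; last first.
  by move=> x z; rewrite tnth_set_coord eq_sym (negbTE jk).
by rewrite gmean_spin !exprS expr0 mulr1.
Qed.

(* Jensen's inequality under the product measure tilted by [l]. *)
Lemma EN_weight_ge (b h : R) :
  expR (N%:R * L l + (b / 3 * (t l ^+ 3 * \sum_i \sum_j \sum_k A i j k)
    + (h - l) * (N%:R * t l))) <=
  EN (fun x => expR (hamiltonian A b h x)).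
Proof.
(* The tilt by [l] is moved into the reference measure, which leaves the field [h - l]. *)
pose u x := hamiltonian A b (h - l) x.
have bu : bmN u by exact: bmeas_hamiltonian.
have Gu : G u = b / 3 * (t l ^+ 3 * \sum_i \sum_j \sum_k A i j k)
    + (h - l) * (N%:R * t l).
  have bt m : bmN (fun x => tnth x m : R) by exact: bmeas_tnth.
  have bc i j k : bmN (fun x => A i j k * tnth x i * tnth x j * tnth x k).
    apply: bmeasM => //; apply: bmeasM => //; apply: bmeasM => //.
    exact: bmeas_cst.
  have bs1 : bmN (fun x => \sum_i tnth x i : R) by exact: bmeas_sum.
  have bs3 : bmN (fun x => \sum_i \sum_j \sum_k A i j k * tnth x i * tnth x j * tnth x k).
    by do 3 (apply: bmeas_sum => ?); exact: bc.
  rewrite /u /hamiltonian (gmeanD mu A 0 l); last 2 first.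
  - by apply: bmeasM => //; exact: bmeas_cst.
  - by apply: bmeasM => //; exact: bmeas_cst.
  rewrite !(gmeanZ mu A 0 l)//; congr (_ * _ + _ * _).
    rewrite (gmean_sum mu)//; last first.
      by move=> i; do 2 (apply: bmeas_sum => ?); exact: bc.
    rewrite mulr_sumr; apply: eq_bigr => i _.
    rewrite (gmean_sum mu)//; last by move=> j; apply: bmeas_sum => ?; exact: bc.
    rewrite mulr_sumr; apply: eq_bigr => j _.
    rewrite (gmean_sum mu)//.
    rewrite mulr_sumr; apply: eq_bigr => k _.
    by rewrite gmean_cubic mulrC.
  rewrite (gmean_sum mu)//; under eq_bigr do rewrite gmean_spin.
  by rewrite sumr_const card_ord -(mulr_natl (t l)).
rewrite -Gu; set c := G u.
have EL : EN (fun x : N.-tuple T => expR (hamiltonian A 0 l x)) = expR (N%:R * L l).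
  rewrite -[RHS]mul1r -[X in _ = X * _](EN_tilt (fun=> l)) /expectN -expectZr//.
  - apply: eq_expect => x _; rewrite -expRD; congr expR.
    rewrite /hamiltonian !mul0r add0r sumrB -mulr_sumr sumr_const card_ord.
    by rewrite -(mulr_natl (L l)) subrK.
  - exact: measurable_box.
  - apply: bmeas_expR; apply: bmeas_sum => i; apply: bmeasB; last exact: bmeas_cst.
    by apply: bmeasM; [exact: bmeas_cst|exact: bmeas_tnth].
(* The tangent of the exponential at the mean [c] of [u] has mean [expR c]; this is the whole of
   Jensen's inequality. *)
have G1 : G (fun x => expR c * (1 + (u x - c))) = expR c.
  have b1 : bmN (fun x => 1 + (u x - c)).
    apply: bmeasD; first exact: bmeas_cst.
    by apply: bmeasB => //; exact: bmeas_cst.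
  rewrite (gmeanZ mu A 0 l)// (gmeanD mu A 0 l); last 2 first.
  - exact: bmeas_cst.
  - by apply: bmeasB => //; exact: bmeas_cst.
  rewrite (gmeanB mu A 0 l)//; last exact: bmeas_cst.
  by rewrite !(gmean_cst mu_on) subrr addr0 mulr1.
have G2 : expR c <= G (fun x => expR (u x)).
  rewrite -[leLHS]G1; apply: (le_gmean mu_on).
  - apply: bmeasM; first exact: bmeas_cst.
    apply: bmeasD; first exact: bmeas_cst.
    by apply: bmeasB => //; exact: bmeas_cst.
  - exact: bmeas_expR.
  - by move=> x _; exact: expR_tangent.
rewrite expRD -EL mulrC.
have E0 := EN_weight_gt0 mu_on A 0 l.
rewrite -ler_pdivlMr//; apply: (le_trans G2); rewrite /gmean.
rewrite ler_wpM2r ?invr_ge0 ?(ltW E0)//.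
rewrite le_eqVlt; apply/orP; left; apply/eqP; apply: eq_expect => x _.
by rewrite -expRD; congr expR; rewrite /u /hamiltonian; ring.
Qed.

End product_tilt.

(* Covering argument: on [S] the energy is dominated, up to [B], by one of
   [#|J|] product tilts, each of which has total mass one. *)
Lemma gmean_cover (J : finType) (th : J -> 'I_N -> R) (b h B Z : R)
    (S : set (N.-tuple T)) : measurable S ->
  (forall x, bx x -> S x -> exists a, hamiltonian A b h x <=
     \sum_i (th a i * tnth x i - L (th a i)) + B) ->
  expR Z <= EN (fun x => expR (hamiltonian A b h x)) ->
  gmean km kp mu A b h \1_S <= #|J|%:R * expR (B - Z).
Proof.
move=> mS cov EZ; have E0 := EN_weight_gt0 mu_on A b h.
rewrite /gmean ler_pdivrMr//.
have bthx a : bmN (fun x : N.-tuple T => expR (\sum_i (th a i * tnth x i - L (th a i)))).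
  apply: bmeas_expR; apply: bmeas_sum => i; apply: bmeasB; last exact: bmeas_cst.
  by apply: bmeasM; [exact: bmeas_cst|exact: bmeas_tnth].
have mb : measurable bx by exact: measurable_box.
apply: (@le_trans _ _ (#|J|%:R * expR B)); last first.
  rewrite -mulrA ler_wpM2l// expRD -mulrA -[leLHS]mulr1 ler_wpM2l ?expR_ge0//.
  by rewrite expRN ler_pdivlMl ?expR_gt0// mulr1.
apply: (@le_trans _ _ (EN (fun x : N.-tuple T => \sum_(a : J)
    expR (\sum_i (th a i * tnth x i - L (th a i))) * expR B))).
  apply: le_expect => //.
  - apply: bmeasM; [exact: bmeas_indic|exact: bmeas_weight].
  - by apply: bmeas_sum => a; apply: bmeasM => //; exact: bmeas_cst.
  move=> x Bx; rewrite indicE; case: (boolP (x \in S)) => [/set_mem Sx|_]; last first.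
    by rewrite mul0r; apply: sumr_ge0 => a _; rewrite mulr_ge0// expR_ge0.
  rewrite mul1r; have [a ha] := cov x Bx Sx.
  rewrite (bigD1 a)//= -[leLHS]addr0; apply: lerD.
    by rewrite -expRD ler_expR.
  by apply: sumr_ge0 => c _; rewrite mulr_ge0// expR_ge0.
rewrite /expectN expect_sum//; last first.
  by move=> a; apply: bmeasM => //; exact: bmeas_cst.
rewrite le_eqVlt; apply/orP; left; apply/eqP.
rewrite (eq_bigr (fun=> expR B)).
  by rewrite sumr_const -(mulr_natl (expR B)).
move=> a _; rewrite expectZr//.
by have := EN_tilt (th a); rewrite /expectN => ->; rewrite mul1r.
Qed.

End tilting.

(** * Bounds for a realization in terms of block averages *)

Section block_bounds.
Context (R : realType) (km kp : R) (g : R * R * R -> R) (N K : nat).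
Local Notation T := (measurableTypeR R).
Local Notation M := (`|km| + `|kp|).
Local Notation Ag := (@grid_tensor R g N).
Hypotheses (N0 : (0 < N)%N) (K0 : (0 < K)%N).
Hypothesis g_sym : symmetric3 g.
Hypothesis g_01 : forall p, cube p -> 0 <= g p <= 1.
Variable xi : hypergraph N.
Hypothesis xi_good : xi \in good_hypergraphs g N.
Local Notation A := (tensor R xi).
Variables (gam c0 w : R).
Hypotheses (gam0 : 0 <= gam) (g_gam : forall p, cube p -> gam <= g p)
  (deg_c0 : forall i : 'I_N, `|\sum_j \sum_k Ag i j k - c0| <= w) (w0 : 0 <= w).
Hypothesis g_osc : forall i i' j k : 'I_N, block N0 K0 i = block N0 K0 i' ->
  `|g (node R i, node R j, node R k) - g (node R i', node R j, node R k)| <= w.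
Variable x : N.-tuple T.
Hypothesis Bx : box km kp x.
Local Notation y := (bavg N0 K0 (tnth x : 'I_N -> R)).

Let NR : 0 < N%:R :> R. Proof. by rewrite ltr0n. Qed.
Let M0 : 0 <= M. Proof. by rewrite addr_ge0. Qed.
Let xM i : `|(tnth x i : R)| <= M. Proof. exact: tnth_norm. Qed.
Let yM i : `|y i| <= M. Proof. exact: bavg_norm. Qed.
Let g_le1 p : cube p -> g p <= 1. Proof. by move=> /g_01 /andP[]. Qed.

Lemma bavg_itv i : km <= y i <= kp.
Proof.
have xI j : km <= (tnth x j : R) <= kp by have := Bx j; rewrite /= in_itv.
apply/andP; split; first by apply: bavg_ge => j _; have /andP[] := xI j.
by apply: bavg_le => j _; have /andP[] := xI j.
Qed.

(** Chains the passages from the tensor to the grid, from spins to block averages, and from averages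
    to their absolute values. Here [7 = 6 + 1] joins the block and degree errors, [55 = 165 / 3] is
    the tensor error, and [18 = 3 * 6] scales the AM-GM deficit. *)
Lemma hamiltonian_block_ub (b h : R) : 0 <= b ->
  hamiltonian A b h x <= \sum_i energy (b / 3 * c0) h `|y i| +
  N%:R * (7 * (b / 3) * w * M ^+ 3) + 55 * b * M ^+ 3 -
  N%:R * (b * gam / 18 * gap_sum y 3 + h * negative_part y).
Proof.
move=> b0; have b3 : 0 <= b / 3 by rewrite divr_ge0.
have h1 := cubic_close g_sym g_01 N0 xi_good M0 xM.
have h2 := grid_cubic_block w0 M0 xM g_sym g_osc.
have h3 := cubic_deficit N0 M0 yM g_sym gam0 g_gam deg_c0.
have h4 : \sum_i (tnth x i : R) * quad_field A (tnth x) i <=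
    N%:R * (avg (fun i => c0 * `|y i| ^+ 3) + w * M ^+ 3 - gam / 6 * gap_sum y 3) +
    6 * w * M ^+ 3 * N%:R + 165 * M ^+ 3.
  move: h1 h2; rewrite !ler_norml => /andP[_ h1] /andP[_ h2]; move: h1 h2 h3.
  set s1 := \sum_i _ * quad_field A _ _; set s2 := \sum_i _ * quad_field Ag (tnth x) _.
  set s3 := \sum_i _ * quad_field Ag y _; set B := N%:R * (_ - _).
  set B1 := 165 * _; set B2 := 6 * w * _ * _; lra.
have h5 : h * \sum_i (tnth x i : R) =
    N%:R * (avg (fun i => h * `|y i|) - h * negative_part y).
  rewrite -(sum_bavg N0 K0) /negative_part -avgZ.
  have -> : avg (fun i => h * `|y i|) - avg (fun i => h * (`|y i| - y i)) =
      avg (fun i => h * y i).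
    rewrite -mulN1r -avgZ -avgD; apply: eq_avg => i; ring.
  by rewrite /avg mulVKf ?gt_eqF// mulr_sumr.
have h6 : \sum_i energy (b / 3 * c0) h `|y i| =
    N%:R * (b / 3 * avg (fun i => c0 * `|y i| ^+ 3) + avg (fun i => h * `|y i|)).
  rewrite -avgZ -avgD /avg mulVKf ?gt_eqF//; apply: eq_bigr => i _.
  by rewrite /energy mulrA.
rewrite /hamiltonian cubicE h6 h5.
have := ler_wpM2l b3 h4; rewrite [local_field A x]/local_field.
rewrite -/(quad_field A (tnth x)).
set s := \sum_i _ * _; set u := avg _; set v := avg _; set q := gap_sum _ _.
set r := negative_part _ => h7.
apply: (@le_trans _ _ (b / 3 * (N%:R * (u + w * M ^+ 3 - gam / 6 * q) +
     6 * w * M ^+ 3 * N%:R + 165 * M ^+ 3) + N%:R * (v - h * r))).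
  by rewrite lerD2r.
by rewrite le_eqVlt; apply/orP; left; apply/eqP; field.
Qed.

Lemma Tstat_block_ub : Tstat A x <=
  4 * (666 * M ^+ 4 / N%:R + (4 * w * M ^+ 2) ^+ 2 + M ^+ 4 * w ^+ 2) +
  32 * M ^+ 3 * spread y.
Proof.
rewrite TstatE.
apply: (@field_variance R N N0 _ M M0 yM g gam c0 w gam0 g_gam deg_c0 g_le1
  (local_field A x) (quad_field Ag (tnth x))).
  rewrite /avg mulrC ler_wpM2r ?invr_ge0 ?(ltW NR)//.
  exact: (quad_field_close g_sym g_01 N0 xi_good M0 xM).
by move=> i; exact: (grid_field_block w0 M0 xM g_sym g_osc).
Qed.

End block_bounds.

Lemma tensor_mass (R : realType) (g : R * R * R -> R) (N : nat) (xi : hypergraph N)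
    (c0 w : R) : (0 < N)%N -> symmetric3 g ->
  (forall p, cube p -> 0 <= g p <= 1) -> xi \in good_hypergraphs g N ->
  (forall i : 'I_N, `|\sum_j \sum_k grid_tensor g i j k - c0| <= w) ->
  `|\sum_i \sum_j \sum_k tensor R xi i j k - N%:R * c0| <= 165 + N%:R * w.
Proof.
move=> N0 g_sym g_01 xi_good deg_c0; pose one (_ : 'I_N) : R := 1.
have one1 i : `|one i| <= 1 by rewrite /one normr1.
have qE (B : 'I_N -> 'I_N -> 'I_N -> R) :
    \sum_i one i * quad_field B one i = \sum_i \sum_j \sum_k B i j k.
  apply: eq_bigr => i _; rewrite mul1r; apply: eq_bigr => j _.
  by apply: eq_bigr => k _; rewrite !mulr1.
have := cubic_close g_sym g_01 N0 xi_good ler01 one1.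
rewrite !qE expr1n mulr1 => h1.
have h2 : `|\sum_(i < N) \sum_j \sum_k grid_tensor g i j k - N%:R * c0| <= N%:R * w.
  have -> : N%:R * c0 = \sum_(i < N) c0.
    by rewrite [RHS]sumr_const card_ord mulr_natl.
  rewrite -sumrB; apply: (le_trans (ler_norm_sum _ _ _)).
  have -> : N%:R * w = \sum_(i < N) w.
    by rewrite [RHS]sumr_const card_ord mulr_natl.
  by apply: ler_sum => i _; exact: deg_c0.
apply: le_trans (lerD h1 h2).
by apply: le_trans (ler_normD _ _); rewrite addrA subrK.
Qed.

(** * Main results *)

Section concentration.
Context (R : realType) (km kp : R) (mu : probability (measurableTypeR R) R).
Context (g : R * R * R -> R) (b h : R).
Hypotheses (km_lt_kp : km < kp) (mu_on : mu [set` `[km, kp]] = 1%E).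
Hypotheses (km_supp : supp mu km) (kp_supp : supp mu kp).
Hypothesis g_sym : symmetric3 g.
Hypothesis g_cont : {within @cube R, continuous g}.
Hypothesis g_01 : forall p, cube p -> 0 <= g p <= 1.
Hypothesis g_deg : forall x, 0 <= x <= 1 -> degree_fun g x = mean_density g.
Hypothesis g_inf : 0 < inf (g @` @cube R).
Hypothesis mu_nonneg : stochastically_nonneg mu.
Hypotheses (b0 : 0 < b) (h0 : 0 <= h) (hk : 0 < h \/ 0 <= km).
Local Notation T := (measurableTypeR R).
Local Notation M := (`|km| + `|kp|).
Local Notation gam := (inf (g @` @cube R)).
Local Notation c0 := (mean_density g).
Local Notation t := (tmean km kp mu).
Local Notation L := (Lambda mu).
Local Notation V := (pressure km kp mu (b / 3 * c0) h).

Let M_gt0 : 0 < M.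
Proof.
have := normr_ge0 km; have := normr_ge0 kp; rewrite lt_neqAle addr_ge0// andbT eq_sym.
rewrite paddr_eq0// !normr_eq0; case: eqP => // km0; case: eqP => // kp0.
by move: km_lt_kp; rewrite km0 kp0 ltxx.
Qed.
Let M0 : 0 <= M. Proof. exact: ltW. Qed.

Let g_gam p : cube p -> gam <= g p.
Proof.
move=> cp; apply: ge_inf; last by exists p.
by exists 0 => _ [q cq <-]; have /andP[] := g_01 cq.
Qed.

Lemma small_oscillation (D e : R) : 0 < D -> 0 < e -> exists w : R,
  [/\ 0 < w, 8 * (b / 3) * w * M ^+ 3 <= D / 4 &
      4 * ((4 * w * M ^+ 2) ^+ 2 + M ^+ 4 * w ^+ 2) <= e / 4].
Proof.
move=> D0 e0; have M3 : 0 < M ^+ 3 by rewrite exprn_gt0.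
have M4 : 0 < M ^+ 4 by rewrite exprn_gt0.
(* The bound [w <= 1] replaces [w ^+ 2] by [w]; then [68 = 4 * (16 + 1)] and [272 = 4 * 68]. *)
pose w := Num.min 1 (Num.min (D / (16 * (b * M ^+ 3))) (e / (272 * M ^+ 4))).
have d1 : 0 < 16 * (b * M ^+ 3) by do 2 rewrite mulr_gt0//.
have d2 : 0 < 272 * M ^+ 4 by rewrite mulr_gt0.
have w0 : 0 < w by rewrite !lt_min ltr01 !divr_gt0.
have w1 : w <= 1 by rewrite ge_min lexx.
have w2 : w * (16 * (b * M ^+ 3)) <= D by rewrite -ler_pdivlMr// !ge_min lexx !orbT.
have w3 : w * (272 * M ^+ 4) <= e by rewrite -ler_pdivlMr// !ge_min lexx !orbT.
exists w; split=> //.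
  have : 0 <= w * (b * M ^+ 3) by apply: mulr_ge0; [exact: ltW|apply/ltW/mulr_gt0].
  have -> : 8 * (b / 3) * w * M ^+ 3 = 8 / 3 * (w * (b * M ^+ 3)) by ring.
  move: w2; have -> : w * (16 * (b * M ^+ 3)) = 16 * (w * (b * M ^+ 3)) by ring.
  by set u := w * (_ * _); lra.
have -> : 4 * ((4 * w * M ^+ 2) ^+ 2 + M ^+ 4 * w ^+ 2) = 68 * (M ^+ 4 * w) * w.
  by ring.
apply: (@le_trans _ _ (68 * (M ^+ 4 * w) * 1)).
  apply: ler_wpM2l => //; apply: mulr_ge0 => //.
  by apply: mulr_ge0; apply: ltW.
move: w3; have -> : w * (272 * M ^+ 4) = 272 * (M ^+ 4 * w) by ring.
by set u := _ * w; lra.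
Qed.

Section realization.
Variables (N K : nat) (N0 : (0 < N)%N) (K0 : (0 < K)%N).
Variable xi : hypergraph N.
Hypothesis xi_good : xi \in good_hypergraphs g N.
Local Notation A := (tensor R xi).
Local Notation Ag := (@grid_tensor R g N).
Variables (w eta D0 eps : R).
Hypotheses (w0 : 0 <= w)
  (deg_c0 : forall i : 'I_N, `|\sum_j \sum_k Ag i j k - c0| <= w).
Hypothesis g_osc : forall i i' j k : 'I_N, block N0 K0 i = block N0 K0 i' ->
  `|g (node R i, node R j, node R k) - g (node R i', node R j, node R k)| <= w.
Variable s : seq R.
Hypothesis s_net : forall z, km <= z <= kp -> exists2 l, l \in s &
  energy (b / 3 * c0) h `|z| - (l * z - L l) <= V + eta.
Hypothesis small_T : 4 * (666 * M ^+ 4 / N%:R +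
  (4 * w * M ^+ 2) ^+ 2 + M ^+ 4 * w ^+ 2) <= eps / 2.
Hypothesis deficit : forall y : 'I_N -> R, (forall i, km <= y i <= kp) ->
  eps / (64 * M ^+ 3) <= spread y ->
  D0 <= b * gam / 18 * gap_sum y 3 + h * negative_part y.

Let NR : 0 < N%:R :> R. Proof. by rewrite ltr0n. Qed.

(** Each block takes the tilt from [s] that suits its average. As the tilt is constant on blocks,
    its linear term is the same for [x] and for the block averages, so the bound for the averages is
    a product tilt in [x]. *)
Lemma hamiltonian_cover (x : N.-tuple T) : box km kp x -> eps < Tstat A x ->
  exists a : {ffun 'I_K -> 'I_(size s)}, hamiltonian A b h x <=
    \sum_i (s`_(a (block N0 K0 i)) * tnth x i - L s`_(a (block N0 K0 i))) +
    (N%:R * (V + eta + 7 * (b / 3) * w * M ^+ 3 - D0) + 55 * b * M ^+ 3).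
Proof.
move=> Bx Tx; pose y := bavg N0 K0 (tnth x : 'I_N -> R).
have yI i : km <= y i <= kp by exact: bavg_itv.
have net_nth z : km <= z <= kp -> exists m : 'I_(size s),
    energy (b / 3 * c0) h `|z| - (s`_m * z - L s`_m) <= V + eta.
  move=> zI; have [l ls hl] := s_net zI.
  have ms : (index l s < size s)%N by rewrite index_mem.
  by exists (Ordinal ms); rewrite /= nth_index.
(* Serves only to show that [s] is non-empty, which provides a default tilt for empty blocks. *)
have km_itv : km <= km <= kp by rewrite lexx ltW.
have [m0 _] := net_nth km km_itv.
have /fin_all_exists[a ha] (c : 'I_K) : exists m : 'I_(size s), forall i,
    block N0 K0 i = c ->
    energy (b / 3 * c0) h `|y i| - (s`_m * y i - L s`_m) <= V + eta.
  have [/existsP[i /eqP ic]|/existsPn none] := boolP [exists i, block N0 K0 i == c].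
    have [m hm] := net_nth _ (yI i); exists m => j jc.
    by rewrite /y (bavg_block _ (_ : block N0 K0 j = block N0 K0 i)) ?jc ?ic.
  by exists m0 => i ic; have := none i; rewrite ic eqxx.
exists (finfun a).
under eq_bigr do rewrite ffunE.
have h1 := hamiltonian_block_ub g_sym g_01 xi_good (ltW g_inf) g_gam deg_c0 w0
  g_osc Bx h (ltW b0).
have h2 : \sum_i energy (b / 3 * c0) h `|y i| <=
    \sum_i (s`_(a (block N0 K0 i)) * tnth x i - L s`_(a (block N0 K0 i))) +
    N%:R * (V + eta).
  rewrite sumrB -(sum_block N0 K0 (fun c => s`_(a c))) -sumrB.
  have -> : N%:R * (V + eta) = \sum_(i < N) (V + eta).
    by rewrite [RHS]sumr_const card_ord mulr_natl.
  rewrite -big_split/=; apply: ler_sum => i _; rewrite -lerBlDl.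
  exact: ha.
have h3 : D0 <= b * gam / 18 * gap_sum y 3 + h * negative_part y.
  apply: deficit => //.
  (* The other errors take at most [eps / 2], so [32 * M ^+ 3 * spread y] exceeds [eps / 2]; hence
     the 64. *)
  have := Tstat_block_ub g_sym g_01 xi_good (ltW g_inf) g_gam deg_c0 w0 g_osc Bx.
  rewrite -/y => h3; rewrite ler_pdivrMr ?mulr_gt0 ?exprn_gt0//.
  have -> : spread y * (64 * M ^+ 3) = 2 * (32 * M ^+ 3 * spread y) by ring.
  move: Tx small_T h3; set u := 32 * _ * _; set v := 4 * _; set z := Tstat _ _.
  lra.
have h4 := ler_wpM2l (ltW NR) h3.
apply: (le_trans h1); rewrite -/y; move: h2 h4; rewrite !(mulrDr N%:R) mulrN.
set u := \sum_i _; set v := \sum_i _; set q := N%:R * (7 * _ * _ * _).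
set r1 := N%:R * (_ * gap_sum _ _); set r2 := N%:R * (h * _).
set r3 := N%:R * V; set r4 := N%:R * eta; set r5 := 55 * _ * _; lra.
Qed.

Lemma weight_lb l : V - eta <= tilt_value km kp mu (b / 3 * c0) h l ->
  expR (N%:R * (V - eta) - b / 3 * M ^+ 3 * (165 + N%:R * w)) <=
  expectN km kp mu (fun x : N.-tuple T => expR (hamiltonian A b h x)).
Proof.
move=> Vl; have tA := tensor_is_tensor R xi.
apply: le_trans (EN_weight_ge km_lt_kp mu_on tA l b h); rewrite ler_expR.
have h1 := tensor_mass N0 g_sym g_01 xi_good deg_c0.
set SA := \sum_i \sum_j \sum_k A i j k in h1 *.
have h2 : `|t l ^+ 3 * (SA - N%:R * c0)| <= M ^+ 3 * (165 + N%:R * w).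
  rewrite normrM; apply: ler_pM => //.
  by rewrite normrX ler_pXn2r ?nnegrE// tmean_norm.
have h3 : b / 3 * - (t l ^+ 3 * (SA - N%:R * c0)) <= b / 3 * (M ^+ 3 * (165 + N%:R * w)).
  apply: ler_wpM2l; first by rewrite divr_ge0// ltW.
  by move: h2; rewrite ler_norml lerNl => /andP[].
have h4 := ler_wpM2l (ltW NR) Vl.
have h5 : N%:R * L l + (b / 3 * (t l ^+ 3 * SA) + (h - l) * (N%:R * t l)) =
    N%:R * tilt_value km kp mu (b / 3 * c0) h l -
    b / 3 * - (t l ^+ 3 * (SA - N%:R * c0)).
  by rewrite /tilt_value /energy; ring.
rewrite h5 -(mulrA (b / 3) (M ^+ 3)).
by apply: lerB.
Qed.

(** The pressure cancels between upper and lower bound. Of the gain [D0], the two [eta] cost at most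
    [D0 / 4] and the oscillation, [8 = 7 + 1] times, another [D0 / 4]. The tensor error enters both
    bounds, whence [110 = 2 * 55]. *)
Lemma gmean_Tstat_tail l : eta <= D0 / 8 -> 8 * (b / 3) * w * M ^+ 3 <= D0 / 4 ->
  V - eta <= tilt_value km kp mu (b / 3 * c0) h l ->
  gmean km kp mu A b h \1_[set x | eps < Tstat A x] <=
  (size s ^ K)%:R * expR (110 * b * M ^+ 3) * expR (- (N%:R * (D0 / 2))).
Proof.
move=> eD wD Vl.
have mS : measurable [set x : N.-tuple T | eps < Tstat A x].
  by apply: measurable_gt; case: (bmeas_Tstat km kp A).
apply: (le_trans (gmean_cover mu_on (J := {ffun 'I_K -> 'I_(size s)})
  (th := fun a i => s`_(a (block N0 K0 i))) mS hamiltonian_cover (weight_lb Vl))).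
rewrite card_ffun !card_ord -[leRHS]mulrA; apply: ler_wpM2l => //.
rewrite -expRD ler_expR.
have h1 : N%:R * (8 * (b / 3) * w * M ^+ 3 + eta + eta - D0) <= N%:R * - (D0 / 2).
  by apply: ler_wpM2l; [exact: ltW|lra].
apply: (@le_trans _ _ (110 * b * M ^+ 3 +
    N%:R * (8 * (b / 3) * w * M ^+ 3 + eta + eta - D0))).
  by rewrite le_eqVlt; apply/orP; left; apply/eqP; field.
by rewrite -mulrN; apply: lerD.
Qed.

End realization.

Lemma littleo_P_Tstat (xi : forall N, hypergraph N) :
  (\forall N \near \oo, xi N \in good_hypergraphs g N) ->
  littleo_P (fun N => gibbs mu (tensor R (xi N)) b h)
    (fun N => Tstat (tensor R (xi N))).
Proof.
move=> xi_good eps eps0.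
have M3 : 0 < M ^+ 3 by rewrite exprn_gt0.
have W00 : 0 < eps / (64 * M ^+ 3) by rewrite divr_gt0// mulr_gt0.
have k0 : 0 < b * gam / 18 by rewrite divr_gt0// mulr_gt0.
have [D0 D00 deficit] := deficit_lb kp W00 k0 h0 hk.
have [w [w0 wD weps]] := small_oscillation D00 eps0.
have [e e0 ucg] := kernel_unif_continuous g_cont w0.
have eta0 : 0 < D0 / 8 by rewrite divr_gt0.
have [s s_net] := rate_net mu_on km_supp kp_supp mu_nonneg (b / 3 * c0) h eta0.
have [l Vl] := pressure_approx mu_on (b / 3 * c0) h eta0.
pose K := (Num.truncn e^-1).+1.
have K0 : (0 < K)%N by [].
have Ke : K%:R^-1 < e.
  by rewrite -[ltRHS]invrK ltf_pV2 ?posrE ?invr_gt0 ?ltr0n// truncnS_gt.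
(* The net and the number of blocks depend on [D0] and [w] but not on [N], so this prefactor is a
   constant. *)
pose C := (size s ^ K)%:R * expR (110 * b * M ^+ 3).
have C0 : 0 <= C by rewrite mulr_ge0 ?expR_ge0.
apply: cvge_to0 => d d0; near=> N.
have N0 : (0 < N)%N by near: N; exact: nbhs_infty_gt.
have NR : 0 < N%:R :> R by rewrite ltr0n.
have xig : xi N \in good_hypergraphs g N by near: N.
have Ne : e^-1 < N%:R by near: N; exact: near_natr_gt.
have Nd : C / (d * (D0 / 2)) < N%:R by near: N; exact: near_natr_gt.
have NT : 666 * M ^+ 4 / (eps / 16) < N%:R by near: N; exact: near_natr_gt.
have Ne' : N%:R^-1 < e by rewrite -[ltRHS]invrK ltf_pV2 ?posrE ?invr_gt0.
have deg_c0 (i : 'I_N) : `|\sum_j \sum_k grid_tensor g i j k - c0| <= w.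
  have := degree_riemann g_01 N0 w0 (node_itv R N0 i) ucg Ne'.
  rewrite g_deg ?node_itv// distrC; congr (`|_ - _| <= _).
  by rewrite mulr_sumr; apply: eq_bigr => j _; rewrite mulr_sumr.
have osc (i i' j k : 'I_N) : block N0 K0 i = block N0 K0 i' ->
    `|g (node R i, node R j, node R k) - g (node R i', node R j, node R k)| <= w.
  move=> ii; apply: ucg; try exact: cube_node.
  split; last exact: ballxx.
  split; last exact: ballxx.
  by apply: le_lt_trans Ke; exact: block_node_dist ii.
have small_T : 4 * (666 * M ^+ 4 / N%:R +
    (4 * w * M ^+ 2) ^+ 2 + M ^+ 4 * w ^+ 2) <= eps / 2.
  have h1 : 666 * M ^+ 4 / N%:R <= eps / 16.
    by rewrite ler_pdivrMr// [leRHS]mulrC -ler_pdivrMr ?divr_gt0// ltW.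
  move: h1 weps; set u := 666 * _ / _; set v := _ ^+ 2; set q := _ * w ^+ 2; lra.
pose A := tensor R (xi N).
have T0 x : 0 <= Tstat A x by apply: avg_ge0 => i; exact: sqr_ge0.
have -> : [set x : N.-tuple T | eps < `|Tstat A x|] = [set x | eps < Tstat A x].
  by apply/funext => x /=; rewrite ger0_norm.
rewrite (gibbsE mu_on); last by apply: measurable_gt; case: (bmeas_Tstat km kp A).
rewrite !lee_fin; apply/andP; split.
  by apply: (gmean_ge0 mu_on) => x _; rewrite indicE.
have := gmean_Tstat_tail xig (ltW w0) deg_c0 osc s_net small_T
  (fun y yI => deficit N y N0 yI) (lexx _) wD Vl.
move=> h1; apply: (le_trans h1); rewrite -/C.
have D2 : 0 < D0 / 2 by rewrite divr_gt0.
have z0 : 0 < N%:R * (D0 / 2) by rewrite mulr_gt0.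
rewrite expRN ler_pdivrMr ?expR_gt0//.
(* The linear bound [z <= expR z] already beats the constant [C]. *)
apply: (@le_trans _ _ (d * (N%:R * (D0 / 2)))).
  have -> : d * (N%:R * (D0 / 2)) = N%:R * (d * (D0 / 2)) by ring.
  by rewrite -ler_pdivrMr ?mulr_gt0// ltW.
apply: ler_wpM2l; first exact: ltW.
by apply: (le_trans _ (expR_ge1Dx _)); rewrite lerDr.
Unshelve. all: by end_near. Qed.

End concentration.

Theorem theorem2p5 (R : realType) (km kp : R)
    (mu : probability (measurableTypeR R) R)
    (g : R * R * R -> R) (b0 h0 : R)
    (km_lt_kp : km < kp)
    (mu_on : mu [set` `[km, kp]] = 1%E)
    (km_supp : supp mu km) (kp_supp : supp mu kp)
    (g_sym : symmetric3 g)
    (g_cont : {within @cube R, continuous g})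
    (g_01 : forall p, cube p -> 0 <= g p <= 1) :
  (~ (exists c : R, forall x, 0 <= x <= 1 -> degree_fun g x = c) ->
   derive1 (Lambda mu) h0 != 0 ->
   exists E : forall N, {set hypergraph N},
     hypergraph_prob g (E N) @[N --> \oo] --> (1 : R) /\
     forall xi : forall N, hypergraph N,
       (\forall N \near \oo, xi N \in E N) ->
       let A N := tensor R (xi N) in
       let P N := gibbs mu (A N) b0 h0 in
       [/\ Omega_P P (fun N => Tstat (A N)),
           mple_exists_whp P mu A &
           mple_sqrt_consistent P mu A b0 h0]) /\
  ((forall x, 0 <= x <= 1 -> degree_fun g x = mean_density g) ->
   0 < inf (g @` @cube R) ->
   stochastically_nonneg mu ->
   0 < b0 -> 0 <= h0 -> 0 < h0 \/ 0 <= km ->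
   exists E : forall N, {set hypergraph N},
     hypergraph_prob g (E N) @[N --> \oo] --> (1 : R) /\
     forall xi : forall N, hypergraph N,
       (\forall N \near \oo, xi N \in E N) ->
       let A N := tensor R (xi N) in
       let P N := gibbs mu (A N) b0 h0 in
       littleo_P P (fun N => Tstat (A N))).
Proof.
split=> [nc L0|g_deg g_inf mu_nonneg b00 h00 hk].
  exists (good_hypergraphs g); split; first exact: good_hypergraphs_cvg.
  move=> xi xi_good A P; have [v v0 vdeg] := good_degree_variance g_sym g_cont g_01 nc.
  have th0 : tmean km kp mu h0 != 0 by rewrite -(derive1_Lambda mu_on).
  have A_good : \forall N \near \oo, is_tensor (A N) /\
      forall s, v <= avg (fun i => (degree (A N) i - s) ^+ 2).
    near=> N; split; first exact: tensor_is_tensor.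
    have xig : xi N \in good_hypergraphs g N by near: N.
    have vN : forall xi0 : hypergraph N, xi0 \in good_hypergraphs g N ->
      forall s, v <= avg (fun i => (degree (tensor R xi0) i - s) ^+ 2) by near: N.
    exact: vN.
  split.
  - exact: (Omega_P_Tstat km_lt_kp mu_on b0 v0 th0 A_good).
  - exact: (mple_exists_whp_Tstat km_lt_kp mu_on b0 km_supp kp_supp v0 th0 A_good).
  - exact: (mple_sqrt_consistent_Tstat km_lt_kp mu_on b0 km_supp kp_supp v0 th0 A_good).
exists (good_hypergraphs g); split; first exact: good_hypergraphs_cvg.
move=> xi xi_good A P.
exact: (littleo_P_Tstat km_lt_kp mu_on km_supp kp_supp g_sym g_cont g_01 g_deg
  g_inf mu_nonneg b00 h00 hk xi_good).
Unshelve. all: by end_near. Qed.
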